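(* Let $A=\oplus_{h\in H}A_h$ be a weakly basic graded algebra with enough idempotents, with $(e_i)_{i\in I}$ as a weakly basic distinguished family of orthogonal idempotents. The following assertions are equivalent: 1. $A$ is locally Noetherian and the following conditions hold: (a) for each $i\in I$, $Ae_i$ and $e_iA$ have a simple essential socle in $A\text{-}Gr$ and $Gr\text{-}A$, respectively; (b) there are bijective maps $\nu,\nu':I\longrightarrow I$ such that, for each $i\in I$, $\mathrm{Soc}_{gr}(e_iA)\cong\frac{e_{\nu(i)}A}{e_{\nu(i)}J^{gr}(A)}[h_i]$ and $\mathrm{Soc}_{gr}(Ae_i)\cong\frac{Ae_{\nu'(i)}}{J^{gr}(A)e_{\nu'(i)}}[h'_i]$, for certain $h_i,h'_i\in H$. 2. $A$ is a locally Noetherian graded pseudo-Frobenius algebra. 3. $A$ is graded Quasi-Frobenius.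
   Context: $K$ is a fixed field and $H$ a fixed abelian group, written additively. Algebras are associative $K$-algebras, not necessarily unital. A *graded algebra with enough idempotents* is an $H$-graded algebra $A=\oplus_{h\in H}A_h$ having a family $(e_i)_{i\in I}$ of nonzero orthogonal idempotents, homogeneous of degree $0$, with $\oplus_{i\in I}e_iA=A=\oplus_{i\in I}Ae_i$ (a *distinguished family* ). $A$ is *locally finite dimensional* if $\dim_K e_iA_he_j<\infty$ for all $i,j\in I$, $h\in H$. Modules are unital; $A\text{-}Gr$ (resp. $Gr\text{-}A$) is the category of $H$-graded left (resp. right) $A$-modules with degree $0$ homomorphisms; $M[k]$ is $M$ with grading $M[k]_h=M_{k+h}$. $\mathrm{Soc}_{gr}$ denotes the graded socle (sum of graded-simple submodules). The graded Jacobson radical $J^{gr}(A)$ is the intersection of all maximal graded left ideals of $A$ (equivalently, of all maximal graded right ideals). A locally finite dimensional graded algebra with enough idempotents is *weakly basic* if it has a distinguished family $(e_i)_{i\in I}$ (called *weakly basic* ) such that each $e_iA_0e_i$ is local and $e_iAe_j\subseteq J^{gr}(A)$ for all $i\neq j$. $A$ is *locally Noetherian* if $Ae_i$ and $e_iA$ satisfy ACC on graded submodules for each $i\in I$. A weakly basic $A$ is *graded pseudo-Frobenius* if in $A\text{-}Gr$ (resp. $Gr\text{-}A$) the finitely generated projective objects coincide with the finitely cogenerated injective objects (a graded module is finitely cogenerated if its graded socle is finitely generated and essential). This is equivalent to the existence of a *graded Nakayama form*: a bilinear form $(-,-):A\times A\to K$ with (i) $(ab,c)=(a,bc)$ for all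 $a,b,c$; (ii) for each $i\in I$ there is a unique $\nu(i)\in I$ with $(e_iA,Ae_{\nu(i)})\ne0$, and $\nu:I\to I$ is bijective; (iii) there is $\mathbf h:I\to H$ such that for all $i,j$ the induced form $e_iAe_j\times e_jAe_{\nu(i)}\to K$ is graded of degree $\mathbf h(i)$ (homogeneous components of degrees $h,k$ pair to zero unless $h+k=\mathbf h(i)$) and nondegenerate (it induces bijections of each factor with the graded dual $\oplus_h\mathrm{Hom}_K((\cdot)_h,K)$ of the other). A weakly basic $A$ is *graded Quasi-Frobenius* if $A\text{-}Gr$ and $Gr\text{-}A$ are Frobenius categories, i.e. they have enough projectives and enough injectives and projective and injective objects coincide. *)

(* Defs.v *)
From HB Require Import structures.
From mathcomp Require Import all_boot all_algebra.
From mathcomp Require Import generic_quotient ring_quotient.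
From mathcomp Require Import boolp classical_sets.

Set Implicit Arguments.
Unset Strict Implicit.
Unset Printing Implicit Defensive.
Import GRing.Theory.
Local Open Scope ring_scope.

Reserved Notation "a ** b" (at level 40, left associativity).

Definition is_subspace (K : fieldType) (V : lmodType K) (S : set V) : Prop :=
  S 0 /\ forall (a : K) (x y : V), S x -> S y -> S (a *: x + y).

(* the finite sums of elements of G *)
Definition sums (V : zmodType) (G : set V) : set V :=
  fun x => exists2 s : seq V, (forall y, y \in s -> G y) & x = \sum_(y <- s) y.

Definition direct_sum (K : fieldType) (V : lmodType K) (I : eqType)
    (F : I -> set V) : Prop :=
  [/\ forall i, is_subspace (F i),
      forall x, sums (fun y => exists i, F i y) x
    & forall (s : seq I) (f : I -> V), uniq s -> (forall i, F i (f i)) ->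
        \sum_(i <- s) f i = 0 -> forall i, i \in s -> f i = 0].

Section Sums.
Variables (V : zmodType).
Implicit Types (G S : set V).

Lemma sums0 G : sums G 0.
Proof. by exists [::] => //; rewrite big_nil. Qed.

Lemma sums1 G x : G x -> sums G x.
Proof.
move=> Gx; exists [:: x]; last by rewrite big_seq1.
by move=> y; rewrite inE => /eqP ->.
Qed.

Lemma sumsD G x y : sums G x -> sums G y -> sums G (x + y).
Proof.
move=> [s sG ->] [t tG ->]; exists (s ++ t); last by rewrite big_cat.
by move=> z; rewrite mem_cat => /orP[/sG|/tG].
Qed.

Lemma sums_ind G (P : V -> Prop) : P 0 ->
  (forall y x, G y -> P x -> P (y + x)) -> forall x, sums G x -> P x.
Proof.
move=> P0 PD x [s sG ->]; elim: s sG => [|y s IHs] sG; first by rewrite big_nil.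
rewrite big_cons; apply: PD; first by apply: sG; rewrite mem_head.
by apply: IHs => z zs; apply: sG; rewrite inE zs orbT.
Qed.

End Sums.

Lemma sums_map (V W : zmodType) (G : set V) (G' : set W) (f : V -> W) :
  f 0 = 0 -> {morph f : x y / x + y} -> (forall x, G x -> G' (f x)) ->
  forall x, sums G x -> sums G' (f x).
Proof.
move=> f0 fD fG; apply: sums_ind => [|y x Gy IH].
  by rewrite f0; apply: sums0.
by rewrite fD; apply: sumsD => //; apply: sums1; apply: fG.
Qed.

Lemma big_subset (V : nmodType) (I : eqType) (r r' : seq I) (g : I -> V) :
  uniq r -> uniq r' -> {subset r <= r'} -> (forall i, i \notin r -> g i = 0) ->
  \sum_(i <- r') g i = \sum_(i <- r) g i.
Proof.
move=> ur ur' sr g0; rewrite (bigID (mem r)) /= [X in _ + X]big1 ?addr0.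
  rewrite -big_filter; apply: perm_big; apply: uniq_perm => //.
    exact: filter_uniq.
  by move=> i; rewrite mem_filter; case ir: (i \in r) => //=; rewrite sr.
by move=> i /g0.
Qed.

Section Decomposition.
Variables (K : fieldType) (V : lmodType K) (I : eqType) (F : I -> set V).
Hypothesis dF : direct_sum F.

Let F0 i : F i 0.
Proof. by case: dF => sF _ _; case: (sF i). Qed.

Let FD i x y : F i x -> F i y -> F i (x + y).
Proof.
by case: dF => sF _ _ Fx Fy; rewrite -[x]scale1r; apply: (sF i).2.
Qed.

Let FN i x : F i x -> F i (- x).
Proof.
by case: dF => sF _ _ Fx; rewrite -scaleN1r -[_ *: _]addr0; apply: (sF i).2.
Qed.

Lemma dsum_nf (S : set V) x : S 0 -> (forall y z, S y -> S z -> S (y + z)) ->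
  sums (fun y => S y /\ exists i, F i y) x ->
  exists t (f : I -> V), [/\ uniq t, forall i, F i (f i) /\ S (f i),
    forall i, i \notin t -> f i = 0 & x = \sum_(i <- t) f i].
Proof.
move=> S0 SD; move: x; apply: sums_ind => [|y x [Sy [k Fy]]].
  by exists [::], (fun=> 0); split => //; rewrite big_nil.
move=> [t [f [ut Ff f0 ->]]].
exists (if k \in t then t else k :: t), (fun i => (if i == k then y else 0) + f i).
split.
- by case: ifPn => //= ->.
- move=> i; have [Fi Si] := Ff i.
  by case: eqP => [->|_]; [split; [apply: FD => //; apply: (Ff k).1|apply: SD => //; apply: (Ff k).2] | rewrite add0r].
- move=> i; case: ifPn => [kt it|_].
    by rewrite f0 //; case: eqP it kt => [->|_] => [/negPf ->|]; rewrite ?addr0.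
  by rewrite inE negb_or => /andP[/negPf -> it]; rewrite f0 ?addr0.
- rewrite big_split /=; congr (_ + _).
    rewrite -big_mkcond /=; case: ifPn => kt.
      by rewrite -big_filter filter_pred1_uniq // big_seq1.
    rewrite big_cons eqxx big1_seq ?addr0 // => i /andP[/eqP -> kt'].
    by rewrite kt' in kt.
  by case: ifPn => // kt; rewrite big_cons [f k]f0 // add0r.
Qed.

Lemma dsum_uniq t t' (f f' : I -> V) : uniq t -> uniq t' ->
  (forall i, F i (f i)) -> (forall i, F i (f' i)) ->
  (forall i, i \notin t -> f i = 0) -> (forall i, i \notin t' -> f' i = 0) ->
  \sum_(i <- t) f i = \sum_(i <- t') f' i -> f =1 f'.
Proof.
move=> ut ut' Ff Ff' f0 f'0 E.
pose u := undup (t ++ t').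
have uu : uniq u by apply: undup_uniq.
have Z : \sum_(i <- u) (f i - f' i) = 0.
  rewrite sumrB (@big_subset _ _ t u f) ?(@big_subset _ _ t' u f') ?E ?subrr // => i it.
    by rewrite mem_undup mem_cat it orbT.
  by rewrite mem_undup mem_cat it.
have [_ _ ind] := dF.
move=> i; have [iu|] := boolP (i \in u).
  apply/eqP; rewrite -subr_eq0; apply/eqP.
  apply: (ind u (fun i => f i - f' i)) => // j.
  by apply: FD => //; apply: FN.
by rewrite mem_undup mem_cat negb_or => /andP[/f0 -> /f'0 ->].
Qed.

Lemma dsum_full x : exists t (f : I -> V), [/\ uniq t, forall i, F i (f i),
  forall i, i \notin t -> f i = 0 & x = \sum_(i <- t) f i].
Proof.
have [_ full _] := dF.
have [//|//||t [f [ut Ff f0 ->]]] := @dsum_nf setT x.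
  by have [s sF ->] := full x; exists s => // y /sF.
by exists t, f; split => // i; case: (Ff i).
Qed.

End Decomposition.

Record galgebra (K : fieldType) (H : zmodType) := GAlgebra {
  ga_car :> lmodType K;
  amul : ga_car -> ga_car -> ga_car where "a ** b" := (amul a b);
  amulA : forall a b c, a ** (b ** c) = a ** b ** c;
  amulDl : forall a b c, (a + b) ** c = a ** c + b ** c;
  amulDr : forall a b c, a ** (b + c) = a ** b + a ** c;
  amulZl : forall (k : K) a b, (k *: a) ** b = k *: (a ** b);
  amulZr : forall (k : K) a b, a ** (k *: b) = k *: (a ** b);
  ahom : H -> set ga_car;
  ahom_direct_sum : direct_sum ahom;
  ahom_mul : forall h k a b, ahom h a -> ahom k b -> ahom (h + k) (a ** b) }.

Arguments amul {K H g}.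
Arguments ahom {K H} g.
Local Notation "a ** b" := (amul a b).

(* a distinguished family of orthogonal idempotents *)
Record dfamily (K : fieldType) (H : zmodType) (A : galgebra K H)
    (I : choiceType) := DFamily {
  df :> I -> A;
  df_neq0 : forall i, df i <> 0;
  df_idem : forall i, df i ** df i = df i;
  df_orth : forall i j, i != j -> df i ** df j = 0;
  df_hom : forall i, ahom A 0 (df i);
  df_directr : direct_sum (fun i x => exists a, x = df i ** a);
  df_directl : direct_sum (fun i x => exists a, x = a ** df i) }.

Record galgei (K : fieldType) (H : zmodType) := GAlgEI {
  gae :> galgebra K H;
  gae_enough : exists I : choiceType, inhabited (dfamily gae I) }.

Section Opposite.
Variables (K : fieldType) (H : zmodType).

Definition galg_op (A : galgebra K H) : galgebra K H.
Proof.
refine (@GAlgebra K H A (fun a b => b ** a) _ _ _ _ _ (ahom A)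
          (ahom_direct_sum A) _).
- by move=> a b c; rewrite amulA.
- by move=> a b c; rewrite amulDr.
- by move=> a b c; rewrite amulDl.
- by move=> k a b; rewrite amulZr.
- by move=> k a b; rewrite amulZl.
- by move=> h k a b Ha Hb; rewrite addrC; apply: ahom_mul.
Defined.

Definition df_op (A : galgebra K H) (I : choiceType) (e : dfamily A I) :
  dfamily (galg_op A) I.
Proof.
refine (@DFamily K H (galg_op A) I e (@df_neq0 _ _ _ _ e) (@df_idem _ _ _ _ e) _
          (@df_hom _ _ _ _ e)
          (df_directl e) (df_directr e)).
by move=> i j ij; apply: (@df_orth _ _ A I e j i); rewrite eq_sym.
Defined.

Lemma op_enough (A : galgei K H) :
  exists I : choiceType, inhabited (dfamily (galg_op A) I).
Proof. by have [I [e]] := gae_enough A; exists I; split; apply: df_op. Qed.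

Definition gop (A : galgei K H) : galgei K H := GAlgEI (op_enough A).

End Opposite.

(* A-Gr is [grmod A] and Gr-A is [grmod (gop A)]: a right A-module is a left
   module over the opposite algebra. *)

Record grmod (K : fieldType) (H : zmodType) (A : galgei K H) := GrMod {
  gm_car :> lmodType K;
  act : A -> gm_car -> gm_car;
  actA : forall a b x, act a (act b x) = act (a ** b) x;
  actDl : forall a b x, act (a + b) x = act a x + act b x;
  actDr : forall a x y, act a (x + y) = act a x + act a y;
  actZl : forall (k : K) a x, act (k *: a) x = k *: act a x;
  actZr : forall (k : K) a x, act a (k *: x) = k *: act a x;
  gm_unital : forall x, sums (fun y => exists a z, y = act a z) x;
  ghom : H -> set gm_car;
  ghom_direct_sum : direct_sum ghom;
  ghom_act : forall h k a x, ahom A h a -> ghom k x -> ghom (h + k) (act a x) }.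

Arguments act {K H A g}.
Arguments ghom {K H A} g.

Record grhom (K : fieldType) (H : zmodType) (A : galgei K H) (M N : grmod A) :=
  GrHom {
  grhom_fun :> {linear M -> N};
  grhom_act : forall a x, grhom_fun (act a x) = act a (grhom_fun x);
  grhom_deg : forall h x, ghom M h x -> ghom N h (grhom_fun x) }.

Definition griso (K : fieldType) (H : zmodType) (A : galgei K H)
  (M N : grmod A) : Prop := exists f : grhom M N, bijective f.

Record grsub (K : fieldType) (H : zmodType) (A : galgei K H) (M : grmod A) :=
  GrSub {
  gs_set :> M -> Prop;
  gs_0 : gs_set 0;
  gs_D : forall x y, gs_set x -> gs_set y -> gs_set (x + y);
  gs_Z : forall (k : K) x, gs_set x -> gs_set (k *: x);
  gs_act : forall a x, gs_set x -> gs_set (act a x);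
  gs_graded : forall x, gs_set x ->
    sums (fun y => gs_set y /\ exists h, ghom M h y) x }.

Section ModuleBasics.
Variables (K : fieldType) (H : zmodType) (A : galgei K H).
Implicit Types M : grmod A.

Lemma act0r M (a : A) : act a (0 : M) = 0.
Proof. by rewrite -[X in act a X](scale0r (0 : M)) actZr scale0r. Qed.

Lemma act0l M (x : M) : act (0 : A) x = 0.
Proof. by rewrite -[X in act X x](scale0r (0 : A)) actZl scale0r. Qed.

Lemma act_suml M (x : M) (T : Type) (s : seq T) (F : T -> A) :
  act (\sum_(i <- s) F i) x = \sum_(i <- s) act (F i) x.
Proof.
by apply: (big_morph (fun a => act a x) _ (act0l x)) => a b; rewrite actDl.
Qed.

Lemma act_sumr M (a : A) (T : Type) (s : seq T) (F : T -> M) :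
  act a (\sum_(i <- s) F i) = \sum_(i <- s) act a (F i).
Proof. by apply: (big_morph (act a) _ (act0r M a)) => x y; rewrite actDr. Qed.

Lemma gs_N M (N : grsub M) x : N x -> N (- x).
Proof. by rewrite -scaleN1r; apply: gs_Z. Qed.

Lemma gs_B M (N : grsub M) x y : N x -> N y -> N (x - y).
Proof. by move=> Nx Ny; apply: gs_D => //; apply: gs_N. Qed.

Lemma gs_sum M (N : grsub M) (T : eqType) (s : seq T) (F : T -> M) :
  (forall i, i \in s -> N (F i)) -> N (\sum_(i <- s) F i).
Proof.
move=> NF; rewrite big_seq; elim/big_ind: _ => //; first exact: gs_0.
exact: gs_D.
Qed.

Lemma gs_sum_ind M (N : grsub M) (G : set M) x : sums G x ->
  (forall y, G y -> N y) -> N x.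
Proof.
by move=> [s sG ->] GN; apply: gs_sum => y /sG; apply: GN.
Qed.

Lemma ghom0 M h : ghom M h 0.
Proof. by case: (ghom_direct_sum M) => sF _ _; case: (sF h). Qed.

Lemma ghomD M h x y : ghom M h x -> ghom M h y -> ghom M h (x + y).
Proof.
case: (ghom_direct_sum M) => sF _ _ Fx Fy.
by rewrite -[x]scale1r; apply: (sF h).2.
Qed.

Lemma ghomZ M h (k : K) x : ghom M h x -> ghom M h (k *: x).
Proof.
case: (ghom_direct_sum M) => sF _ _ Fx.
by rewrite -[_ *: _]addr0; apply: (sF h).2 => //; apply: ghom0.
Qed.

Lemma amul0r (B : galgebra K H) (a : B) : a ** 0 = 0.
Proof. by rewrite -[X in a ** X](scale0r (0 : B)) amulZr scale0r. Qed.

Lemma amul0l (B : galgebra K H) (a : B) : 0 ** a = 0.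
Proof. by rewrite -[X in X ** a](scale0r (0 : B)) amulZl scale0r. Qed.

Lemma amul_suml (B : galgebra K H) (x : B) (T : Type) (s : seq T) (F : T -> B) :
  (\sum_(i <- s) F i) ** x = \sum_(i <- s) F i ** x.
Proof.
by apply: (big_morph (fun a => a ** x) _ (amul0l x)) => a b; rewrite amulDl.
Qed.

Lemma amul_sumr (B : galgebra K H) (x : B) (T : Type) (s : seq T) (F : T -> B) :
  x ** (\sum_(i <- s) F i) = \sum_(i <- s) x ** F i.
Proof.
by apply: (big_morph (amul x) _ (amul0r x)) => a b; rewrite amulDr.
Qed.

Lemma alunit (B : galgei K H) (s : seq B) :
  exists u : B, forall a, a \in s -> u ** a = a.
Proof.
have [I [e]] := gae_enough B.
suff [t [ut Ht]] : exists t : seq I, uniq t /\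
    forall a, a \in s -> exists f, a = \sum_(i <- t) e i ** f i.
  exists (\sum_(i <- t) e i) => a /Ht [f ->].
  rewrite amul_suml; apply: eq_big_seq => i it.
  rewrite amul_sumr (bigD1_seq i) //= amulA df_idem big1 ?addr0 // => j ji.
  by rewrite amulA df_orth ?amul0l // eq_sym.
elim: s => [|a s [t [ut Ht]]]; first by exists [::].
have [t' [f [ut' Ff f0 Ea]]] := dsum_full (df_directr e) a.
have [g Eg] := choice Ff.
have ext (r : seq I) (F : I -> B) : uniq r ->
    {subset r <= undup (t ++ t')} -> \sum_(i <- r) e i ** F i =
    \sum_(i <- undup (t ++ t')) e i ** (if i \in r then F i else 0).
  move=> ur sr; rewrite [RHS](@big_subset _ _ r) ?undup_uniq //.
    by apply: eq_big_seq => i ->.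
  by move=> i /negPf ->; rewrite amul0r.
exists (undup (t ++ t')); split; first exact: undup_uniq.
move=> b; rewrite inE => /orP[/eqP ->|/Ht [F ->]].
  exists (fun i => if i \in t' then g i else 0).
  rewrite -ext // ?Ea; first by apply: eq_bigr => i _; apply: Eg.
  by move=> i it; rewrite mem_undup mem_cat it orbT.
exists (fun i => if i \in t then F i else 0); rewrite -ext //.
by move=> i it; rewrite mem_undup mem_cat it.
Qed.

Lemma lunit M (x : M) : exists u : A, act u x = x.
Proof.
have [s sG ->] := gm_unital x.
have [r Hr] : exists r : seq A, forall y, y \in s ->
    exists2 a, a \in r & exists z, y = act a z.
  elim: s sG => [|y s IHs] sG; first by exists [::].
  have [|r Hr] := IHs; first by move=> z zs; apply: sG; rewrite inE zs orbT.
  have [|a [z Ey]] := sG y; first exact: mem_head.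
  exists (a :: r) => w; rewrite inE => /orP[/eqP ->|/Hr [b br Eb]].
    by exists a; [exact: mem_head | exists z].
  by exists b => //; rewrite inE br orbT.
have [u Hu] := alunit r; exists u.
rewrite act_sumr; apply: eq_big_seq => y /Hr [a ar [z ->]].
by rewrite actA Hu.
Qed.

End ModuleBasics.

Section Constructions.
Variables (K : fieldType) (H : zmodType) (A : galgei K H).
Implicit Types M : grmod A.

Section SubModule.
Variables (M : grmod A) (N : grsub M).

Definition gs_pred : {pred M} := fun x => `[< N x >].

Lemma gs_predE x : (x \in gs_pred) <-> N x.
Proof. by split=> /asboolP. Qed.

Lemma gs_closed : submod_closed gs_pred.
Proof.
split; first by apply/gs_predE; apply: gs_0.
move=> a x y /gs_predE Nx /gs_predE Ny; apply/gs_predE.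
by apply: gs_D => //; apply: gs_Z.
Qed.

HB.instance Definition _ := GRing.isSubmodClosed.Build K M gs_pred gs_closed.

Definition gs_type := {x : M | x \in gs_pred}.
HB.instance Definition _ := SubChoice.on gs_type.
HB.instance Definition _ := [SubChoice_isSubLmodule of gs_type by <:].

Lemma gs_valP (x : gs_type) : N (val x).
Proof. by apply/gs_predE; exact: valP x. Qed.

Definition gs_in x (Nx : N x) : gs_type := exist _ x ((gs_predE x).2 Nx).

Definition gs_type_act (a : A) (x : gs_type) : gs_type :=
  gs_in (gs_act a (gs_valP x)).

Lemma gs_type_sums (P : set M) (Q : set gs_type) :
  (forall x : gs_type, P (val x) -> Q x) ->
  forall x : gs_type, sums (fun y => N y /\ P y) (val x) -> sums Q x.
Proof.
move=> PQ x; move Ex: (val x) => v Sv.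
elim/sums_ind: Sv x Ex => [|y w [Ny Py] IH] x Ex.
  have -> : x = 0 by apply: val_inj; rewrite Ex raddf0.
  exact: sums0.
have Ew : val (x - gs_in Ny) = w by rewrite raddfB /= Ex addrC addKr.
rewrite -[x](subrK (gs_in Ny)); apply: sumsD; first exact: IH.
by apply: sums1; apply: PQ.
Qed.

Lemma gs_type_unital (x : gs_type) :
  sums (fun y => exists a z, y = gs_type_act a z) x.
Proof.
have [u Eu] := lunit (val x : M).
by apply: sums1; exists u, x; apply: val_inj.
Qed.

Lemma gs_type_direct_sum :
  direct_sum (fun h (x : gs_type) => ghom M h (val x)).
Proof.
split.
- move=> h; split; first by rewrite raddf0; apply: ghom0.
  by move=> a x y Hx Hy; rewrite linearP; apply: ghomD => //; apply: ghomZ.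
- move=> x; apply: (@gs_type_sums (fun y => exists h, ghom M h y)) => //.
  by apply: gs_graded; apply: gs_valP.
- move=> s f us Ff E i si; apply: val_inj; rewrite raddf0.
  have [_ _ ind] := ghom_direct_sum M.
  apply: (ind s (fun i => val (f i))) => //.
  by rewrite -raddf_sum E raddf0.
Qed.

Definition submod_of : grmod A.
Proof.
refine (@GrMod K H A gs_type gs_type_act _ _ _ _ _ gs_type_unital
  (fun h x => ghom M h (val x)) gs_type_direct_sum _).
- by move=> a b x; apply: val_inj; rewrite /= actA.
- by move=> a b x; apply: val_inj; rewrite /= actDl.
- by move=> a x y; apply: val_inj; rewrite /= actDr.
- by move=> k a x; apply: val_inj; rewrite /= actZl.
- by move=> k a x; apply: val_inj; rewrite /= actZr.
- by move=> h k a x Ha Hx; apply: ghom_act.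
Defined.

Definition gq_type := Quotient.quot gs_pred.
HB.instance Definition _ := GRing.Zmodule.on gq_type.
HB.instance Definition _ := Choice.on gq_type.

Definition gq_pi (x : M) : gq_type := (\pi_gq_type x)%qT.
Definition gq_repr (x : gq_type) : M := repr x.

Lemma gq_reprK x : gq_pi (gq_repr x) = x.
Proof. exact: reprK. Qed.

Lemma gq_eq x y : gq_pi x = gq_pi y <-> N (x - y).
Proof.
rewrite -gs_predE [_ \in _]Quotient.idealrBE.
by split=> /eqP.
Qed.

Lemma gq_piD : {morph gq_pi : x y / x + y}.
Proof. by move=> x y; rewrite /gq_pi (raddfD (\pi_gq_type)%qT). Qed.

Lemma gq_pi0 : gq_pi 0 = 0.
Proof. by rewrite /gq_pi (raddf0 (\pi_gq_type)%qT). Qed.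

Lemma gq_lift (f : M -> M) : (forall x, N x -> N (f x)) ->
  {morph f : x y / x - y} ->
  forall x, gq_pi (f (gq_repr (gq_pi x))) = gq_pi (f x).
Proof.
move=> Nf fB x; apply/gq_eq; rewrite -fB; apply: Nf.
by apply/gq_eq; rewrite gq_reprK.
Qed.

Definition gq_scale (k : K) (x : gq_type) : gq_type :=
  gq_pi (k *: gq_repr x).
Definition gq_act (a : A) (x : gq_type) : gq_type :=
  gq_pi (act a (gq_repr x)).

Lemma gq_scaleE k x : gq_scale k (gq_pi x) = gq_pi (k *: x).
Proof.
apply: gq_lift => [y|y z]; [exact: gs_Z | exact: scalerBr].
Qed.

Lemma gq_actE a x : gq_act a (gq_pi x) = gq_pi (act a x).
Proof.
apply: (gq_lift (f := act a)) => [y|y z]; first exact: gs_act.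
by rewrite actDr -[- z]scaleN1r actZr scaleN1r.
Qed.

Lemma gq_scaleA a b x : gq_scale a (gq_scale b x) = gq_scale (a * b) x.
Proof. by rewrite -[x]gq_reprK !gq_scaleE scalerA. Qed.

Lemma gq_scale1 : left_id 1 gq_scale.
Proof. by move=> x; rewrite -[x]gq_reprK gq_scaleE scale1r. Qed.

Lemma gq_scaleDr : right_distributive gq_scale +%R.
Proof.
move=> a x y; rewrite -[x]gq_reprK -[y]gq_reprK -gq_piD !gq_scaleE.
by rewrite scalerDr gq_piD.
Qed.

Lemma gq_scaleDl x : {morph gq_scale^~ x : a b / a + b}.
Proof.
by move=> a b; rewrite -[x]gq_reprK !gq_scaleE -gq_piD scalerDl.
Qed.

HB.instance Definition _ := GRing.Zmodule_isLmodule.Build K gq_type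
  gq_scaleA gq_scale1 gq_scaleDr gq_scaleDl.

Definition gq_hom (h : H) : set gq_type :=
  fun x => exists2 y, ghom M h y & x = gq_pi y.

Lemma gq_unital (x : gq_type) : sums (fun y => exists a z, y = gq_act a z) x.
Proof.
have [u Eu] := lunit (gq_repr x).
by apply: sums1; exists u, x; rewrite /gq_act Eu gq_reprK.
Qed.

Lemma gq_direct_sum : direct_sum gq_hom.
Proof.
have piZ k y : k *: gq_pi y = gq_pi (k *: y) by apply: gq_scaleE.
split.
- move=> h; split; first by exists 0; [exact: ghom0 | rewrite gq_pi0].
  move=> a x y [x' Hx ->] [y' Hy ->]; exists (a *: x' + y').
    by apply: ghomD => //; apply: ghomZ.
  by rewrite piZ gq_piD.
- move=> x; rewrite -[x]gq_reprK.
  have [_ full _] := ghom_direct_sum M.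
  apply: (sums_map (f := gq_pi) gq_pi0 gq_piD _ (full _)) => y [h Hy].
  by exists h, y.
- move=> s f us Ff E i si.
  have /choice [g Hg] : forall h, exists y, ghom M h y /\ f h = gq_pi y.
    by move=> h; have [y Hy Ey] := Ff h; exists y.
  pose g' h := if h \in s then g h else 0.
  have Hg' h : ghom M h (g' h).
    by rewrite /g'; case: ifP => _; [case: (Hg h) | exact: ghom0].
  have NS : N (\sum_(h <- s) g' h).
    rewrite -[X in N X]subr0; apply/gq_eq; rewrite gq_pi0 -E.
    rewrite (big_morph gq_pi gq_piD gq_pi0); apply: eq_big_seq => h hs.
    by rewrite /g' hs; case: (Hg h).
  have [t [f' [ut Ff' f'0 E']]] := dsum_nf (ghom_direct_sum M) (gs_0 N)
    (@gs_D _ _ _ _ N) (gs_graded NS).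
  have g'f' : g' =1 f'.
    apply: (dsum_uniq (ghom_direct_sum M) us ut) => // h.
      by case: (Ff' h).
    by rewrite /g' => /negPf ->.
  have [_ ->] := Hg i; rewrite -gq_pi0; apply/gq_eq; rewrite subr0.
  have <- : g' i = g i by rewrite /g' si.
  by rewrite g'f'; case: (Ff' i).
Qed.

Definition quot_by : grmod A.
Proof.
refine (@GrMod K H A gq_type gq_act _ _ _ _ _ gq_unital gq_hom gq_direct_sum _).
- by move=> a b x; rewrite -[x]gq_reprK !gq_actE actA.
- by move=> a b x; rewrite -[x]gq_reprK !gq_actE actDl gq_piD.
- move=> a x y; rewrite -[x]gq_reprK -[y]gq_reprK -gq_piD !gq_actE.
  by rewrite actDr gq_piD.
- move=> k a x; rewrite -[x]gq_reprK !gq_actE [RHS]gq_scaleE.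
  by rewrite actZl.
- move=> k a x; rewrite -[x]gq_reprK [k *: _]gq_scaleE !gq_actE.
  by rewrite [RHS]gq_scaleE actZr.
- move=> h k a x Ha [y Hy ->]; rewrite gq_actE; exists (act a y) => //.
  exact: ghom_act.
Defined.

End SubModule.

(* M[k], with the convention M[k]_h = M_(k + h) *)
Section Shift.
Variables (M : grmod A) (k : H).

Lemma shift_direct_sum : direct_sum (fun h => ghom M (k + h)).
Proof.
have [sF full ind] := ghom_direct_sum M; split.
- by move=> h; apply: sF.
- move=> x; have [s sG ->] := full x; exists s => // y /sG [h Hy].
  by exists (h - k); rewrite addrC subrK.
- move=> s f us Ff E i si.
  have kK h : k + h - k = h by rewrite addrC addKr.
  rewrite -[i]kK; apply: (ind [seq k + h | h <- s] (fun h => f (h - k))).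
  + by rewrite map_inj_uniq //; apply: addrI.
  + by move=> h; have := Ff (h - k); rewrite addrC subrK.
  + by rewrite big_map -[RHS]E; apply: eq_bigr => h _; rewrite kK.
  + exact: map_f.
Qed.

Definition shift : grmod A.
Proof.
refine (@GrMod K H A M act (@actA _ _ _ M) (@actDl _ _ _ M) (@actDr _ _ _ M)
  (@actZl _ _ _ M) (@actZr _ _ _ M) (@gm_unital _ _ _ M) _
  shift_direct_sum _).
by move=> h k' a x Ha Hx; rewrite addrCA; apply: ghom_act.
Defined.

End Shift.

Section SumOfSubmodules.
Variables (M : grmod A) (P : grsub M -> Prop).

Definition sum_of : grsub M.
Proof.
refine (@GrSub K H A M (sums (fun y => exists2 N, P N & N y))
  (sums0 _) (@sumsD _ _) _ _ _).
- move=> k; apply: sums_map; [exact: scaler0 | exact: scalerDr |].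
  by move=> x [N PN Nx]; exists N => //; apply: gs_Z.
- move=> a; apply: sums_map; [exact: act0r | exact: actDr |].
  by move=> x [N PN Nx]; exists N => //; apply: gs_act.
- move=> x; elim/sums_ind => [|y {}x [N PN Ny] IH]; first exact: sums0.
  apply: sumsD => //; have [s sG ->] := gs_graded Ny.
  exists s => // z /sG [Nz Hz]; split => //.
  by apply: sums1; exists N.
Defined.

End SumOfSubmodules.

Definition gsimple M : Prop :=
  (exists x : M, x <> 0) /\
  forall N : grsub M, (forall x, N x -> x = 0) \/ (forall x, N x).

Definition essential M (N : grsub M) : Prop :=
  forall L : grsub M, (exists2 x, L x & x <> 0) ->
    exists x, [/\ L x, N x & x <> 0].

Definition socle M : grsub M := sum_of (fun N : grsub M => gsimple (submod_of N)).

Definition fingen M : Prop :=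
  exists s : seq M, forall x : M, exists a : nat -> A,
    x = \sum_(i < size s) act (a i) (nth 0 s i).

Definition fincogen M : Prop :=
  fingen (submod_of (socle M)) /\ essential (socle M).

(* The epimorphisms (monomorphisms) of the abelian category A-Gr are its
   surjective (injective) morphisms. *)
Definition gr_projective (P : grmod A) : Prop :=
  forall (M N : grmod A) (p : grhom M N) (f : grhom P N),
    (forall y, exists x, p x = y) -> exists g : grhom P M, forall x, p (g x) = f x.

Definition gr_injective (E : grmod A) : Prop :=
  forall (M N : grmod A) (i : grhom M N) (f : grhom M E),
    injective i -> exists g : grhom N E, forall x, g (i x) = f x.

Definition acc M : Prop :=
  forall N : nat -> grsub M, (forall n x, N n x -> N n.+1 x) ->
    exists n, forall m, (n <= m)%N -> forall x, N m x -> N n x.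

End Constructions.

Section Categories.
Variables (K : fieldType) (H : zmodType) (A : galgei K H).

(* A-Gr is abelian: its exact structure consists of all short exact sequences *)
Definition Frobenius_category : Prop :=
  [/\ forall M : grmod A, exists (P : grmod A) (p : grhom P M),
        gr_projective P /\ forall y, exists x, p x = y,
      forall M : grmod A, exists (E : grmod A) (i : grhom M E),
        gr_injective E /\ injective i
    & forall M : grmod A, gr_projective M <-> gr_injective M].

Definition fgproj_eq_fcinj : Prop :=
  forall M : grmod A, gr_projective M /\ fingen M <-> gr_injective M /\ fincogen M.

End Categories.

Section Regular.
Variables (K : fieldType) (H : zmodType) (A : galgei K H).

Lemma reg_unital (x : A) : sums (fun y => exists a z : A, y = a ** z) x.
Proof.
have [u Eu] := alunit [:: x].
by apply: sums1; exists u, x; rewrite Eu // mem_head.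
Qed.

Definition regmod : grmod A.
Proof.
refine (@GrMod K H A A amul _ _ _ _ _ reg_unital (ahom A)
  (ahom_direct_sum A) _).
- exact: amulA.
- exact: amulDl.
- exact: amulDr.
- exact: amulZl.
- by move=> k a x; apply: amulZr.
- exact: ahom_mul.
Defined.

(* the graded left ideal A e, for e homogeneous *)
Definition principal (e : A) (k : H) (he : ahom A k e) : grsub regmod.
Proof.
refine (@GrSub K H A regmod (fun x : A => exists a, x = a ** e) _ _ _ _ _).
- by exists 0; rewrite amul0l.
- by move=> x y [a ->] [b ->]; exists (a + b); rewrite amulDl.
- by move=> c x [a ->]; exists (c *: a); rewrite amulZl.
- by move=> b x [a ->]; exists (b ** a); exact: amulA.
- move=> x [a ->].
  have [_ full _] := ahom_direct_sum A.
  apply: (sums_map (f := fun a => a ** e) _ _ _ (full a)).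
  + exact: amul0l.
  + by move=> b c; rewrite amulDl.
  + move=> b [h Hb]; split; first by exists b.
    by exists (h + k); apply: ahom_mul.
Defined.

Definition max_left_ideal (L : grsub regmod) : Prop :=
  (exists a : A, ~ L a) /\
  forall L' : grsub regmod, (forall a, L a -> L' a) ->
    (forall a, L' a -> L a) \/ (forall a, L' a).

Definition Jgr : A -> Prop :=
  fun a => forall L : grsub regmod, max_left_ideal L -> L a.

Record gideal := GIdeal {
  gi_left :> grsub regmod;
  gi_right : forall a b : A, gi_left a -> gi_left (a ** b) }.

Lemma Jgr_graded (x : A) : Jgr x ->
  sums (fun y => Jgr y /\ exists h, ahom A h y) x.
Proof.
move=> Jx; have dA := ahom_direct_sum A.
have [t [f [ut Ff f0 Ex]]] := dsum_full dA x.
exists [seq f h | h <- t]; last by rewrite big_map.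
move=> _ /mapP [h ht ->]; split; last by exists h; exact: Ff.
move=> L mL.
have [t' [f' [ut' Ff' f'0 Ex']]] := dsum_nf (ghom_direct_sum regmod) (gs_0 L)
  (@gs_D _ _ _ _ L) (gs_graded (Jx L mL)).
have -> : f h = f' h.
  apply: (dsum_uniq dA ut ut') => // [i|]; first by case: (Ff' i).
  by rewrite -Ex -Ex'.
by case: (Ff' h).
Qed.

Definition Jleft : grsub regmod.
Proof.
refine (@GrSub K H A regmod Jgr _ _ _ _ Jgr_graded).
- by move=> L _; exact: gs_0.
- by move=> x y Jx Jy L mL; apply: gs_D; [apply: Jx | apply: Jy].
- by move=> k x Jx L mL; apply: gs_Z; apply: Jx.
- by move=> a x Jx L mL; apply: gs_act; apply: Jx.
Defined.

(* the left ideal {x | x b in L}, for b homogeneous *)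
Definition colon (L : grsub regmod) (b : A) (k : H) (Hb : ahom A k b) :
  grsub regmod.
Proof.
refine (@GrSub K H A regmod (fun x : A => L (x ** b)) _ _ _ _ _).
- by rewrite amul0l; apply: gs_0.
- by move=> x y Lx Ly; rewrite amulDl; apply: gs_D.
- by move=> c x Lx; rewrite amulZl; apply: gs_Z.
- by move=> a x Lx; rewrite /= -amulA; exact: (@gs_act _ _ _ _ L).
- move=> x Lxb; have dA := ahom_direct_sum A.
  have [t [f [ut Ff f0 Ex]]] := dsum_full dA x.
  exists [seq f h | h <- t]; last by rewrite big_map.
  move=> _ /mapP [h ht ->]; split; last by exists h; exact: Ff.
  have [t' [f' [ut' Ff' f'0 Ex']]] := dsum_nf (ghom_direct_sum regmod) (gs_0 L)
    (@gs_D _ _ _ _ L) (gs_graded Lxb).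
  have dS := shift_direct_sum regmod k.
  pose s := [seq h' - k | h' <- t'].
  have us : uniq s by rewrite map_inj_uniq //; apply: addIr.
  have -> : f h ** b = f' (k + h).
    apply: (dsum_uniq dS ut us (f := fun h => f h ** b)
      (f' := fun h => f' (k + h))).
    + by move=> i; rewrite addrC; apply: ahom_mul.
    + by move=> i; case: (Ff' (k + i)).
    + by move=> i /f0 ->; rewrite amul0l.
    + move=> i is'; apply: f'0; apply: contra is' => it.
      by apply/mapP; exists (k + i) => //; rewrite addrC addKr.
    + rewrite -amul_suml -Ex Ex' big_map; apply: eq_bigr => i _.
      by rewrite addrC subrK.
  by case: (Ff' (k + h)).
Defined.

Lemma colon_max (L : grsub regmod) (b : A) (k : H) (Hb : ahom A k b) :
  max_left_ideal L -> (exists a : A, ~ L (a ** b)) ->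
  max_left_ideal (colon L Hb).
Proof.
move=> [_ maxL] nL; split=> // N LN.
have [NL|] := pselect (forall a : A, N a -> L (a ** b)); first by left.
move=> nNL; right=> x.
have [y [Ny [h Hy] Lyb]] : exists y : A,
    [/\ N y, exists h, ahom A h y & ~ L (y ** b)].
  apply: contrapT => nex; apply: nNL => n Nn.
  apply: (gs_sum_ind (N := colon L Hb) (gs_graded Nn)) => y [Ny Hy].
  by apply: contrapT => nLy; apply: nex; exists y.
have Hyb := ahom_mul Hy Hb.
pose S := sum_of (fun N : grsub regmod =>
  (forall x, N x -> L x) \/ (forall x, N x -> principal Hyb x)).
have [|SL|S1] := maxL S.
- by move=> a La; apply: sums1; exists L => //; left.
- case: Lyb; apply: SL; apply: sums1; exists (principal Hyb); first by right.
  by have [u Eu] := alunit [:: y ** b]; exists u; rewrite Eu // mem_head.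
have [l Ll [c Exb]] : exists2 l, L l & exists c, x ** b = l + c ** (y ** b).
  have := S1 (x ** b); elim/sums_ind => [|z w [N' PN' N'z] [l Ll [c ->]]].
    by exists 0; [exact: gs_0 | exists 0; rewrite amul0l addr0].
  have [N'L|/(_ z N'z) [d ->]] := PN'.
    exists (z + l); first by apply: gs_D => //; apply: N'L.
    by exists c; rewrite addrA.
  by exists l => //; exists (d + c); rewrite amulDl addrCA.
have /LN Nx : L ((x - c ** y) ** b).
  by rewrite amulDl -scaleN1r amulZl scaleN1r -amulA Exb addrK.
by rewrite -[x](subrK (c ** y)); apply: gs_D => //; apply: (@gs_act _ _ _ _ N).
Qed.

Lemma Jgr_right (a b : A) : Jgr a -> Jgr (a ** b).
Proof.
move=> Ja L mL; have [_ full _] := ahom_direct_sum A.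
have [s sG ->] := full b; rewrite amul_sumr.
apply: (gs_sum (N := L)) => y /sG [h Hy].
apply: contrapT => nL; apply: (nL).
by apply: (Ja (colon L Hy)); apply: colon_max => //; exists a.
Qed.

Definition Jideal : gideal := GIdeal (gi_left := Jleft) Jgr_right.

End Regular.

Section OppositeIdeal.
Variables (K : fieldType) (H : zmodType) (A : galgei K H) (J : gideal A).

Definition gi_op_left : grsub (regmod (gop A)).
Proof.
refine (@GrSub K H (gop A) (regmod (gop A)) J (gs_0 J) (@gs_D _ _ _ _ J)
  (@gs_Z _ _ _ _ J) _ (@gs_graded _ _ _ _ J)).
by move=> a x Jx; apply: (gi_right (g := J)).
Defined.

Definition gi_op : gideal (gop A).
Proof.
refine (@GIdeal K H (gop A) gi_op_left _).
by move=> a b Ja; apply: (gs_act (g := J)).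
Defined.

End OppositeIdeal.

Section Family.
Variables (K : fieldType) (H : zmodType) (A : galgei K H) (I : choiceType).
Variable e : dfamily A I.

Definition Ae (i : I) : grmod A := submod_of (principal (df_hom e i)).

Definition Je (J : gideal A) (i : I) : grsub (Ae i).
Proof.
refine (@GrSub K H A (Ae i)
  (fun x => exists2 a : A, J a & val x = a ** e i) _ _ _ _ _).
- by exists 0; [exact: gs_0 | rewrite amul0l].
- move=> x y [a Ja Ea] [b Jb Eb]; exists (a + b); first exact: gs_D.
  by rewrite amulDl -Ea -Eb.
- move=> k x [a Ja Ea]; exists (k *: a); first exact: gs_Z.
  by rewrite amulZl -Ea.
- move=> b x [a Ja Ea]; exists (b ** a); first exact: (gs_act (g := J)).
  by rewrite -amulA -Ea.
- move=> x [a Ja Ea].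
  pose f (b : A) : Ae i := gs_in (N := principal (df_hom e i))
    (ex_intro (fun c => b ** e i = c ** e i) b erefl).
  have -> : x = f a by apply: val_inj.
  apply: (sums_map (f := f) _ _ _ (gs_graded Ja)).
  + by apply: val_inj; rewrite /= amul0l.
  + by move=> b c; apply: val_inj; rewrite /= amulDl.
  + move=> b [Jb [h Hb]]; split; first by exists b.
    exists h; rewrite -[h]addr0; apply: ahom_mul => //; exact: df_hom.
Defined.

Definition Ae_top (J : gideal A) (i : I) : grmod A := quot_by (Je J i).

End Family.

(* e_i A and e_i A / e_i J, in Gr-A *)
Definition eA (K : fieldType) (H : zmodType) (A : galgei K H) (I : choiceType)
  (e : dfamily A I) (i : I) : grmod (gop A) := @Ae K H (gop A) I (df_op e) i.

Definition eA_top (K : fieldType) (H : zmodType) (A : galgei K H)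
  (I : choiceType) (e : dfamily A I) (J : gideal A) (i : I) : grmod (gop A) :=
  @Ae_top K H (gop A) I (df_op e) (gi_op J) i.

Section MainNotions.
Variables (K : fieldType) (H : zmodType) (A : galgei K H) (I : choiceType).
Variable e : dfamily A I.

Definition locally_findim : Prop :=
  forall (i j : I) (h : H),
  let W := (fun x : A => exists2 a, ahom A h a & x = e i ** a ** e j) in
  exists (n : nat) (b : 'I_n -> A), (forall k, W (b k)) /\
    forall x, W x -> exists c : 'I_n -> K, x = \sum_(k < n) c k *: b k.

(* The subset R of A, closed under the operations and with identity u, is a
   local ring: it is nonzero and its non-units are closed under addition. *)
Definition local_subring (R : set A) (u : A) : Prop :=
  let unit x := exists2 y, R y & x ** y = u /\ y ** x = u in
  u <> 0 /\ forall x y, R x -> R y -> ~ unit x -> ~ unit y -> ~ unit (x + y).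

Definition weakly_basic : Prop :=
  [/\ locally_findim,
      forall i,
        local_subring (fun x => exists2 a, ahom A 0 a & x = e i ** a ** e i) (e i)
    & forall i j, i != j -> forall a, Jgr (e i ** a ** e j)].

Definition locally_Noetherian : Prop := forall i, acc (Ae e i) /\ acc (eA e i).

Definition simple_essential_socle (B : galgei K H) (M : grmod B) : Prop :=
  gsimple (submod_of (socle M)) /\ essential (socle M).

Definition graded_pseudo_Frobenius : Prop :=
  fgproj_eq_fcinj A /\ fgproj_eq_fcinj (gop A).

Definition graded_quasi_Frobenius : Prop :=
  Frobenius_category A /\ Frobenius_category (gop A).

End MainNotions.

(* Main.v *)
Require Import Defs.
From HB Require Import structures.
From mathcomp Require Import all_boot all_algebra.
From mathcomp Require Import boolp classical_sets functions.

Set Implicit Arguments.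
Unset Strict Implicit.
Unset Printing Implicit Defensive.
Import GRing.Theory.
Local Open Scope ring_scope.

Local Notation "a ** b" := (amul a b).

(** The three conditions are compared with a fourth one, in which duality is
    concrete: A is locally Noetherian, and every index occurs on each side of
    a pairing. Here i and j are [paired] when some linear functional f on A,
    supported on a single component e_i A_d e_j, makes the form f(x y) on
    e_i A x A e_j nondegenerate; [nakayama] collects these pairings.

    A pairing is powerful because the components e_i A_h e_k are finite
    dimensional: it identifies A e_j, up to a shift, with the graded dual of
    e_i A. The predicate [codual] captures what this gives. A codual is
    injective, since extending a partial morphism into it amounts to extending
    one linear functional ([codual_extends]); and it has a least nonzero
    graded submodule, because e_i A_0 e_i is local ([codual_monolith]).

    From pairings to the conditions. The socles of A e_j and e_i A are simple
    and essential, with the expected tops ([paired_socle]), and each of two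
    paired indices determines the other ([paired_inj]), which gives the two
    bijections. If A is locally Noetherian, Baer's criterion makes direct sums
    of shifted A e_j injective ([free_injective]), and annihilators turn the
    ascending chain condition on e_i A into a descending one on A e_j, so that
    socles are essential ([minimal_below]). Hence every module embeds in such
    a direct sum, which is projective and injective ([embed_free]). The
    Frobenius property follows, and looking at which summands are met matches
    finite generation with finite cogeneration.

    From the conditions to pairings. In the Frobenius and the pseudo-Frobenius
    case the graded dual of e_i A is injective and finitely cogenerated, hence
    projective; being injective with a monolith, it splits off a single shifted
    A e_j, and A e_j is indecomposable ([projective_paired]). In the Frobenius
    case the chain conditions come from Bass's argument ([frobenius_acc]). If
    instead the socles are known to be simple, essential and permuted, then
    the right socle of e_i A and the left socle of A e_(nu i) have a common
    generator ([gens_paired]), and a functional that does not vanish on it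
    defines a pairing ([paired_of_gen]).

    One-sided statements are proved for left modules and applied to the
    opposite algebra, which is again weakly basic with the same radical
    ([wb_op], [Jgr_op]). *)

(** * Maximal sets and separating functionals *)

(** Zorn's lemma above a given set: chains need only be nonempty, which spares
    the properties below a clause for the empty set. *)
Lemma zorn_above (T : Type) (P : set (set T)) (G0 : set T) : P G0 ->
  (forall C : set (set T), (exists X, C X) -> (forall X, C X -> P X) ->
     (forall X Y, C X -> C Y -> (forall z, X z -> Y z) \/ (forall z, Y z -> X z)) ->
     P (fun z => exists2 X, C X & X z)) ->
  exists G, [/\ P G, forall z, G0 z -> G z
    & forall G', P G' -> (forall z, G z -> G' z) -> forall z, G' z -> G z].
Proof.
move=> P0 PC; pose Q (X : set T) := P (fun z => X z \/ G0 z).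
have [F FQ totF|G [QG maxG]] := @Zorn_bigcup T Q.
  have [Fe|/set0P[X0 FX0]] := eqVneq F set0.
    rewrite /Q; suff -> : (fun z => (\bigcup_(X in F) X)%classic z \/ G0 z) = G0 by [].
    apply: funext => z; apply: propext; split; last by right.
    by case=> // -[X]; rewrite Fe.
  pose C := fun Y : set T => exists2 X, F X & Y = (fun z => X z \/ G0 z).
  have := PC C; rewrite /Q.
  have -> : (fun z => (\bigcup_(X in F) X)%classic z \/ G0 z) =
     (fun z => exists2 X, C X & X z).
    apply: funext => z; apply: propext; split.
      case=> [[X FX Xz]|Gz].
        by exists (fun z => X z \/ G0 z); [exists X | left].
      by exists (fun z => X0 z \/ G0 z); [exists X0 | right].
    by case=> _ [X FX ->] [Xz|]; [left; exists X | right].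
  apply; first by exists (fun z => X0 z \/ G0 z), X0.
    by move=> _ [X FX ->]; apply: FQ.
  move=> _ _ [X FX ->] [Y FY ->]; have [XY|YX] := totF X Y FX FY.
    by left=> z [/XY|]; [left | right].
  by right=> z [/YX|]; [left | right].
exists (fun z => G z \/ G0 z); split=> //; first by move=> z; right.
move=> G' PG' GG' z G'z; apply: contrapT => nz.
apply: (maxG (fun z => G' z \/ G0 z)).
  split; first by move=> y Gy; left; apply: GG'; left.
  by move=> /(_ z (or_introl G'z)) Gz; apply: nz; left.
rewrite /Q; suff -> : (fun z => (G' z \/ G0 z) \/ G0 z) = G' by [].
apply: funext => y; apply: propext; split; last by left; left.
by case=> [[]|] // Gy; apply: GG'; right.
Qed.

Definition lfun (K : fieldType) (V : lmodType K) (f : V -> K) : Prop :=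
  forall c x y, f (c *: x + y) = c * f x + f y.

Section Functionals.
Variables (K : fieldType).
Implicit Types V : lmodType K.

Lemma lfun0 V (f : V -> K) : lfun f -> f 0 = 0.
Proof.
by move=> lf; have /eqP := lf 1 0 0; rewrite scaler0 add0r mul1r -subr_eq0 opprD addNKr oppr_eq0 => /eqP.
Qed.

Lemma lfunD V (f : V -> K) : lfun f -> {morph f : x y / x + y}.
Proof. by move=> lf x y; rewrite -[x]scale1r lf mul1r scale1r. Qed.

Lemma lfunZ V (f : V -> K) : lfun f -> forall c x, f (c *: x) = c * f x.
Proof. by move=> lf c x; rewrite -[c *: x]addr0 lf lfun0 // addr0. Qed.

Lemma lfunB V (f : V -> K) : lfun f -> forall x y, f (x - y) = f x - f y.
Proof. by move=> lf x y; rewrite addrC -scaleN1r lf mulN1r addrC. Qed.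

Lemma lfun_sum V (f : V -> K) : lfun f -> forall (T : Type) (s : seq T) (F : T -> V),
  f (\sum_(i <- s) F i) = \sum_(i <- s) f (F i).
Proof.
by move=> lf T s F; apply: big_morph => [x y|]; [apply: lfunD | apply: lfun0].
Qed.

Lemma subspaceD V (S : set V) x y : is_subspace S -> S x -> S y -> S (x + y).
Proof. by case=> _ SP Sx Sy; rewrite -[x]scale1r; apply: SP. Qed.

Lemma subspaceZ V (S : set V) c x : is_subspace S -> S x -> S (c *: x).
Proof. by case=> S0 SP Sx; rewrite -[_ *: _]addr0; apply: SP. Qed.

(** A subspace maximal among those avoiding y is a hyperplane complementary to
    the line of y. *)
Lemma separate V (S : set V) y : is_subspace S -> ~ S y ->
  exists f : V -> K, [/\ lfun f, forall x, S x -> f x = 0 & f y = 1].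
Proof.
move=> sS nSy.
have [||U [[sU nUy] SU maxU]] :=
  @zorn_above V (fun U => is_subspace U /\ ~ U y) S.
- by [].
- move=> C [X0 CX0] CP totC; split; last by case=> X /CP[].
  split; first by exists X0 => //; have [[]] := CP _ CX0.
  move=> a u v [X CX Xu] [Y CY Yv]; have [XY|YX] := totC _ _ CX CY.
    by exists Y => //; have [[_ sY] _] := CP _ CY; apply: sY => //; apply: XY.
  by exists X => //; have [[_ sX] _] := CP _ CX; apply: sX => //; apply: YX.
have dec v : exists c, U (v - c *: y).
  apply: contrapT => nv.
  have nUv : ~ U v by move=> Uv; apply: nv; exists 0; rewrite scale0r subr0.
  apply: (nUv); apply: (maxU (fun z => exists2 u, U u & exists c, z = u + c *: v)).
  - split.
      split; first by exists 0; [case: sU | exists 0; rewrite scale0r addr0].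
      move=> a _ _ [u Uu [c ->]] [u' Uu' [c' ->]].
      exists (a *: u + u'); first by apply: sU.2.
      exists (a * c + c'); rewrite scalerDr scalerDl scalerA; exact: addrACA.
    case=> u Uu [c Ey]; have [c0|c0] := eqVneq c 0.
      by apply: nUy; rewrite Ey c0 scale0r addr0.
    apply: nv; exists c^-1.
    have -> : v - c^-1 *: y = (- c^-1) *: u; last exact: subspaceZ.
    by rewrite Ey scalerDr scalerA mulVf // scale1r opprD addrCA subrr addr0 scaleNr.
  - by move=> z Uz; exists z => //; exists 0; rewrite scale0r addr0.
  - by exists 0; [case: sU | exists 1; rewrite scale1r add0r].
have [f Hf] := choice dec; have uf v c : U (v - c *: y) -> f v = c.
  move=> Uc; apply/eqP/negPn/negP; rewrite -subr_eq0 => nz.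
  apply: nUy; rewrite -[y]scale1r -(mulVf nz) -scalerA; apply: subspaceZ => //.
  have -> : (f v - c) *: y = (v - c *: y) - (v - f v *: y).
    by rewrite scalerBl opprB [RHS]addrC addrA subrK.
  by apply: subspaceD => //; rewrite -scaleN1r; apply: subspaceZ.
exists f; split.
- move=> c u v; apply: uf.
  have -> : c *: u + v - (c * f u + f v) *: y =
     c *: (u - f u *: y) + (v - f v *: y).
    by rewrite scalerDl scalerBr scalerA opprD addrACA.
  by apply: sU.2.
- by move=> x Sx; apply: uf; rewrite scale0r subr0; apply: SU.
- by apply: uf; rewrite scale1r subrr; case: sU.
Qed.

(** In coordinates on a finite spanning family, this is separation of the
    vector of values of [t] from the subspace of values of [Phi]. *)
Lemma span_functionals V n (b : 'I_n -> V) (Phi : set (V -> K)) (t : V -> K) :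
  (exists f, Phi f) ->
  (forall f, Phi f -> lfun f) ->
  (forall c f g, Phi f -> Phi g -> exists2 k, Phi k & forall x, k x = c * f x + g x) ->
  lfun t ->
  (forall c : 'I_n -> K, let x := \sum_(k < n) c k *: b k in
     (forall f, Phi f -> f x = 0) -> t x = 0) ->
  exists2 f, Phi f & forall k, f (b k) = t (b k).
Proof.
move=> [f0 Pf0] Pl PD lt kt.
pose S (v : 'rV[K]_n) := exists2 f, Phi f & v = \row_k f (b k).
pose v := \row_k t (b k).
have sS : is_subspace S.
  split; last first.
    move=> a _ _ [f Pf ->] [g Pg ->]; have [k Pk Ek] := PD a f g Pf Pg.
    by exists k => //; apply/rowP => i; rewrite !mxE Ek.
  have [k Pk Ek] := PD (-1) f0 f0 Pf0 Pf0.
  by exists k => //; apply/rowP => i; rewrite !mxE Ek mulN1r addNr.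
have [[f Pf Ef]|nS] := pselect (S v).
  by exists f => // k; move/rowP/(_ k): Ef; rewrite !mxE.
have [g [lg gS gv]] := separate sS nS.
pose c (k : 'I_n) := g (delta_mx 0 k).
have gE (f : V -> K) : lfun f ->
    g (\row_k f (b k)) = f (\sum_(k < n) c k *: b k).
  move=> lf; rewrite [X in g X]row_sum_delta !lfun_sum //.
  by apply: eq_bigr => k _; rewrite mxE !lfunZ // mulrC.
have Z : t (\sum_(k < n) c k *: b k) = 0.
  apply: kt => f Pf; rewrite -gE; last exact: Pl.
  by apply: gS; exists f.
by move: (oner_neq0 K); rewrite -gv /v gE // Z eqxx.
Qed.

End Functionals.

(** * Homogeneous components *)

Section Components.
Variables (K : fieldType) (V : lmodType K) (H : eqType) (F : H -> set V).
Hypothesis dF : direct_sum F.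

Lemma comp_subproof (x : V) : exists f : H -> V, (forall h, F h (f h)) /\
  exists t, [/\ uniq t, forall h, h \notin t -> f h = 0 & x = \sum_(h <- t) f h].
Proof. by have [t [f [ut Ff f0 Ex]]] := dsum_full dF x; exists f; split => //; exists t. Qed.

Definition component (h : H) (x : V) : V := sval (cid (comp_subproof x)) h.

Lemma compP h x : F h (component h x).
Proof. by case: (svalP (cid (comp_subproof x))) => Ff _; apply: Ff. Qed.

Lemma comp_sum x : exists t, [/\ uniq t, forall h, h \notin t -> component h x = 0
  & x = \sum_(h <- t) component h x].
Proof. by case: (svalP (cid (comp_subproof x))). Qed.

Lemma comp_eq x t (f : H -> V) : uniq t -> (forall h, F h (f h)) ->
  (forall h, h \notin t -> f h = 0) -> x = \sum_(h <- t) f h ->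
  forall h, component h x = f h.
Proof.
move=> ut Ff f0 Ex h; have [t' [ut' f'0 Ex']] := comp_sum x.
apply: (dsum_uniq dF ut' ut (f := fun h => component h x)) => //; last by rewrite -Ex'.
by move=> k; apply: compP.
Qed.

Lemma compM c x y h : component h (c *: x + y) = c *: component h x + component h y.
Proof.
have [t [ut t0 Ex]] := comp_sum x; have [s [us s0 Ey]] := comp_sum y.
apply: (@comp_eq _ (undup (t ++ s)) (fun h => c *: component h x + component h y)).
- exact: undup_uniq.
- by case: dF => sF _ _ k; apply: (sF k).2; apply: compP.
- move=> k; rewrite mem_undup mem_cat negb_or => /andP[/t0 -> /s0 ->].
  by rewrite scaler0 addr0.
- rewrite big_split /= -scaler_sumr.
  rewrite (@big_subset _ _ t) ?undup_uniq -?Ex //; last first.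
    by move=> k kt; rewrite mem_undup mem_cat kt.
  rewrite (@big_subset _ _ s) ?undup_uniq -?Ey // => k kt.
  by rewrite mem_undup mem_cat kt orbT.
Qed.

Lemma comp0 h : component h 0 = 0.
Proof. by have := compM (-1) 0 0 h; rewrite !scaleN1r oppr0 addr0 addNr. Qed.

Lemma compD h : {morph component h : x y / x + y}.
Proof. by move=> x y; have := compM 1 x y h; rewrite !scale1r. Qed.

Lemma compZ h c x : component h (c *: x) = c *: component h x.
Proof. by have := compM c x 0 h; rewrite comp0 !addr0. Qed.

Lemma comp_bigsum h (T : Type) (s : seq T) (G : T -> V) :
  component h (\sum_(i <- s) G i) = \sum_(i <- s) component h (G i).
Proof. exact: (big_morph (component h) (@compD h) (comp0 h)). Qed.

Lemma comp_id h x : F h x -> component h x = x.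
Proof.
move=> Fx; rewrite (@comp_eq x [:: h] (fun k => if k == h then x else 0)) ?eqxx //.
- by case: dF => sF _ _ k; case: eqP => [->//|_]; case: (sF k).
- by move=> k; rewrite inE => /negPf ->.
- by rewrite big_seq1 eqxx.
Qed.

Lemma comp_ne h k x : F h x -> k != h -> component k x = 0.
Proof.
move=> Fx kh; rewrite (@comp_eq x [:: h] (fun k => if k == h then x else 0)) ?(negPf kh) //.
- by case: dF => sF _ _ l; case: eqP => [->//|_]; case: (sF l).
- by move=> l; rewrite inE => /negPf ->.
- by rewrite big_seq1 eqxx.
Qed.

Lemma comp_ext x y : (forall h, component h x = component h y) -> x = y.
Proof.
move=> xy; have [t [ut t0 Ex]] := comp_sum x; rewrite Ex.
have [s [us s0 Ey]] := comp_sum y; rewrite Ey.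
rewrite -(@big_subset _ _ t (undup (t ++ s))) ?undup_uniq //; last first.
  by move=> k kt; rewrite mem_undup mem_cat kt.
rewrite -(@big_subset _ _ s (undup (t ++ s))) ?undup_uniq //; last first.
  by move=> k kt; rewrite mem_undup mem_cat kt orbT.
by apply: eq_bigr => h _.
Qed.

End Components.

Section GradedModules.
Variables (K : fieldType) (H : zmodType) (A : galgei K H).
Implicit Types M N E : grmod A.

Definition gc M (h : H) (x : M) : M := component (ghom_direct_sum M) h x.

(** Stated for algebras, not for [regmod], so that an algebra and its opposite
    have convertible component functions. *)
Definition hc (B : galgebra K H) (h : H) (x : B) : B :=
  component (ahom_direct_sum B) h x.

Lemma gcP M h x : ghom M h (gc h x). Proof. exact: compP. Qed.
Lemma hcP (B : galgebra K H) h (x : B) : ahom B h (hc h x). Proof. exact: (compP (ahom_direct_sum B)). Qed.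
Lemma gc0 M h : gc h (0 : M) = 0. Proof. exact: comp0. Qed.
Lemma gcD M h (x y : M) : gc h (x + y) = gc h x + gc h y.
Proof. exact: compD. Qed.
Lemma gcZ M h c (x : M) : gc h (c *: x) = c *: gc h x.
Proof. exact: compZ. Qed.
Lemma gc_sum M h (T : Type) (s : seq T) (G : T -> M) :
  gc h (\sum_(i <- s) G i) = \sum_(i <- s) gc h (G i).
Proof. exact: comp_bigsum. Qed.
Lemma gc_id M h (x : M) : ghom M h x -> gc h x = x. Proof. exact: comp_id. Qed.
Lemma hc_ext (B : galgebra K H) (x y : B) : (forall h, hc h x = hc h y) -> x = y.
Proof. exact: comp_ext. Qed.
Lemma hc_neq0 (B : galgebra K H) (x : B) : x <> 0 -> exists h, hc h x <> 0.
Proof.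
move=> x0; apply: contrapT => nh; apply: x0; apply: hc_ext => h.
apply: contrapT => ne; apply: nh; exists h.
by rewrite -[X in _ <> X](comp0 (ahom_direct_sum B) h).
Qed.
Lemma gc_full M (x : M) : exists t, x = \sum_(h <- t) gc h x.
Proof. by have [t [_ _ E]] := comp_sum (ghom_direct_sum M) x; exists t. Qed.
Lemma hc_full (B : galgebra K H) (x : B) : exists t, x = \sum_(h <- t) hc h x.
Proof. by have [t [_ _ E]] := comp_sum (ahom_direct_sum B) x; exists t. Qed.
Lemma hc_id (B : galgebra K H) h (x : B) : ahom B h x -> hc h x = x. Proof. exact: comp_id. Qed.
Lemma hc_ne (B : galgebra K H) h k (x : B) : ahom B h x -> k != h -> hc k x = 0.
Proof. exact: comp_ne. Qed.
Lemma hcM (B : galgebra K H) h c (x y : B) : hc h (c *: x + y) = c *: hc h x + hc h y.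
Proof. exact: compM. Qed.

(** All the rules for components of products, restrictions, shifts and images
    are instances of this one. *)
Lemma comp_shift (V W : lmodType K) (F : H -> set V) (G : H -> set W)
   (dF : direct_sum F) (dG : direct_sum G) (k : H) (f : V -> W) :
  f 0 = 0 -> {morph f : x y / x + y} -> (forall h x, F h x -> G (k + h) (f x)) ->
  forall h x, component dG (k + h) (f x) = f (component dF h x).
Proof.
move=> f0 fD fh h x; have [t [ut t0 Ex]] := comp_sum dF x.
rewrite {1}Ex (big_morph f fD f0) comp_bigsum.
have E l : component dG (k + h) (f (component dF l x)) =
    if l == h then f (component dF h x) else 0.
  case: eqP => [->|/eqP lh]; first by apply: comp_id; apply: fh; apply: compP.
  apply: (@comp_ne _ _ _ _ dG (k + l)); first by apply: fh; apply: compP.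
  by rewrite (inj_eq (addrI k)) eq_sym.
rewrite (eq_bigr _ (fun l _ => E l)) -big_mkcond /=.
have [ht|/t0 ->] := boolP (h \in t).
  by rewrite -big_filter filter_pred1_uniq // big_seq1.
by rewrite f0 big1.
Qed.

Lemma gc_act M k a (x : M) h : ahom A k a -> gc (k + h) (act a x) = act a (gc h x).
Proof.
move=> ka; apply: (comp_shift _ _ (f := act a)); first exact: act0r.
  by move=> y z; apply: actDr.
by move=> l y; apply: ghom_act.
Qed.

Lemma gc_act0 M a (x : M) h : ahom A 0 a -> gc h (act a x) = act a (gc h x).
Proof. by move=> /gc_act <-; rewrite add0r. Qed.

Lemma gc_actr M a k (x : M) h : ghom M k x -> gc h (act a x) = act (hc (h - k) a) x.
Proof.
move=> kx; have -> : h = k + (h - k) by rewrite addrC subrK.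
rewrite [X in hc X](addrAC k) subrr add0r.
apply: (comp_shift _ _ (f := fun b => act b x)); first exact: act0l.
  by move=> y z; apply: actDl.
by move=> l y ly; rewrite addrC; apply: ghom_act.
Qed.

Lemma gc_hom M N (f : grhom M N) h x : f (gc h x) = gc h (f x).
Proof.
rewrite -[h in RHS]add0r; apply/esym/(comp_shift _ _ (f := f)).
- exact: raddf0.
- exact: raddfD.
- by move=> k y ky; rewrite add0r; apply: grhom_deg.
Qed.

Lemma gs_gc M (L : grsub M) h x : L x -> L (gc h x).
Proof.
move=> Lx; have [t [f [ut Ff f0 Ex]]] := dsum_nf (ghom_direct_sum M) (gs_0 L)
  (@gs_D _ _ _ _ L) (gs_graded Lx).
rewrite /gc (comp_eq _ ut (f := f)) //; first by case: (Ff h).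
by move=> k; case: (Ff k).
Qed.

Lemma graded_gc M (L : set M) x : (forall h, L (gc h x)) ->
  sums (fun y => L y /\ exists h, ghom M h y) x.
Proof.
move=> Lx; have [t Ex] := gc_full x; rewrite {1}Ex.
exists [seq gc h x | h <- t]; last by rewrite big_map.
by move=> _ /mapP[h _ ->]; split=> //; exists h; apply: gcP.
Qed.

Lemma ahomB (B : galgebra K H) h (x y : B) : ahom B h x -> ahom B h y -> ahom B h (x - y).
Proof.
have [sF _ _] := ahom_direct_sum B => hx hy.
by rewrite addrC -scaleN1r; apply: (sF h).2.
Qed.

Lemma val_gc M (L : grsub M) h (x : submod_of L) : val (gc h x) = gc h (val x).
Proof.
rewrite -[h in RHS]add0r; apply/esym.
apply: (comp_shift _ _ (f := fun x : submod_of L => val x : M)) => //.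
by move=> k y; rewrite add0r.
Qed.

Lemma gc_shift M k h (x : M) : @gc (shift M k) h x = @gc M (k + h) x.
Proof.
by rewrite /gc; apply/esym; exact: (comp_shift (ghom_direct_sum (shift M k)) (ghom_direct_sum M) (f := id)).
Qed.

Section Family.
Variables (I : choiceType) (e : dfamily A I).

Lemma e_idem M i (x : M) : act (e i) (act (e i) x) = act (e i) x.
Proof. by rewrite actA df_idem. Qed.

Lemma e_full M (x : M) : exists2 t : seq I, uniq t & x = \sum_(i <- t) act (e i) x.
Proof.
have [u Eu] := lunit x.
have [t [f [ut Ff f0 Ex]]] := dsum_full (df_directr e) u.
exists t => //; rewrite -{1}Eu Ex act_suml; apply: eq_big_seq => i it.
rewrite -[in RHS]Eu Ex act_suml act_sumr (bigD1_seq i) //= big1 ?addr0.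
  by have [a ->] := Ff i; rewrite actA amulA df_idem.
move=> j ji; have [a ->] := Ff j.
by rewrite actA amulA df_orth 1?eq_sym // amul0l act0l.
Qed.

(** Every element is a finite sum of homogeneous elements of the e_i M, by the
    grading and by unitality. *)
Lemma bih_ind M (P : M -> Prop) : P 0 -> (forall x y, P x -> P y -> P (x + y)) ->
  (forall i h x, ghom M h x -> act (e i) x = x -> P x) -> forall x, P x.
Proof.
move=> P0 PD Pb x.
have Ps (T : eqType) (s : seq T) (G : T -> M) :
    (forall i, i \in s -> P (G i)) -> P (\sum_(i <- s) G i).
  by move=> PG; rewrite big_seq; elim/big_ind: _.
have [s ->] := gc_full x; apply: (Ps) => h _.
have [t ut ->] := e_full (gc h x); apply: Ps => i _.
apply: (Pb i h); last exact: e_idem.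
by rewrite -[h]add0r; apply: ghom_act; [apply: df_hom | rewrite add0r; apply: gcP].
Qed.

Lemma bih_sub M (L : grsub M) x : (forall i h, L (act (e i) (gc h x))) -> L x.
Proof.
move=> Lx; have [s ->] := gc_full x; apply: gs_sum => h _.
by have [t ut ->] := e_full (gc h x); apply: gs_sum => i _.
Qed.

Lemma bih0 M (x : M) : (forall i h, act (e i) (gc h x) = 0) -> x = 0.
Proof.
move=> x0; have [s ->] := gc_full x; rewrite big1 // => h _.
by have [t ut ->] := e_full (gc h x); rewrite big1.
Qed.

Lemma bih_neq0 M (x : M) : x <> 0 -> exists i h, act (e i) (gc h x) <> 0.
Proof.
move=> x0; apply: contrapT => nx; apply: x0; apply: bih0 => i h.
by apply: contrapT => xih; apply: nx; exists i, h.
Qed.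

Lemma ghom_e M i h (x : M) : ghom M h x -> ghom M h (act (e i) x).
Proof. by move=> hx; rewrite -[h]add0r; apply: ghom_act => //; apply: df_hom. Qed.

Lemma bih_hom M i h (x : M) : ghom M h (act (e i) (gc h x)).
Proof. by apply: ghom_e; apply: gcP. Qed.

End Family.
End GradedModules.

(** * Morphisms from graphs, and the extension property *)

Lemma bij_of (T U : Type) (f : T -> U) : injective f -> (forall y, exists x, f x = y) ->
  bijective f.
Proof.
move=> fi fs; have [g Hg] := choice fs.
by exists g => // x; apply: fi; rewrite Hg.
Qed.

Section Morphisms.
Variables (K : fieldType) (H : zmodType) (A : galgei K H).
Implicit Types M N E P : grmod A.

Section OfFunction.
Variables (M N : grmod A) (f : M -> N).
Hypothesis fl : forall (c : K) x y, f (c *: x + y) = c *: f x + f y.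
Hypothesis fa : forall a x, f (act a x) = act a (f x).
Hypothesis fd : forall h x, ghom M h x -> ghom N h (f x).

Definition lin_of : {linear M -> N} :=
  HB.pack f (GRing.isLinear.Build K M N *:%R f fl).

Definition grhom_of : grhom M N := @GrHom K H A M N lin_of fa fd.

End OfFunction.

Lemma hom_comp (M N P : grmod A) (g : grhom N P) (f : grhom M N) :
  exists k : grhom M P, forall x, k x = g (f x).
Proof.
have kl c x y : g (f (c *: x + y)) = c *: g (f x) + g (f y) by rewrite !linearP.
have ka a x : g (f (act a x)) = act a (g (f x)) by rewrite !grhom_act.
have kd h x : ghom M h x -> ghom P h (g (f x)) by move=> hx; do 2!apply: grhom_deg.
by exists (grhom_of kl ka kd).
Qed.

Lemma hom_id (M : grmod A) : exists k : grhom M M, forall x, k x = x.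
Proof.
by exists (@grhom_of M M id (fun _ _ _ => erefl) (fun _ _ => erefl) (fun _ _ hx => hx)).
Qed.

(** Graphs of partial morphisms: defining a morphism by its graph avoids
    choosing representatives before linearity is known. *)
Definition graph M N (G : M -> N -> Prop) : Prop :=
  [/\ G 0 0,
      forall (c : K) x y x' y', G x y -> G x' y' -> G (c *: x + x') (c *: y + y'),
      forall a x y, G x y -> G (act a x) (act a y),
      forall h x y, G x y -> G (gc h x) (gc h y)
    & forall y, G 0 y -> y = 0].

Lemma graph_fun M N G (gG : @graph M N G) x y y' : G x y -> G x y' -> y = y'.
Proof.
case: gG => _ GD _ _ G0 xy xy'; apply/eqP; rewrite -subr_eq0; apply/eqP/G0.
by rewrite addrC -[0](addNr x) -!scaleN1r; apply: GD.
Qed.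

Lemma graph_total M N G : @graph M N G -> (forall x, exists y, G x y) ->
  exists g : grhom M N, forall x y, G x y -> g x = y.
Proof.
move=> gG tG; have [g Hg] := choice tG.
have gE x y : G x y -> g x = y by move=> xy; apply: (graph_fun gG) (Hg x) xy.
have [_ GD Ga Gc _] := gG.
have gl c x y : g (c *: x + y) = c *: g x + g y by apply: gE; apply: GD.
have ga a x : g (act a x) = act a (g x) by apply: gE; apply: Ga.
have gd h x : ghom M h x -> ghom N h (g x).
  by move=> hx; rewrite -(gc_id hx) (gE _ _ (Gc h _ _ (Hg x))); apply: gcP.
by exists (grhom_of gl ga gd).
Qed.

Lemma graph_dom M N G : @graph M N G ->
  exists L : grsub M, forall x, L x <-> exists y, G x y.
Proof.
case=> G0 GD Ga Gc _.
unshelve eexists; first refine (@GrSub K H A M (fun x => exists y, G x y) _ _ _ _ _).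
- by exists 0.
- by move=> x y [x' xx'] [y' yy']; exists (1 *: x' + y'); rewrite -[x]scale1r; apply: GD.
- by move=> k x [y xy]; exists (k *: y + 0); rewrite -[_ *: x]addr0; apply: GD.
- by move=> a x [y xy]; exists (act a y); apply: Ga.
- move=> x [y xy]; apply: graded_gc => h; exists (gc h y); exact: Gc.
- by [].
Qed.

Definition hom_ker M N (f : grhom M N) : grsub M.
Proof.
refine (@GrSub K H A M (fun x => f x = 0) _ _ _ _ _).
- exact: raddf0.
- by move=> x y x0 y0; rewrite raddfD /= x0 y0 addr0.
- by move=> k x x0; rewrite linearZ /= x0 scaler0.
- by move=> a x x0; rewrite grhom_act x0 act0r.
- by move=> x x0; apply: graded_gc => h; rewrite gc_hom x0 gc0.
Defined.

Lemma ker_inj M N (f : grhom M N) : (forall x, f x = 0 -> x = 0) -> injective f.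
Proof.
move=> f0 x y xy; apply/eqP; rewrite -subr_eq0; apply/eqP/f0.
by rewrite raddfB /= xy subrr.
Qed.

Lemma incl M (L : grsub M) : exists i : grhom (submod_of L) M, forall x, i x = val x.
Proof.
have il c (x y : submod_of L) : val (c *: x + y) = c *: val x + val y :> M.
  by rewrite linearP.
by exists (@grhom_of (submod_of L) M (fun x => val x) il (fun _ _ => erefl) (fun _ _ hx => hx)).
Qed.

(** Injectivity relative to [N]: every partial morphism from [N] extends. *)
Definition extends_from N E : Prop :=
  forall G, @graph N E G -> exists g : grhom N E, forall x y, G x y -> g x = y.

Lemma extends_inj E : (forall N, extends_from N E) -> gr_injective E.
Proof.
move=> Eext M N i f ii.
have [|g Hg] := Eext N (fun x y => exists2 m, x = i m & y = f m); last first.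
  by exists g => x; apply: Hg; exists x.
split.
- by exists 0; rewrite raddf0.
- move=> c _ _ _ _ [m -> ->] [m' -> ->]; exists (c *: m + m'); by rewrite linearP.
- by move=> a _ _ [m -> ->]; exists (act a m); rewrite grhom_act.
- by move=> h _ _ [m -> ->]; exists (gc h m); rewrite gc_hom.
- by move=> y [m m0 ->]; rewrite -[m](ii 0) ?raddf0 // -m0.
Qed.

Lemma inj_extends E : gr_injective E -> forall N, extends_from N E.
Proof.
move=> Einj N G gG; have [L HL] := graph_dom gG; have [G0 GD Ga Gc _] := gG.
have [||f Hf] := @graph_total (submod_of L) E (fun x y => G (val x) y).
- split=> //.
  + by move=> c x y x' y' xy xy'; rewrite linearP; apply: GD.
  + by move=> a x y; apply: Ga.
  + by move=> h x y xy; rewrite val_gc; apply: Gc.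
  + by case: gG => _ _ _ _ G00 y; apply: G00.
- by move=> x; apply/HL; apply: gs_valP.
have [i Hi] := incl L.
have [|g Hg] := Einj _ _ i f.
  by move=> x y; rewrite !Hi => /val_inj.
exists g => x y xy; have Lx : L x by apply/HL; exists y.
by have := Hg (gs_in Lx); rewrite Hi /= => ->; apply: Hf.
Qed.

(** With q a presentation of part of M, this extends to M a map that is known
    only on generators and relations. *)
Lemma inj_factor M P E (q : grhom P M) (v : grhom P E) : gr_injective E ->
  (forall x, q x = 0 -> v x = 0) -> exists g : grhom M E, forall x, g (q x) = v x.
Proof.
move=> Einj qv; have [|g Hg] := inj_extends Einj (N := M) (G := fun x y => exists2 p, x = q p & y = v p).
  split.
  - by exists 0; rewrite raddf0.
  - by move=> c _ _ _ _ [p -> ->] [p' -> ->]; exists (c *: p + p'); rewrite linearP.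
  - by move=> a _ _ [p -> ->]; exists (act a p); rewrite grhom_act.
  - by move=> h _ _ [p -> ->]; exists (gc h p); rewrite gc_hom.
  - by move=> y [p /esym /qv p0 ->].
by exists g => x; apply: Hg; exists x.
Qed.

Lemma inj_split E N (i : grhom E N) : gr_injective E -> injective i ->
  exists r : grhom N E, forall x, r (i x) = x.
Proof.
move=> Einj ii; have [k Hk] := hom_id E; have [g Hg] := Einj _ _ i k ii.
by exists g => x; rewrite Hg Hk.
Qed.

Lemma proj_split P N (p : grhom N P) : gr_projective P -> (forall y, exists x, p x = y) ->
  exists s : grhom P N, forall x, p (s x) = x.
Proof.
move=> Pproj pp; have [k Hk] := hom_id P; have [g Hg] := Pproj _ _ p k pp.
by exists g => x; rewrite Hg Hk.
Qed.

Lemma inj_retract E F (s : grhom E F) (r : grhom F E) : (forall x, r (s x) = x) ->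
  gr_injective F -> gr_injective E.
Proof.
move=> rs Finj M N i f ii; have [k Hk] := hom_comp s f.
have [g Hg] := Finj _ _ i k ii; have [l Hl] := hom_comp r g.
by exists l => x; rewrite Hl Hg Hk rs.
Qed.

Lemma proj_retract P F (s : grhom P F) (r : grhom F P) : (forall x, r (s x) = x) ->
  gr_projective F -> gr_projective P.
Proof.
move=> rs Fproj M N p f pp; have [k Hk] := hom_comp f r.
have [g Hg] := Fproj _ _ p k pp; have [l Hl] := hom_comp g s.
by exists l => x; rewrite Hl Hg Hk rs.
Qed.

End Morphisms.

(** * Submodules, socles and monoliths *)

Section Submodules.
Variables (K : fieldType) (H : zmodType) (A : galgei K H).
Implicit Types M N : grmod A.

Definition cyc M h (x : M) (hx : ghom M h x) : grsub M.
Proof.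
refine (@GrSub K H A M (fun y => exists a, y = act a x) _ _ _ _ _).
- by exists 0; rewrite act0l.
- by move=> _ _ [a ->] [b ->]; exists (a + b); rewrite actDl.
- by move=> k _ [a ->]; exists (k *: a); rewrite actZl.
- by move=> b _ [a ->]; exists (b ** a); rewrite actA.
- by move=> _ [a ->]; apply: graded_gc => k; exists (hc (k - h) a); apply: gc_actr.
Defined.

Lemma cyc_id M h (x : M) (hx : ghom M h x) : cyc hx x.
Proof. by have [u Eu] := lunit x; exists u. Qed.

Lemma gs_le_cyc M (L : grsub M) h (x : M) (hx : ghom M h x) : L x -> forall y, cyc hx y -> L y.
Proof. by move=> Lx _ [a ->]; apply: gs_act. Qed.

Definition gs_cap M (L N : grsub M) : grsub M.
Proof.
refine (@GrSub K H A M (fun x => L x /\ N x) _ _ _ _ _).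
- by split; apply: gs_0.
- by move=> x y [Lx Nx] [Ly Ny]; split; apply: gs_D.
- by move=> k x [Lx Nx]; split; apply: gs_Z.
- by move=> a x [Lx Nx]; split; apply: gs_act.
- by move=> x [Lx Nx]; apply: graded_gc => h; split; apply: gs_gc.
Defined.

Definition gs_add M (L N : grsub M) : grsub M.
Proof.
refine (@GrSub K H A M (fun x => exists2 y, L y & N (x - y)) _ _ _ _ _).
- by exists 0; rewrite ?subr0; apply: gs_0.
- move=> x x' [y Ly Ny] [y' Ly' Ny']; exists (y + y'); first exact: gs_D.
  by rewrite opprD addrACA; apply: gs_D.
- move=> k x [y Ly Ny]; exists (k *: y); first exact: gs_Z.
  by rewrite -scalerBr; apply: gs_Z.
- move=> a x [y Ly Ny]; exists (act a y); first exact: gs_act.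
  by rewrite -scaleN1r -actZr scaleN1r -actDr; apply: gs_act.
- move=> x [y Ly Ny]; apply: graded_gc => h; exists (gc h y); first exact: gs_gc.
  by rewrite -scaleN1r -gcZ scaleN1r -gcD; apply: gs_gc.
Defined.

Definition hspan M (B : set M) : grsub M.
Proof.
refine (@GrSub K H A M (sums (fun y => exists a x, [/\ B x, exists h, ghom M h x & y = act a x]))
  (sums0 _) (@sumsD _ _) _ _ _).
- move=> k; apply: sums_map; [exact: scaler0 | exact: scalerDr |].
  by move=> _ [a [x [Bx hx ->]]]; exists (k *: a), x; rewrite actZl.
- move=> b; apply: sums_map; [exact: act0r | exact: actDr |].
  by move=> _ [a [x [Bx hx ->]]]; exists (b ** a), x; rewrite actA.
- move=> x Sx; apply: graded_gc => h; apply: sums_map Sx; [exact: gc0 | exact: gcD|].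
  move=> _ [a [y [By [k ky] ->]]]; exists (hc (h - k) a), y; split=> //; first by exists k.
  exact: gc_actr.
Defined.

Lemma hspan_mem M (B : set M) h x : B x -> ghom M h x -> hspan B x.
Proof.
move=> Bx hx; have [u Eu] := lunit x.
by apply: sums1; exists u, x; split=> //; exists h.
Qed.

Lemma fingenP M : fingen M <-> exists s : seq M, forall x : M,
  sums (fun y => exists a z, z \in s /\ y = act a z) x.
Proof.
split=> [[s Hs]|[s Hs]]; exists s => x.
  have [a ->] := Hs x; exists [seq act (a i) s`_i | i : 'I_(size s)].
    by move=> _ /codomP[i ->]; exists (a i), s`_i; rewrite mem_nth.
  by rewrite /image_mem big_map big_enum.
elim/sums_ind: {x} (Hs x) => [|_ x [a [z [zs ->]]] [b ->]].
  by exists (fun=> 0); rewrite big1 // => i _; rewrite act0l.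
exists (fun i => (if i == index z s then a else 0) + b i).
under [RHS]eq_bigr do rewrite actDl.
rewrite big_split /=; congr (_ + _).
have iz : (index z s < size s)%N by rewrite index_mem.
rewrite (bigD1 (Ordinal iz)) //= eqxx nth_index // big1 ?addr0 // => i.
by rewrite -val_eqE /= => /negPf ->; rewrite act0l.
Qed.

Definition gs_img M (L : grsub M) (N : grsub (submod_of L)) : grsub M.
Proof.
refine (@GrSub K H A M (fun x => exists2 y, N y & x = val y) _ _ _ _ _).
- by exists 0; rewrite ?raddf0 //; apply: gs_0.
- move=> _ _ [x Nx ->] [y Ny ->]; exists (x + y); first exact: gs_D.
  by rewrite raddfD.
- by move=> k _ [x Nx ->]; exists (k *: x); first exact: gs_Z.
- by move=> a _ [x Nx ->]; exists (act a x); first exact: gs_act.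
- move=> _ [x Nx ->]; apply: graded_gc => h; exists (gc h x); first exact: gs_gc.
  by rewrite val_gc.
Defined.

Definition gs_pre M (L N : grsub M) : grsub (submod_of L).
Proof.
refine (@GrSub K H A (submod_of L) (fun x => N (val x)) _ _ _ _ _).
- by rewrite raddf0; apply: gs_0.
- by move=> x y Nx Ny; rewrite raddfD; apply: gs_D.
- by move=> k x Nx; rewrite linearZ; apply: gs_Z.
- by move=> a x Nx; apply: (gs_act (g := N)).
- by move=> x Nx; apply: graded_gc => h; rewrite val_gc; apply: gs_gc.
Defined.

(** A monolith of [M] generates the least nonzero graded submodule. *)
Definition monolith M (w : M) : Prop :=
  w <> 0 /\ forall L : grsub M, (exists2 x, L x & x <> 0) -> L w.

Lemma monolith_act M (w x : M) h : monolith w -> ghom M h x -> x <> 0 ->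
  exists a, w = act a x.
Proof. by case=> _ Mw hx x0; apply: (Mw (cyc hx)); exists x => //; apply: cyc_id. Qed.

Lemma simpleP M (L : grsub M) : gsimple (submod_of L) <->
  (exists2 x, L x & x <> 0) /\
  forall N : grsub M, (forall x, N x -> L x) -> (exists2 x, N x & x <> 0) -> forall x, L x -> N x.
Proof.
split=> [[[x x0] sL]|[[x Lx x0] sL]].
  split; first by exists (val x); [apply: gs_valP | move=> v0; apply: x0; apply: val_inj].
  move=> N NL [y Ny y0] z Lz; have [N0|N1] := sL (gs_pre L N).
    by case: y0; have := N0 (gs_in (NL y Ny)) Ny => /(congr1 val).
  exact: (N1 (gs_in Lz)).
split; first by exists (gs_in Lx) => /(congr1 val).
move=> N; have [[y Ny y0]|nN] := pselect (exists2 y, N y & y <> 0); last first.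
  by left=> y Ny; apply: contrapT => y0; apply: nN; exists y.
right=> z; have [||t Nt Et] := sL (gs_img N) _ _ (val z) (gs_valP z).
- by move=> _ [t Nt ->]; apply: gs_valP.
- by exists (val y); [exists y | move=> v0; apply: y0; apply: val_inj].
- by rewrite (_ : z = t) //; apply: val_inj.
Qed.

Lemma simple_socle M (L : grsub M) : gsimple (submod_of L) -> forall x, L x -> socle M x.
Proof. by move=> sL x Lx; apply: sums1; exists L. Qed.

Lemma monolith_socle M (w : M) h : monolith w -> ghom M h w ->
  forall x, socle M x <-> exists a, x = act a w.
Proof.
move=> mw hw x; have [w0 Mw] := mw; split.
  elim/sums_ind => [|y {}x [N /simpleP[nN sN] Ny] [b ->]].
    by exists 0; rewrite act0l.
  have Nw := Mw _ nN.
  have [|||a ->] := sN (cyc hw) _ _ y => //.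
  - exact: gs_le_cyc.
  - by exists w => //; apply: cyc_id.
  - by exists (a + b); rewrite actDl.
move=> Cx; apply: (@simple_socle _ (cyc hw)) => //; apply/simpleP; split.
  by exists w => //; apply: cyc_id.
by move=> N NC nN; apply: gs_le_cyc; apply: Mw.
Qed.

Lemma monolith_simple_socle M (w : M) h : monolith w -> ghom M h w ->
  simple_essential_socle M /\ fincogen M.
Proof.
move=> mw hw; have [w0 Mw] := mw; have sE := monolith_socle mw hw.
have sw : socle M w by apply/sE; have [u Eu] := lunit w; exists u.
have ess : essential (socle M).
  by move=> L nL; exists w; split => //; apply: Mw.
split; split => //.
  apply/simpleP; split; first by exists w.
  by move=> N _ nN x /sE[a ->]; apply: gs_act; apply: Mw.
apply/fingenP; exists [:: gs_in sw] => x.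
have [a Ea] := (sE (val x)).1 (gs_valP x).
by apply: sums1; exists a, (gs_in sw); rewrite mem_head; split => //; apply: val_inj.
Qed.

Lemma simple_socle_monolith M (w : M) : simple_essential_socle M ->
  socle M w -> w <> 0 -> monolith w.
Proof.
move=> [/simpleP[_ sS] ess] sw w0; split => // L nL.
have [x [Lx sx x0]] := ess L nL.
have [] := sS (gs_cap L (socle M)) _ _ w sw => //; first by move=> y [].
by exists x.
Qed.

End Submodules.

(** * The graded radical of a weakly basic algebra *)

Section Radical.
Variables (K : fieldType) (H : zmodType).

Lemma hc_mull (B : galgebra K H) k (a x : B) h : ahom B k a -> hc (k + h) (a ** x) = a ** hc h x.
Proof.
move=> ka; apply: (comp_shift _ _ (f := amul a)); first exact: amul0r.
  by move=> y z; apply: amulDr.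
by move=> l y; apply: ahom_mul.
Qed.

Lemma hc_mulr (B : galgebra K H) k (a x : B) h : ahom B k a -> hc (k + h) (x ** a) = hc h x ** a.
Proof.
move=> ka; apply: (comp_shift _ _ (f := fun y => y ** a)); first exact: amul0l.
  by move=> y z; apply: amulDl.
by move=> l y; rewrite addrC => ly; apply: ahom_mul.
Qed.

Variables (A : galgei K H) (I : choiceType) (e : dfamily A I).

Definition bih h i j (x : A) : Prop := [/\ ahom A h x, e i ** x = x & x ** e j = x].

Lemma bih_mul h k i j l x y : bih h i j x -> bih k j l y -> bih (h + k) i l (x ** y).
Proof.
move=> [hx ix xj] [ky jy yl]; split; first exact: ahom_mul.
  by rewrite amulA ix.
by rewrite -amulA yl.
Qed.

Lemma bih_comp h i j a : bih h i j (e i ** hc h a ** e j).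
Proof.
split; last by rewrite -amulA df_idem.
  rewrite -[h]addr0; apply: ahom_mul; last exact: df_hom.
  by rewrite addr0 -[h]add0r; apply: ahom_mul; [apply: df_hom | rewrite ?add0r; apply: hcP].
by rewrite !amulA df_idem.
Qed.

Lemma bih_e i : bih 0 i i (e i).
Proof. by split; [apply: df_hom | apply: df_idem | apply: df_idem]. Qed.

Lemma amulBl (x y z : A) : (x - y) ** z = x ** z - y ** z.
Proof. by rewrite amulDl -scaleN1r amulZl scaleN1r. Qed.

Lemma amulBr (x y z : A) : z ** (x - y) = z ** x - z ** y.
Proof. by rewrite amulDr -scaleN1r amulZr scaleN1r. Qed.

Lemma bihB h i j x y : bih h i j x -> bih h i j y -> bih h i j (x - y).
Proof.
move=> [hx ix xj] [hy iy yj]; split; first exact: ahomB.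
  by rewrite amulBr ix iy.
by rewrite amulBl xj yj.
Qed.

Lemma er_full (x : A) : exists2 t : seq I, uniq t & x = \sum_(i <- t) x ** e i.
Proof. exact: (@e_full K H (gop A) I (df_op e) (regmod (gop A)) x). Qed.

Hypothesis wb : weakly_basic e.

Lemma local_e i x y : bih 0 i i x -> bih 0 i i y -> x + y = e i ->
  (exists z, [/\ bih 0 i i z, x ** z = e i & z ** x = e i]) \/
  (exists z, [/\ bih 0 i i z, y ** z = e i & z ** y = e i]).
Proof.
have R0 u : bih 0 i i u -> exists2 a, ahom A 0 a & u = e i ** a ** e i.
  by case=> hu iu ui; exists u => //; rewrite iu.
have [_ /(_ i)[_ loc] _] := wb => /R0 Rx /R0 Ry xy.
apply: contrapT => /not_orP[nx ny].
have bR z : (exists2 a, ahom A 0 a & z = e i ** a ** e i) -> bih 0 i i z.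
  by case=> a ha ->; rewrite -{1}(hc_id ha); apply: bih_comp.
apply: (loc x y Rx Ry).
- by case=> z /bR bz [xz zx]; apply: nx; exists z.
- by case=> z /bR bz [xz zx]; apply: ny; exists z.
- rewrite xy; exists (e i); last by rewrite df_idem.
  by exists (e i); rewrite ?df_idem //; apply: df_hom.
Qed.

(** The product in the other order is a nonzero idempotent of a local ring. *)
Lemma linv_rinv h i x b : bih h i i x -> bih (- h) i i b -> b ** x = e i -> x ** b = e i.
Proof.
move=> bx bb bxe; pose p := x ** b.
have bp : bih 0 i i p by rewrite -(subrr h); apply: bih_mul bx bb.
have pp : p ** p = p.
  by rewrite /p amulA -(amulA x) bxe; case: bx => _ _ ->.
have [|||[z [bz pz zp]]|[z [bz pz zp]]] := @local_e i p (e i - p).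
- exact: bp.
- by apply: bihB => //; apply: bih_e.
- by rewrite addrC subrK.
- have [_ _ pi] := bp; have E : p ** (p ** z) = e i by rewrite amulA pp pz.
  by rewrite -[LHS]/p -pi -{1}pz E.
- have p0 : p = 0.
    have [_ ip _] := bp.
    by rewrite -ip -zp -amulA amulBl ip pp subrr amul0r.
  case: (@df_neq0 _ _ _ _ e i); have [_ _ xi] := bx.
  have x0 : x = 0 by rewrite -xi -bxe amulA -/p p0 amul0l.
  by rewrite -bxe x0 amul0r.
Qed.

(** For i = k, a maximal left ideal L avoiding x satisfies L + A x = A; in degree
    0 this writes e_i as l + a x with l in L, and l is not a unit, so a x is one
    because e_i A_0 e_i is local. *)
Lemma not_Jgr_inv h k i x : bih h k i x -> ~ Jgr x ->
  k = i /\ exists b, [/\ bih (- h) i i b, b ** x = e i & x ** b = e i].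
Proof.
move=> bx nJ; have [ki|ki] := eqVneq k i; last first.
  case: nJ; have [_ _ /(_ k i ki x)] := wb.
  by case: bx => _ -> ->.
subst k; split=> //; have [hx ix xi] := bx.
have [L mL nLx] : exists2 L, max_left_ideal L & ~ L x.
  apply: contrapT => nL; apply: nJ => L mL; apply: contrapT => nLx.
  by apply: nL; exists L.
pose C := @cyc K H A (regmod A) h x hx.
have Cx : C x by apply: cyc_id.
have [[a0 nLa] maxL] := mL.
have [|L1|L1] := maxL (gs_add L C).
- move=> a La; exists a => //; rewrite subrr; exact: gs_0.
- by case: nLx; apply: L1; exists 0; rewrite ?subr0 //; apply: gs_0.
have [l Ll [a Ea]] := L1 (e i).
pose a' := e i ** hc (- h) a ** e i.
have ba' : bih (- h) i i a' by apply: bih_comp.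
have ba'x : bih 0 i i (a' ** x) by rewrite -(addNr h); apply: bih_mul ba' bx.
have El : L (e i - a' ** x).
  have El' : l = e i - a ** x by rewrite -[a ** x]Ea opprB addrC subrK.
  have := gs_act (e i) (gs_gc 0 Ll).
  have -> : gc 0 l = e i - hc (- h) a ** x :> A.
    rewrite El' [LHS](_ : _ = hc 0 (e i - a ** x)) // addrC -scaleN1r hcM.
    rewrite (hc_id (df_hom e i)) -{1}(subrr h) (hc_mulr _ _ hx).
    by rewrite scaleN1r addrC.
  rewrite [X in L X](_ : _ = e i - a' ** x) //= amulBr df_idem /a'.
  by rewrite -(amulA _ (e i) x) ix amulA.
have [|||[z [bz pz zp]]|[z [bz pz zp]]] := @local_e i (e i - a' ** x) (a' ** x).
- by apply: bihB => //; apply: bih_e.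
- by [].
- by rewrite subrK.
- case: nLx; rewrite -xi; apply: (gs_act (g := L)); rewrite -zp.
  exact: (gs_act (g := L)).
exists (z ** a'); have bza : bih (- h) i i (z ** a').
  by rewrite -[- h]add0r; apply: bih_mul bz ba'.
have zax : z ** a' ** x = e i by rewrite -amulA.
by split => //; apply: linv_rinv bx bza zax.
Qed.

Section NonUnits.
Variable i : I.
Let linv (x : A) := exists z, z ** x = e i.
Let Mset (y : A) := forall h b, ~ linv (e i ** hc h (b ** y) ** e i).

Let linv_hom h u : bih h i i u -> linv u -> exists2 z, bih (- h) i i z & z ** u = e i.
Proof.
move=> [hu iu ui] [z zu]; exists (e i ** hc (- h) z ** e i); first exact: bih_comp.
rewrite -amulA iu -amulA -(hc_mulr _ _ hu) subrr zu.
by rewrite (hc_id (df_hom e i)) df_idem.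
Qed.

Let linvD h u v : bih h i i u -> bih h i i v -> linv (u + v) -> linv u \/ linv v.
Proof.
move=> bu bv luv; have [|z bz zuv] := @linv_hom h (u + v) _ luv.
  rewrite -[v]opprK; apply: bihB => //; rewrite -[- v]add0r; apply: bihB => //.
  by rewrite -(subrr v); apply: bihB.
have bzu : bih 0 i i (z ** u) by rewrite -(addNr h); apply: bih_mul bz bu.
have bzv : bih 0 i i (z ** v) by rewrite -(addNr h); apply: bih_mul bz bv.
have [|[t [_ _ tz]]|[t [_ _ tz]]] := local_e bzu bzv; first by rewrite -amulDr.
- by left; exists (t ** z); rewrite -amulA.
- by right; exists (t ** z); rewrite -amulA.
Qed.

Let linv0 : ~ linv 0.
Proof. by case=> z; rewrite amul0r => /esym; apply: df_neq0. Qed.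

(** An explicit maximal graded left ideal avoiding e_i: it contains every e_j
    with j different from i, and in A e_i it consists of the elements that no
    left multiplication brings back to e_i. *)
Definition nonunits_ideal : grsub (regmod A).
Proof.
refine (@GrSub K H A (regmod A) Mset _ _ _ _ _).
- move=> h b; rewrite amul0r.
  have -> : hc h (0 : A) = 0 by apply: comp0.
  by rewrite amul0r amul0l; apply: linv0.
- move=> x y Mx My h b; rewrite amulDr.
  have -> : hc h (b ** x + b ** y) = hc h (b ** x) + hc h (b ** y) by apply: compD.
  rewrite amulDr amulDl => /(linvD (bih_comp _ _ _ _) (bih_comp _ _ _ _))[].
    exact: Mx.
  exact: My.
- move=> k x Mx h b; rewrite amulZr -amulZl; exact: Mx.
- by move=> a x Mx h b; rewrite [act a x]/(a ** x) amulA; apply: Mx.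
- move=> x Mx; apply: graded_gc => l h b.
  have -> : hc h (b ** gc l x) = hc h (hc (h - l) b ** x).
    transitivity (hc (h - l) b ** gc l x).
      exact: (@gc_actr K H A (regmod A) b l _ h (gcP l x)).
    by rewrite -[in RHS](subrK l h) addrK (hc_mull _ _ (hcP _ b)).
  exact: Mx.
Defined.

Lemma nonunits_max : max_left_ideal nonunits_ideal.
Proof.
split.
  exists (e i) => /(_ 0 (e i)); apply.
  by exists (e i); rewrite df_idem (hc_id (df_hom e i)) !df_idem.
move=> L ML; have Mv v : nonunits_ideal (v - v ** e i).
  move=> h b; rewrite amulBr amulA.
  have -> : hc h (b ** v - b ** v ** e i) = hc h (b ** v) - hc h (b ** v) ** e i.
    by rewrite addrC -scaleN1r hcM -[h]add0r (hc_mulr _ _ (df_hom e i)) add0r scaleN1r addrC.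
  by rewrite -amulA amulBl -amulA df_idem subrr amul0r.
have [|nL] := pselect (forall a, L a -> nonunits_ideal a); [by left | right=> a].
have [y [Ly [h [b [z Ez]]]]] : exists y, L y /\ exists h b, linv (e i ** hc h (b ** y) ** e i).
  apply: contrapT => ny; apply: nL => y Ly h b ln; apply: ny; exists y; split=> //.
  by exists h, b.
have Le v : L v -> L (v ** e i).
  move=> Lv; rewrite -[v ** e i](subKr v); apply: gs_B => //; apply: ML; exact: Mv.
have Lei : L (e i).
  rewrite -Ez; apply: (gs_act (g := L)); apply: Le; apply: (gs_act (g := L)).
  by apply: (gs_gc (L := L)); apply: (gs_act (g := L)).
rewrite -[a](subrK (a ** e i)); apply: gs_D; first by apply: ML; apply: Mv.
exact: (gs_act (g := L)).
Qed.

Lemma Jgr_e : ~ Jgr (e i).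
Proof.
move=> /(_ _ nonunits_max) /(_ 0 (e i)); apply.
by exists (e i); rewrite df_idem (hc_id (df_hom e i)) !df_idem.
Qed.

End NonUnits.

Lemma Jgr_mull (a x : A) : Jgr x -> Jgr (a ** x).
Proof. by move=> Jx; apply: (gs_act (g := Jleft A)). Qed.

Lemma Jgr_hc h (x : A) : Jgr x -> Jgr (hc h x).
Proof. by move=> Jx; apply: (gs_gc (L := Jleft A)). Qed.

(** This description of the radical is visibly the same for the opposite algebra. *)
Lemma Jgr_char (x : A) : Jgr x <->
  forall i h, ~ exists z, z ** (e i ** hc h x ** e i) = e i /\ e i ** hc h x ** e i ** z = e i.
Proof.
split=> [Jx i h [z [zx _]]|nx].
  apply: (@Jgr_e i); rewrite -zx; apply: Jgr_mull; apply: Jgr_right.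
  by apply: Jgr_mull; apply: Jgr_hc.
apply: (bih_sub (e := e) (L := Jleft A)) => i h.
have [t _ Et] := er_full (e i ** hc h x).
rewrite [act _ _](_ : _ = e i ** hc h x) // Et.
apply: (gs_sum (N := Jleft A)) => j _; apply: contrapT => nJ.
have [ij [b [_ bx xb]]] := not_Jgr_inv (bih_comp h i j x) nJ; subst j.
by apply: (nx i h); exists b.
Qed.

Lemma unit_sub_Jgr i x : bih 0 i i x -> Jgr x -> exists z, z ** (e i - x) = e i.
Proof.
move=> bx Jx; have [|||[z [_ _ zx]]|[z [_ _ zx]]] := @local_e i (e i - x) x.
- by apply: bihB => //; apply: bih_e.
- by [].
- by rewrite subrK.
- by exists z.
- by case: (@Jgr_e i); rewrite -zx; apply: Jgr_mull.
Qed.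

(** Only the off-diagonal condition is not symmetric on its face. For a maximal
    right ideal R avoiding x in e_j A e_i, write e_j = r + x b in degree 0; x b
    is in the radical, so r is a unit and R is everything. *)
Lemma wb_op : @weakly_basic K H (gop A) I (df_op e).
Proof.
have [fd loc off] := wb; split.
- move=> i j h; have [n [b [Wb sb]]] := fd j i h; exists n, b; split.
    by move=> k; have [a ha ->] := Wb k; exists a => //=; rewrite amulA.
  by move=> x [a ha Ex]; apply: sb; exists a => //; rewrite Ex /= amulA.
- move=> i; have [ei0 add] := loc i; split=> //.
  have S x : (exists2 a, ahom A 0 a & x = e i ** (a ** e i)) <->
     (exists2 a, ahom A 0 a & x = e i ** a ** e i).
    by split=> -[a ha ->]; exists a => //; rewrite amulA.
  move=> x y /S Rx /S Ry nx ny [z /S Rz [z1 z2]].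
  apply: (add x y Rx Ry).
  + by case=> t /S Rt [t1 t2]; apply: nx; exists t.
  + by case=> t /S Rt [t1 t2]; apply: ny; exists t.
  + by exists z.
- move=> i j ij a L mL.
  rewrite [X in L X](_ : _ = (e j : A) ** a ** (e i : A)); last exact: (@amulA _ _ A).
  set x : A := _ ** _ ** _.
  have Jx : Jgr x by apply: off; rewrite eq_sym.
  apply: contrapT => nLx.
  have [h nLh] : exists h, ~ L (hc h x).
    apply: contrapT => nh; apply: nLx.
    have [s ->] := hc_full x; apply: (gs_sum (N := L)) => h _.
    by apply: contrapT => nLh; apply: nh; exists h.
  pose y : A := hc h x; have {}nLh : ~ L y by [].
  have jy : e j ** y = y.
    by rewrite /y -(hc_mull _ _ (df_hom e j)) add0r /x !amulA df_idem.
  have Jy : Jgr y by apply: Jgr_hc.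
  have hy : ahom A h y by apply: hcP.
  pose C := @cyc K H (gop A) (regmod (gop A)) h y hy.
  have Cy : C y by apply: cyc_id.
  have [[a0 nLa] maxL] := mL.
  have [|L1|L1] := maxL (gs_add L C).
  + move=> b Lb; exists b => //; rewrite subrr; exact: gs_0.
  + by apply: nLh; apply: L1; exists 0; rewrite ?subr0 //; apply: gs_0.
  have [l [Ll [b Eb]]] : exists l : A, L l /\ exists b : A, e j - l = y ** b.
    by have [l Ll [b Eb]] := L1 (e j); exists l; split => //; exists b.
  pose b' := hc (- h) b ** e j.
  have byb : bih 0 j j (y ** b').
    split; last by rewrite /b' -!amulA df_idem.
      rewrite -(subrr h); apply: ahom_mul => //; rewrite -(addr0 (- h)).
      by apply: ahom_mul; [apply: hcP | apply: df_hom].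
    by rewrite amulA jy.
  have Lb : L (e j - y ** b').
    have El : l = e j - y ** b by rewrite -Eb subKr.
    have := gs_act (g := L) (e j) (gs_gc (L := L) 0 Ll).
    rewrite [X in L X](_ : _ = e j - y ** b') //.
    rewrite [LHS](_ : _ = hc 0 l ** e j) // El addrC -scaleN1r hcM.
    rewrite (hc_id (df_hom e j)) -{1}(subrr h) (hc_mull _ _ hy) scaleN1r addrC.
    by rewrite amulBl df_idem -amulA.
  have [|||[z [_ xz zx]]|[z [_ _ zx]]] := @local_e j (e j - y ** b') (y ** b').
  + by apply: bihB => //; apply: bih_e.
  + by [].
  + by rewrite subrK.
  + apply: nLh; rewrite -jy; apply: (gs_act (g := L) y); rewrite -xz.
    exact: (gs_act (g := L) z).
  + by apply: (@Jgr_e j); rewrite -zx; apply: Jgr_mull; apply: Jgr_right.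
Qed.

End Radical.

Section RadicalModules.
Variables (K : fieldType) (H : zmodType).

Lemma Jgr_op (A : galgei K H) (I : choiceType) (e : dfamily A I) (wb : weakly_basic e) (x : A) :
  @Jgr K H (gop A) x <-> Jgr x.
Proof.
rewrite (Jgr_char wb) (Jgr_char (wb_op wb)).
have E i h : (e i : A) ** hc h x ** e i = e i ** (hc h x ** e i) by rewrite amulA.
split=> nx i h [z [z1 z2]]; apply: (nx i h); exists z.
  by split; [move: z2 | move: z1]; rewrite ?E.
by split; [move: z2 | move: z1]; rewrite ?E.
Qed.

Variables (A : galgei K H) (I : choiceType) (e : dfamily A I).
Hypothesis wb : weakly_basic e.
Implicit Types M : grmod A.

(** A bihomogeneous element outside the radical is invertible, so it kills no
    nonzero element of e_i M. *)
Lemma annJ M i h (x : M) : ghom M h x -> act (e i) x = x -> x <> 0 ->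
  (forall a, Jgr a -> act a x = 0) -> forall a, act a x = 0 <-> Jgr (a ** e i).
Proof.
move=> hx ix x0 Jx a; split=> [ax|Ja]; last first.
  by rewrite -ix actA; apply: Jx.
apply: (bih_sub (e := e) (L := Jleft A)) => k l; apply: contrapT => nJ.
have E : act (e k) (gc l (a ** e i : regmod A)) = e k ** hc l a ** e i.
  by rewrite -amulA -(hc_mulr _ _ (df_hom e i)) add0r.
have {E}nJ : ~ Jgr (e k ** hc l a ** e i) by rewrite -E.
have [_ [b [_ bx _]]] := not_Jgr_inv wb (bih_comp e l k i a) nJ.
apply: x0; rewrite -ix -bx -!actA ix.
by rewrite -(addrK h l) -(gc_actr _ _ hx) ax gc0 !act0r.
Qed.

(** A Nakayama argument: if a x were nonzero with a in the radical, x would be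
    c x with c in the radical and e_i - c invertible. *)
Lemma J_kills M i h (x : M) : ghom M h x -> act (e i) x = x ->
  (forall a k, ghom M k (act a x) -> act a x <> 0 -> exists b, x = act b (act a x)) ->
  forall a, Jgr a -> act a x = 0.
Proof.
move=> hx ix minx a Ja; apply: contrapT => /(bih_neq0 e)[k [l y0]].
set a' := e k ** hc (l - h) a.
have Ey : act (e k) (gc l (act a x)) = act a' x.
  by rewrite (gc_actr _ _ hx) actA.
rewrite Ey in y0; have ha' : ahom A (l - h) a'.
  by rewrite -[l - h]add0r; apply: ahom_mul; [apply: df_hom | rewrite ?add0r; apply: hcP].
have [|b Eb] := minx a' l _ y0.
  by rewrite -[l](subrK h); apply: ghom_act.
pose c := e i ** hc (h - l) b ** a' ** e i.
have bc : bih e 0 i i c.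
  split; last by rewrite /c -amulA df_idem.
    rewrite -[0](addr0 (0 : H)); apply: ahom_mul; last exact: df_hom.
    rewrite -{1}(subrr (h - l)) opprB; apply: ahom_mul => //.
    by rewrite -[h - l]add0r; apply: ahom_mul; [apply: df_hom | rewrite ?add0r; apply: hcP].
  by rewrite /c !amulA df_idem.
have Jc : Jgr c.
  by apply: Jgr_right; apply: Jgr_mull; apply: Jgr_mull; apply: Jgr_hc.
have xc : act c x = x.
  rewrite /c -3!actA ix -Ey.
  rewrite -(gc_actr _ _ (bih_hom e k l (act a x))) Ey -Eb (gc_id hx) //.
have [z Ez] := unit_sub_Jgr wb bc Jc.
have x0 : x = 0.
  by rewrite -ix -Ez -actA actDl ix -scaleN1r actZl xc scaleN1r subrr act0r.
by apply: y0; rewrite x0 act0r.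
Qed.

Lemma J_monolith M (w : M) i h : monolith w -> ghom M h w -> act (e i) w = w ->
  forall a, Jgr a -> act a w = 0.
Proof.
move=> mw hw iw; apply: J_kills hw iw _ => a k ka a0.
exact: monolith_act mw ka a0.
Qed.

Lemma quot_map M (L : grsub M) : exists p : grhom M (quot_by L),
  forall x, p x = gq_pi L x.
Proof.
have pl c (x y : M) : gq_pi L (c *: x + y) = c *: gq_pi L x + gq_pi L y.
  by rewrite gq_piD; congr (_ + _); apply/esym; apply: gq_scaleE.
have pa a (x : M) : gq_pi L (act a x) = act a (gq_pi L x : quot_by L).
  by apply/esym; apply: gq_actE.
have pd h (x : M) : ghom M h x -> ghom (quot_by L) h (gq_pi L x) by exists x.
by exists (@grhom_of K H A M (quot_by L) _ pl pa pd).
Qed.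

Variable J : gideal A.
Hypothesis JE : forall a, J a <-> Jgr a.

Lemma top_map i : exists p : grhom (Ae e i) (Ae_top e J i),
  (forall y, exists x, p x = y) /\
  forall x, p x = 0 <-> exists2 a : A, J a & val x = a ** e i.
Proof.
have [p Hp] := quot_map (Je e J i); exists p; split=> [y|x].
  by exists (gq_repr (N := Je e J i) y); rewrite Hp gq_reprK.
by rewrite Hp -(gq_pi0 (Je e J i)) gq_eq subr0.
Qed.

Definition inAe j (a : A) : Ae e j := gs_in (N := principal (df_hom e j))
    (ex_intro (fun c => a ** e j = c ** e j) a erefl).

Lemma inAeP j (c : K) a b : inAe j (c *: a + b) = c *: inAe j a + inAe j b.
Proof. by apply: val_inj; rewrite linearP /= amulDl amulZl. Qed.

Lemma inAe_act j a b : inAe j (a ** b) = act a (inAe j b).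
Proof. by apply: val_inj; rewrite /= amulA. Qed.

Lemma inAe_val j (x : Ae e j) : inAe j (val x) = x.
Proof.
by apply: val_inj => /=; have [a ->] := gs_valP x; rewrite -amulA df_idem.
Qed.

Lemma Ae_val j (x : Ae e j) : (val x : A) ** e j = val x.
Proof. by have [a ->] := gs_valP x; rewrite -amulA df_idem. Qed.

Lemma inAe_gc j h a : gc h (inAe j a) = inAe j (hc h a).
Proof.
apply: val_inj; rewrite val_gc /= [LHS](_ : _ = hc h (a ** e j)) //.
by rewrite -[h in LHS]add0r (hc_mulr _ _ (df_hom e j)).
Qed.

(** Q stands for A e_i / J e_i; only the kernel of the projection matters, and
    an abstract Q keeps conversion away from the quotient type. *)
Section Top.
Variables (M Q : grmod A) (i : I) (p : grhom (Ae e i) Q).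
Hypothesis ps : forall y, exists x, p x = y.
Hypothesis p0 : forall x, p x = 0 <-> exists2 a : A, J a & val x = a ** e i.

Lemma monolith_top_quot (w : M) d : monolith w -> ghom M d w -> act (e i) w = w ->
  griso (submod_of (socle M)) (shift Q (- d)).
Proof.
move=> mw dw iw; have Jw := J_monolith mw dw iw; have [w0 _] := mw.
have ann := annJ dw iw w0 Jw; have sE := monolith_socle mw dw.
pose G (s : submod_of (socle M)) (y : shift Q (- d)) :=
  exists a, val s = act a w /\ y = p (inAe i a).
have gG : graph G.
  split.
  - exists 0; rewrite raddf0 act0l; split => //.
    have -> : inAe i 0 = 0 by apply: val_inj; rewrite /= amul0l.
    by rewrite raddf0.
  - move=> c x y x' y' [a [xa ->]] [b [xb ->]]; exists (c *: a + b).
    rewrite linearP /= xa xb actDl actZl; split => //.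
    by rewrite inAeP linearP.
  - move=> a x y [b [xb ->]]; exists (a ** b); split; first by rewrite -actA -xb.
    by rewrite inAe_act grhom_act.
  - move=> h x y [a [xa ->]]; exists (hc (h - d) a); split.
      by rewrite val_gc xa (gc_actr _ _ dw).
    by rewrite gc_shift -[LHS]/(gc (- d + h) (p (inAe i a))) -gc_hom inAe_gc (addrC h).
  - move=> y [a [a0 ->]]; apply/p0; exists (a ** e i); last by rewrite /= -amulA df_idem.
    by apply/JE/ann; rewrite -a0 raddf0.
have [|g Hg] := graph_total gG.
  by move=> s; have [a Ea] := (sE (val s)).1 (gs_valP s); exists (p (inAe i a)), a.
exists g; apply: bij_of.
  apply: ker_inj => s; have [a Ea] := (sE (val s)).1 (gs_valP s).
  rewrite (Hg s (p (inAe i a))); last by exists a.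
  move=> /p0[b Jb Eb]; apply: val_inj; rewrite raddf0 Ea -iw actA.
  by rewrite [a ** e i]Eb -actA iw; apply: Jw; apply/JE.
move=> y; have [x Ex] := ps y; have [a Ea] := gs_valP x.
have sa : socle M (act a w) by apply/sE; exists a.
exists (gs_in sa); apply: Hg; exists a; split => //.
by rewrite -Ex; congr (p _); apply: val_inj; rewrite Ea.
Qed.

Lemma top_quot_gen (S : grsub M) h : griso (submod_of S) (shift Q h) ->
  exists w d, [/\ S w, w <> 0, ghom M d w, act (e i) w = w & forall a, J a -> act a w = 0].
Proof.
move=> [f [g fK gK]]; pose x := inAe i (e i).
have hx : ghom (Ae e i) 0 x by rewrite /= df_idem; apply: df_hom.
have ix : act (e i) x = x by apply: val_inj; rewrite /= !df_idem.
pose y : shift Q h := p x; pose w := g y.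
have fw : f w = y by apply: gK.
have fa a : f (act a w) = p (act a x) by rewrite !grhom_act fw.
have hy : ghom (shift Q h) (- h) y by rewrite /= subrr; apply: grhom_deg.
have fi : injective f := can_inj fK.
exists (val w), (- h); split.
- exact: gs_valP.
- move=> w0; have y0 : y = 0.
    by rewrite -fw (_ : w = 0) ?raddf0 //; apply: val_inj.
  have [a Ja Ea] := (p0 x).1 y0.
  apply: (@Jgr_e _ _ _ _ _ wb i); rewrite -[e i]df_idem [e i ** e i]Ea.
  by apply: Jgr_right; apply/JE.
- suff : gc (- h) w = w by move=> <-; rewrite val_gc; apply: gcP.
  by apply: fi; rewrite gc_hom fw; apply: gc_id.
- have : act (e i) w = w by apply: fi; rewrite fa ix fw.
  by move=> /(congr1 val).
- move=> a Ja; suff aw0 : act a w = 0.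
    by rewrite -[LHS]/(val (act a w)) aw0 raddf0.
  apply: fi; rewrite fa raddf0; apply/p0; exists a => //.
  by rewrite /= df_idem.
Qed.

End Top.

Lemma monolith_top M (w : M) i d : monolith w -> ghom M d w -> act (e i) w = w ->
  griso (submod_of (socle M)) (shift (Ae_top e J i) (- d)).
Proof. by have [p [ps p0]] := top_map i; apply: monolith_top_quot ps p0 _ _. Qed.

Lemma top_gen M (S : grsub M) i h :
  griso (submod_of S) (shift (Ae_top e J i) h) ->
  exists w d, [/\ S w, w <> 0, ghom M d w, act (e i) w = w & forall a, J a -> act a w = 0].
Proof. by have [p [_ p0]] := top_map i; apply: top_quot_gen p0 _ _. Qed.

End RadicalModules.

(** * Graded duals of the right modules e_i A *)

Section Coduals.
Variables (K : fieldType) (H : zmodType) (A : galgei K H).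
Variables (I : choiceType) (e : dfamily A I).
Implicit Types M N : grmod A.

(** [codual i d l] says that M, with its universal functional l of degree d, is
    the graded dual of the right module e_i A up to a shift. Stating it through
    l lets the dual module itself and the modules A e_j of a Nakayama pairing
    share all their properties. *)
Definition codual i d M (l : M -> K) : Prop :=
  [/\ lfun l,
      forall x, l x = l (act (e i) (gc d x)),
      forall x, (forall b, l (act b x) = 0) -> x = 0
    & forall a, e i ** a = a -> (forall x, l (act a x) = 0) -> a = 0].

Definition gs_top M : grsub M.
Proof.
refine (@GrSub K H A M (fun=> True) _ _ _ _ _) => // x _.
exact: graded_gc.
Defined.

Lemma gc_actB M d h a (x : M) : ahom A (d - h) a -> gc d (act a x) = act a (gc h x).
Proof. by move=> /(gc_act x h); rewrite subrK. Qed.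

Lemma gcd_shift M d h b (x : M) :
  gc d (act b (gc h x)) = gc d (act (hc (d - h) b) x).
Proof.
by rewrite (gc_actr _ _ (gcP h x)) (gc_actB _ (hcP _ b)).
Qed.

Lemma codual_act i d M (l : M -> K) k h b (x : M) : codual i d l -> ghom M h x -> act (e k) x = x ->
  l (act b x) = l (act (e i ** hc (d - h) b ** e k) x).
Proof.
by case=> _ ld _ _ hx kx; rewrite ld (gc_actr _ _ hx) -!actA kx.
Qed.

Hypothesis wb : weakly_basic e.

(** Local finiteness turns nondegeneracy into representability: a functional
    on the finite dimensional e_i A_(d-h) e_k that vanishes wherever the
    pairing with [L] does is given by pairing with an element of [L]. *)
Lemma codual_repr_in i d M (l : M -> K) (L : grsub M) k h (t : A -> K) :
  codual i d l -> lfun t ->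
  (forall b, bih e (d - h) i k b ->
     (forall x, L x -> ghom M h x -> act (e k) x = x -> l (act b x) = 0) -> t b = 0) ->
  exists x, [/\ L x, ghom M h x, act (e k) x = x
    & forall b, bih e (d - h) i k b -> l (act b x) = t b].
Proof.
move=> [ll ld _ _] lt Ht; have [fd _ _] := wb.
have [n [b [Wb sb]]] := fd i k (d - h).
have bW x : (exists2 a, ahom A (d - h) a & x = e i ** a ** e k) -> bih e (d - h) i k x.
  by case=> a ha ->; rewrite -(hc_id ha); apply: bih_comp.
pose Phi (f : A -> K) := exists x : M, [/\ L x, ghom M h x, act (e k) x = x
  & forall b, f b = l (act b x)].
have [|||||f [x [Lx hx kx fE]] fb] := @span_functionals K A n b Phi t.
- exists (fun b => l (act b 0)), 0; split => //; [exact: gs_0 | exact: ghom0 | exact: act0r].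
- by move=> f [x [_ _ _ fE]] c u v; rewrite !fE actDl actZl ll.
- move=> c f g [x [Lx hx kx fE]] [y [Ly hy ky gE]].
  exists (fun b => l (act b (c *: x + y))).
    exists (c *: x + y); split=> //.
    + by apply: gs_D => //; apply: gs_Z.
    + by apply: ghomD => //; apply: ghomZ.
    + by rewrite actDr actZr kx ky.
  by move=> u; rewrite fE gE actDr actZr ll.
- by [].
- move=> c x Hx; apply: Ht.
    have Hs : forall s : seq 'I_n, bih e (d - h) i k (\sum_(r <- s) c r *: b r).
      elim=> [|r s IH]; rewrite ?big_nil ?big_cons.
        split; rewrite ?amul0l ?amul0r //.
        by case: (ahom_direct_sum A) => sF _ _; case: (sF (d - h)).
      have [hs is_ sk] := IH; have [hr ir rk] := bW _ (Wb r); split.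
      + by case: (ahom_direct_sum A) => sF _ _; apply: (sF _).2.
      + by rewrite amulDr amulZr ir is_.
      + by rewrite amulDl amulZl rk sk.
    exact: Hs.
  by move=> y Ly hy ky; apply: (Hx (fun b => l (act b y))); exists y.
exists x; split=> // u [hu iu uk].
have [|c ->] := sb u; first by exists u => //; rewrite iu uk.
rewrite act_suml !lfun_sum //; apply: eq_bigr => r _.
by rewrite actZl !lfunZ // -fE fb.
Qed.

Lemma codual_repr i d M (l : M -> K) k h (t : A -> K) :
  codual i d l -> lfun t ->
  exists x, [/\ ghom M h x, act (e k) x = x
    & forall b, bih e (d - h) i k b -> l (act b x) = t b].
Proof.
move=> cl lt; have [|x [_ hx kx xt]] := codual_repr_in (L := gs_top M) (k := k) (h := h) cl lt.
  move=> b bb Hb; have [ll ld _ la] := cl; have [hb ib bk] := bb.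
  rewrite (la b ib) ?lfun0 // => x; rewrite ld (gc_actB _ hb) actA ib -bk -actA.
  by apply: Hb => //; [apply: bih_hom | apply: e_idem].
by exists x.
Qed.

(** A partial morphism [G] into a codual is a partial functional; extend the
    functional to the whole module and represent it. *)
Lemma codual_extends i d M (l : M -> K) N : codual i d l -> extends_from N M.
Proof.
move=> cl G gG; have [ll ld l0 la] := cl; have [G0 GD Ga Gc _] := gG.
(* The functional l m of n, for G n m, is itself given by its graph, a subspace
   of N * K without (0, 1); a functional separating the two extends it. *)
pose S (p : N * K^o) := exists2 m, G p.1 m & p.2 = l m.
have sS : is_subspace S.
  split; first by exists 0; rewrite ?lfun0.
  move=> c [n u] [n' u'] [m nm /= ->] [m' nm' /= ->]; exists (c *: m + m') => /=.
    exact: GD.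
  by rewrite ll.
have nS : ~ S (0, 1).
  move=> [m /(graph_fun gG G0) <- /=]; rewrite lfun0 // => /eqP; apply/negP; exact: oner_neq0.
have [mu [lmu muS mu1]] := separate sS nS.
pose f n := - mu (n, 0).
have lf : lfun f.
  move=> c x y; rewrite /f mulrN -opprD -lmu; congr (- mu _).
  by congr (_, _); rewrite /= ?scaler0 ?addr0.
have fG n m : G n m -> f n = l m.
  move=> nm; have : mu (n, l m) = 0 by apply: muS; exists m.
  have -> : (n, l m) = l m *: ((0, 1) : N * K^o) + (n, 0).
    by congr (_, _) => /=; rewrite ?scaler0 ?add0r // addr0 [RHS]mulr1.
  by rewrite lmu mu1 mulr1 => /eqP; rewrite addr_eq0 => /eqP ->.
(* The element m representing the functional b |-> f (e_i (b n)_d) on e_i A. *)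
pose G2 n m := forall b, l (act b m) = f (act (e i) (gc d (act b n))).
have gG2 : graph G2.
  split.
  - by move=> b; rewrite !act0r gc0 act0r !lfun0.
  - move=> c x y x' y' xy xy' b.
    by rewrite !actDr !actZr gcD gcZ actDr actZr ll lf xy xy'.
  - by move=> a x y xy b; rewrite !actA xy.
  - by move=> h x y xy b; rewrite ld gcd_shift -ld xy gcd_shift.
  - by move=> y y0; apply: l0 => b; rewrite y0 act0r gc0 act0r lfun0.
have tG2 : forall n, exists m, G2 n m.
  apply: (bih_ind (e := e)).
  - by exists 0; case: gG2.
  - move=> x y [x' xx'] [y' yy']; exists (1 *: x' + y').
    by rewrite -[x]scale1r; case: gG2 => _ G2D _ _ _; apply: G2D.
  - move=> k h n hn kn.
    have lt : lfun (fun b => f (act (e i) (gc d (act b n)))).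
      by move=> c x y; rewrite actDl actZl gcD gcZ actDr actZr lf.
    have [m [hm km Em]] := codual_repr k h cl lt.
    exists m => b; rewrite (codual_act _ cl hm km) Em; last exact: bih_comp.
    rewrite -!actA kn gc_act0; last exact: df_hom.
    by rewrite e_idem !(gc_actr _ _ hn) (hc_id (hcP _ _)).
have [g Hg] := graph_total gG2 tG2.
exists g => x y xy; apply: Hg => b; rewrite ld; apply/esym/fG.
by apply: (Ga); apply: Gc; apply: Ga.
Qed.

Lemma codual_inj i d M (l : M -> K) : codual i d l -> gr_injective M.
Proof. by move=> cl; apply: extends_inj => N; apply: codual_extends cl. Qed.

(** The monolith w represents a functional t on the local ring e_i A_0 e_i that
    is 1 at e_i and kills the radical. The functionals on that ring given by
    a nonzero submodule L have no invertible common zero, so t vanishes on their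
    common zeros and is itself given by an element of L, which must be w. *)
Lemma codual_monolith i d M (l : M -> K) : codual i d l ->
  exists w, [/\ monolith w, ghom M d w & act (e i) w = w].
Proof.
move=> cl; have [ll ld l0 la] := cl.
have sJ : is_subspace (fun a : A => Jgr a).
  split; first exact: (gs_0 (Jleft A)).
  move=> c x y Jx Jy; apply: (gs_D (g := Jleft A)) => //; exact: (gs_Z (g := Jleft A)).
have [t [lt tJ t1]] := separate sJ (@Jgr_e _ _ _ _ _ wb i).
have [w [dw iw wt]] := codual_repr i d cl lt; rewrite subrr in wt.
exists w; split=> //; split.
  move=> w0; have := wt (e i) (bih_e e i); rewrite w0 act0r lfun0 // t1.
  by move=> /esym/eqP; apply/negP; apply: oner_neq0.
move=> L [x Lx x0].
have [b' nb'] : exists b', l (act b' x) <> 0.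
  apply: contrapT => nb; apply: x0; apply: l0 => b; apply: contrapT => lb.
  by apply: nb; exists b.
pose m := act (e i) (gc d (act b' x)).
have Lm : L m by do ?[apply: gs_act || apply: gs_gc].
have [|y [Ly dy iy yt]] := codual_repr_in (L := L) (k := i) (h := d) cl lt.
  rewrite subrr => b bb Hb; have [Jb|nJb] := pselect (Jgr b); first exact: tJ.
  have [_ [c [bc _ bce]]] := not_Jgr_inv wb bb nJb; case: nb'.
  have im : act (e i) m = m by apply: e_idem.
  have [hc0 ic _] := bc; rewrite oppr0 in hc0.
  rewrite ld -/m -im -bce -actA; apply: Hb.
  - exact: gs_act.
  - by rewrite -[d]add0r; apply: ghom_act => //; rewrite ?add0r; apply: bih_hom.
  - by rewrite actA ic.
rewrite subrr in yt; suff -> : w = y by [].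
apply/eqP; rewrite -subr_eq0; apply/eqP/l0 => b.
rewrite -scaleN1r actDr actZr scaleN1r lfunB //.
rewrite (codual_act _ cl dw iw) (codual_act _ cl dy iy) subrr.
by rewrite wt ?yt ?subrr //; apply: bih_comp.
Qed.

Lemma codual_shift i d M (l : M -> K) k : codual i d l -> @codual i (d - k) (shift M k) l.
Proof.
case=> ll ld l0 la; split=> // x.
by rewrite gc_shift addrC subrK.
Qed.

Lemma codual_iso i d M N (f : grhom N M) (l : M -> K) : bijective f -> codual i d l ->
  codual i d (fun x => l (f x)).
Proof.
move=> [g fK gK] [ll ld l0 la]; split.
- by move=> c x y; rewrite linearP ll.
- by move=> x; rewrite ld grhom_act gc_hom.
- move=> x Hx; apply: (can_inj fK); rewrite raddf0; apply: l0 => b.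
  by rewrite -grhom_act.
- by move=> a ia Ha; apply: la => // x; rewrite -[x]gK -grhom_act.
Qed.

End Coduals.

(** * The Nakayama pairing *)

Section Pairing.
Variables (K : fieldType) (H : zmodType).

(** A form on e_i A x A e_j that is associative, homogeneous of degree [d] and
    nondegenerate, written as a functional of the product. *)
Definition pairing (A : galgei K H) (I : choiceType) (e : dfamily A I) (i j : I) d
    (f : A -> K) : Prop :=
  [/\ lfun f,
      forall a, f a = f (e i ** hc d a ** e j),
      forall y, y ** e j = y -> (forall b, f (b ** y) = 0) -> y = 0
    & forall x, e i ** x = x -> (forall b, f (x ** b) = 0) -> x = 0].

Definition paired (A : galgei K H) (I : choiceType) (e : dfamily A I) i j :=
  exists d f, pairing e i j d f.

Lemma paired_op (A : galgei K H) (I : choiceType) (e : dfamily A I) i j :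
  @paired (gop A) I (df_op e) j i <-> paired e i j.
Proof.
split=> -[d [f [lf fd fr fl]]]; exists d, f; split=> // a; rewrite {1}fd /=.
  by rewrite amulA.
by rewrite amulA.
Qed.

Variables (A : galgei K H) (I : choiceType) (e : dfamily A I).

Lemma pairing_codual i j d f : pairing e i j d f -> codual e i d (fun y : Ae e j => f (val y)).
Proof.
case=> lf fd fr fl; split.
- by move=> c x y; rewrite linearP lf.
- move=> x; rewrite fd; congr f; transitivity (e i ** hc d (val x : A)).
    by rewrite -amulA -(hc_mulr _ _ (df_hom e j)) add0r Ae_val.
  by rewrite -[RHS]/(e i ** val (gc d x)) val_gc.
- by move=> x Hx; apply: val_inj; rewrite raddf0; apply: fr => //; apply: Ae_val.
- move=> a ia Ha; apply: fl => // b; rewrite fd -amulA -(hc_mulr _ _ (df_hom e j)) add0r.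
  have := Ha (inAe e j b); rewrite /= fd -!amulA => <-.
  by congr f; congr (_ ** _); rewrite -(hc_mulr _ _ (df_hom e j)) add0r -!amulA df_idem.
Qed.

Lemma codual_pairing i j d (l : Ae e j -> K) : codual e i d l -> paired e i j.
Proof.
case=> ll ld l0 la; exists d, (fun a => l (inAe e j a)); split.
- by move=> c x y; rewrite inAeP ll.
- move=> a; rewrite ld inAe_gc -inAe_act; congr l; apply: val_inj.
  by rewrite /= -!amulA df_idem.
- move=> y yj Hy; rewrite -yj -[LHS]/(val (inAe e j y)) [inAe e j y]l0 ?raddf0 // => b.
  by rewrite -inAe_act.
- by move=> x ix Hx; apply: la => // y; rewrite -[y]inAe_val -inAe_act.
Qed.

End Pairing.

(** * The graded dual as a module *)

Section DualModule.
Variables (K : fieldType) (H : zmodType) (A : galgei K H).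
Variables (I : choiceType) (e : dfamily A I) (i : I).

Let AK : lmodType K := (A -> K^o).

(** The functionals on some e_i A_(-h) e_k, extended by zero. *)
Definition dual_bih (k : I) (h : H) (f : AK) : Prop :=
  lfun (f : A -> K) /\ forall b, f b = f (e i ** hc (- h) b ** e k).

Definition dual_fun : set AK := sums (fun f => exists k h, dual_bih k h f).

Definition dual_pred : {pred AK} := fun f => `[< dual_fun f >].

Lemma dual_predE f : (f \in dual_pred) <-> dual_fun f.
Proof. by split=> /asboolP. Qed.

Lemma dual_bihZ k h (c : K) f : dual_bih k h f -> dual_bih k h (c *: f).
Proof.
move=> [lf fE]; split=> [a x y|b].
  change (c * f (a *: x + y) = a * (c * f x) + c * f y).
  by rewrite lf mulrDr !mulrA (mulrC c a).
by change (c * f b = c * f (e i ** hc (- h) b ** e k)); rewrite -fE.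
Qed.

Lemma dual_closed : submod_closed dual_pred.
Proof.
split; first by apply/dual_predE; apply: sums0.
move=> c f g /dual_predE Df /dual_predE Dg; apply/dual_predE; apply: sumsD => //.
apply: sums_map Df; [exact: scaler0 | exact: scalerDr |].
by move=> u [k [h hu]]; exists k, h; apply: dual_bihZ.
Qed.

HB.instance Definition _ := GRing.isSubmodClosed.Build K AK dual_pred dual_closed.

Definition dual_type := {f : AK | f \in dual_pred}.
HB.instance Definition _ := SubChoice.on dual_type.
HB.instance Definition _ := [SubChoice_isSubLmodule of dual_type by <:].

Lemma dual_valP (f : dual_type) : dual_fun (val f).
Proof. by apply/dual_predE; apply: valP. Qed.

Lemma dual_lfun (f : AK) : dual_fun f -> lfun (f : A -> K).
Proof.
elim/sums_ind => [c x y|u v [k [h [lu _]]] lv c x y]; first by rewrite mulr0 addr0.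
rewrite -[LHS]/(u (c *: x + y) + v (c *: x + y)) lu lv.
by rewrite -[X in _ = c * X + _]/(u x + v x) -[X in _ = _ + X]/(u y + v y) mulrDr addrACA.
Qed.

Lemma dual_e (f : AK) : dual_fun f -> forall b, f b = f (e i ** b).
Proof.
elim/sums_ind => [//|u v [k [h [_ uE]]] IH b].
rewrite -[LHS]/(u b + v b) -[RHS]/(u (e i ** b) + v (e i ** b)) IH; congr (_ + _).
by rewrite uE [RHS]uE -[- h in RHS]add0r (hc_mull _ _ (df_hom e i)) amulA df_idem.
Qed.

Lemma dual_act_subproof a (f : AK) : dual_fun f -> dual_fun ((fun b => f (b ** a)) : AK).
Proof.
elim/sums_ind => [|u v [k [h [lu uE]]] IH]; first exact: sums0.
rewrite (_ : (fun b => (u + v) (b ** a)) =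
  ((fun b => u (b ** a)) : AK) + ((fun b => v (b ** a)) : AK)) //.
apply: sumsD => // {IH v}.
apply: (@bih_ind K H A I e (regmod A)
  (fun a : A => dual_fun ((fun b => u (b ** a)) : AK)) _ _ _ a) => {a}.
- rewrite (_ : (fun b => u (b ** 0)) = 0 :> AK); first exact: sums0.
  by apply: funext => b; rewrite amul0r lfun0.
- move=> x y IHx IHy; rewrite (_ : (fun b => u (b ** (x + y))) =
    ((fun b => u (b ** x)) : AK) + ((fun b => u (b ** y)) : AK)); first exact: sumsD.
  by apply: funext => b; rewrite amulDr lfunD.
move=> l g a ga la; apply: sums1; exists l, (h + g); split.
  by move=> c x y; rewrite amulDl amulZl lu.
move=> b; have {}la : e l ** a = a by [].
have E (c : A) : hc (- h) (c ** a) = hc (- (h + g)) c ** a.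
  by rewrite -(hc_mulr _ _ ga) opprD addrCA subrr addr0.
pose b' := hc (- (h + g)) b.
have hb' : ahom A (- h) (e i ** (b' ** a)).
  rewrite -[- h]add0r -(E b).
  by apply: ahom_mul; [apply: df_hom | apply: hcP].
rewrite uE (E b) -[in RHS](amulA _ (e l)) la -[in RHS]amulA [RHS]uE (hc_id hb').
by rewrite !amulA df_idem.
Qed.

Definition dual_in f (Df : dual_fun f) : dual_type := exist _ f ((dual_predE f).2 Df).

Definition dual_act (a : A) (f : dual_type) : dual_type :=
  dual_in (dual_act_subproof a (dual_valP f)).

Definition dual_hom (h : H) (f : dual_type) : Prop := forall b, val f b = val f (hc (- h) b).

Lemma dual_ind (P : dual_type -> Prop) : P 0 ->
  (forall f g, P f -> P g -> P (f + g)) ->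
  (forall k h f, dual_bih k h (val f) -> P f) -> forall f, P f.
Proof.
move=> P0 PD Pb f; move Ev : (val f) (dual_valP f) => v Dv.
elim/sums_ind: Dv f Ev => [|u w [k [h bu]] IH] f Ev.
  by rewrite (_ : f = 0) //; apply: val_inj; rewrite Ev raddf0.
have Du : dual_fun u by apply: sums1; exists k, h.
rewrite -[f](subrK (dual_in Du)); apply: PD; last exact: (Pb k h).
by apply: IH; rewrite raddfB /= Ev addrC addKr.
Qed.

Lemma dual_bih_hom k h f : dual_bih k h (val f) -> dual_hom h f.
Proof. by move=> [_ fE] b; rewrite fE [RHS]fE (hc_id (hcP (- h) b)). Qed.

Lemma dual_unital (x : dual_type) : sums (fun y => exists a z, y = dual_act a z) x.
Proof.
elim/dual_ind: x => [|f g IHf IHg|k h f [lf fE]]; [exact: sums0 | exact: sumsD |].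
apply: sums1; exists (e k), f; apply: val_inj; apply: funext => b /=.
by rewrite fE [RHS]fE -[in RHS](add0r (- h)) (hc_mulr _ _ (df_hom e k)) -!amulA df_idem.
Qed.

Lemma dual_direct_sum : direct_sum dual_hom.
Proof.
split.
- move=> h; split; first by move=> b.
  move=> c f g hf hg b.
  by rewrite linearP -[LHS]/(c * val f b + val g b) hf hg.
- move=> f; elim/dual_ind: f => [|f g|k h f /dual_bih_hom hf]; [exact: sums0 | exact: sumsD |].
  by apply: sums1; exists h.
- move=> s F us hF E h hs; apply: val_inj; apply: funext => b.
  have := congr1 (fun f : dual_type => val f (hc (- h) b)) E.
  rewrite raddf_sum /= fct_sumE (bigD1_seq h) //= -hF big1 ?addr0 // => k kh.
  rewrite hF (hc_ne (hcP _ b)) ?lfun0 //; first by apply: dual_lfun; apply: dual_valP.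
  by rewrite (inj_eq (@oppr_inj _)).
Qed.

(** The graded dual of e_i A, as a left module. *)
Definition dual_mod : grmod A.
Proof.
refine (@GrMod K H A dual_type dual_act _ _ _ _ _ dual_unital dual_hom dual_direct_sum _).
- by move=> a b f; apply: val_inj; apply: funext => c /=; rewrite amulA.
- move=> a b f; apply: val_inj; apply: funext => c /=; rewrite amulDr.
  by rewrite lfunD //; apply: dual_lfun; apply: dual_valP.
- by move=> a f g; apply: val_inj; apply: funext.
- move=> c a f; apply: val_inj; apply: funext => b /=; rewrite amulZr.
  by rewrite lfunZ //; apply: dual_lfun; apply: dual_valP.
- by move=> c a f; apply: val_inj; apply: funext.
- move=> h k a f ha hf b /=.
  have E (c : A) : hc (- k) (c ** a) = hc (- (h + k)) c ** a.
    by rewrite -(hc_mulr _ _ ha) opprD addrA subrr add0r.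
  by rewrite hf [RHS]hf !E (hc_id (hcP _ b)).
Defined.

Lemma dual_gc h (f : dual_mod) b : val (gc h f) b = val f (hc (- h) b).
Proof.
have [t [ut t0 Ef]] := comp_sum (ghom_direct_sum dual_mod) f.
rewrite [in RHS]Ef raddf_sum /= fct_sumE.
have E k : val (gc k f) (hc (- h) b) = if k == h then val (gc h f) b else 0.
  case: eqP => [->|/eqP kh]; first by rewrite -(gcP h f b).
  rewrite (gcP k f) (hc_ne (hcP _ b)) ?(inj_eq (@oppr_inj _)) //.
  by rewrite lfun0 //; apply: dual_lfun; apply: dual_valP.
rewrite (eq_bigr _ (fun k _ => E k)) -big_mkcond /=.
have [ht|/t0 f0] := boolP (h \in t).
  by rewrite -big_filter filter_pred1_uniq // big_seq1.
rewrite (_ : gc h f = 0); last exact: f0.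
by rewrite big1 ?raddf0.
Qed.

(** Evaluation at e_i is the universal functional. It detects a nonzero x in e_i A
    because some functional on a single component e_i A_h e_k does not vanish on
    the corresponding part of x. *)
Lemma dual_codual : @codual K H A I e i 0 dual_mod (fun f => val f (e i)).
Proof.
split.
- by move=> c f g; rewrite linearP.
- move=> f; rewrite /= df_idem dual_gc oppr0 hc_id //; exact: df_hom.
- move=> f f0; apply: val_inj; apply: funext => b.
  by rewrite dual_e; [apply: f0 | apply: dual_valP].
- move=> x ix Hx; apply: contrapT => x0.
  have [k [h]] := @bih_neq0 K H (gop A) I (df_op e) (regmod (gop A)) x x0.
  rewrite -[act _ _]/(hc h x ** e k) => xhk.
  have [||t [lt _ t1]] := @separate K A (fun y => y = 0) (hc h x ** e k).
  + by split=> // c u v -> ->; rewrite scaler0 addr0.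
  + exact: xhk.
  pose f : AK := fun b => t (e i ** hc h b ** e k).
  have bf : dual_bih k (- h) f.
    split; first by move=> c u v; rewrite /f hcM amulDr amulZr amulDl amulZl lt.
    by move=> b; rewrite /f opprK; case: (bih_comp e h i k b) => hb ib bk; rewrite (hc_id hb) ib bk.
  have Df : dual_fun f by apply: sums1; exists k, (- h).
  have := Hx (dual_in Df); rewrite /= ix /f -(hc_mull _ _ (df_hom e i)) add0r ix t1.
  by move=> /eqP; apply/negP; apply: oner_neq0.
Qed.

End DualModule.

(** * Graded free modules *)

Section FreeModule.
Variables (K : fieldType) (H : zmodType) (A : galgei K H).
Variables (I : choiceType) (e : dfamily A I).
Variables (T : choiceType) (i : T -> I) (d : T -> H).

Let AT : lmodType K := (T -> A).

Let fctP (c : K) (x y : AT) t : (c *: x + y) t = c *: x t + y t.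
Proof. by []. Qed.

Definition free_fun : set AT := fun x =>
  (exists s : seq T, forall t, t \notin s -> x t = 0) /\ forall t, x t ** e (i t) = x t.

Definition free_pred : {pred AT} := fun x => `[< free_fun x >].

Lemma free_predE x : (x \in free_pred) <-> free_fun x.
Proof. by split=> /asboolP. Qed.

Lemma free_closed : submod_closed free_pred.
Proof.
split; first by apply/free_predE; split=> [|t]; [exists [::] | apply: amul0l].
move=> c x y /free_predE[[s xs] xi] /free_predE[[r yr] yi]; apply/free_predE; split.
  exists (s ++ r) => t; rewrite mem_cat negb_or => /andP[/xs xt /yr yt].
  by rewrite fctP xt yt scaler0 addr0.
by move=> t; rewrite fctP amulDl amulZl xi yi.
Qed.

HB.instance Definition _ := GRing.isSubmodClosed.Build K AT free_pred free_closed.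

Definition free_type := {x : AT | x \in free_pred}.
HB.instance Definition _ := SubChoice.on free_type.
HB.instance Definition _ := [SubChoice_isSubLmodule of free_type by <:].

Lemma free_valP (x : free_type) : free_fun (val x).
Proof. by apply/free_predE; apply: valP. Qed.

Definition free_in x (Fx : free_fun x) : free_type := exist _ x ((free_predE x).2 Fx).

Lemma free_act_subproof a x : free_fun x -> free_fun (fun t => a ** x t).
Proof.
case=> [[s xs] xi]; split; last by move=> t; rewrite -amulA xi.
by exists s => t /xs ->; rewrite amul0r.
Qed.

Definition free_act (a : A) (x : free_type) : free_type :=
  free_in (free_act_subproof a (free_valP x)).

Definition free_hom (h : H) (x : free_type) : Prop := forall t, ahom A (h - d t) (val x t).

Lemma single_subproof t a : free_fun (fun t' => if t' == t then a ** e (i t) else 0).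
Proof.
split; first by exists [:: t] => t'; rewrite inE => /negPf ->.
by move=> t'; case: eqP => [->|_]; rewrite ?amul0l // -amulA df_idem.
Qed.

Definition single (t : T) (a : A) : free_type := free_in (single_subproof t a).

Lemma singleD t : {morph single t : a b / a + b}.
Proof.
move=> a b; apply: val_inj; apply: funext => t' /=.
rewrite -[RHS]/((if t' == t then a ** e (i t) else 0) + (if t' == t then b ** e (i t) else 0)).
by case: eqP; rewrite ?amulDl ?addr0.
Qed.

Lemma single0 t : single t 0 = 0.
Proof.
apply: val_inj; rewrite raddf0; apply: funext => t' /=.
by case: eqP; rewrite ?amul0l.
Qed.

Lemma single_hom t h a : ahom A h a -> free_hom (h + d t) (single t a).
Proof.
move=> ha t' /=; case: eqP => [->|_]; last by case: (ahom_direct_sum A) => sF _ _; case: (sF (h + d t - d t')).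
by rewrite addrK -[h]addr0; apply: ahom_mul => //; apply: df_hom.
Qed.

Lemma free_sum (x : free_type) (s : seq T) : uniq s -> (forall t, t \notin s -> val x t = 0) ->
  x = \sum_(t <- s) single t (val x t).
Proof.
move=> us xs; apply: val_inj; apply: funext => t.
rewrite raddf_sum /= fct_sumE /=; have [_ xi] := free_valP x.
have [ts|ts] := boolP (t \in s); last first.
  rewrite xs // big1_seq // => t' /andP[_ t's].
  by case: eqP t's => // <- /(negP ts).
rewrite (bigD1_seq t) //= eqxx xi big1 ?addr0 // => t' t't.
by rewrite eq_sym (negPf t't).
Qed.

Lemma free_supp (x : free_type) : exists2 s : seq T, uniq s & forall t, t \notin s -> val x t = 0.
Proof.
have [[s xs] _] := free_valP x; exists (undup s); first exact: undup_uniq.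
by move=> t; rewrite mem_undup; apply: xs.
Qed.

Lemma free_supp_seq (X : eqType) (s : seq X) (f : X -> free_type) :
  exists r : seq T, forall z, z \in s -> forall t, t \notin r -> val (f z) t = 0.
Proof.
elim: s => [|z s [r IH]]; first by exists [::].
have [r' _ Hr'] := free_supp (f z); exists (r' ++ r) => u.
rewrite inE => us t; rewrite mem_cat negb_or => /andP[tr' tr].
by case/orP: us => [/eqP ->|us]; [apply: Hr' | apply: IH].
Qed.

Lemma free_unital (x : free_type) : sums (fun y => exists a z, y = free_act a z) x.
Proof.
have [s us xs] := free_supp x; have [u Eu] := alunit (map (val x) s).
apply: sums1; exists u, x; apply: val_inj; apply: funext => t /=.
have [ts|/xs ->] := boolP (t \in s); last by rewrite amul0r.
by rewrite Eu //; apply: map_f.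
Qed.

Lemma free_direct_sum : direct_sum free_hom.
Proof.
split.
- move=> h; split.
    by move=> t; case: (ahom_direct_sum A) => sF _ _; case: (sF (h - d t)).
  move=> c x y hx hy t; rewrite linearP.
  by case: (ahom_direct_sum A) => sF _ _; apply: (sF (h - d t)).2.
- move=> x; have [s us xs] := free_supp x; rewrite (free_sum us xs).
  elim/big_ind: _ => [|y z|t _]; [exact: sums0 | exact: sumsD |].
  have [r ->] := hc_full (val x t).
  rewrite (big_morph (single t) (@singleD t) (single0 t)).
  elim/big_ind: _ => [|y z|h _]; [exact: sums0 | exact: sumsD |].
  by apply: sums1; exists (h + d t); apply: single_hom; apply: hcP.
- move=> s F us hF E h hs; apply: val_inj; apply: funext => t.
  have := congr1 (fun x : free_type => hc (h - d t) (val x t)) E.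
  rewrite raddf_sum raddf0 /= fct_sumE /hc comp_bigsum comp0 -/(hc _ _).
  rewrite (bigD1_seq h) //= comp_id; last exact: hF.
  rewrite big1 ?addr0 // => k kh; apply: (comp_ne _ (hF k t)).
  by rewrite (inj_eq (addIr _)) eq_sym.
Qed.

(** Finitely supported families, the t-th entry in A e_(i t), with a
    generator of degree [d t] for each [t]. *)
Definition free_mod : grmod A.
Proof.
refine (@GrMod K H A free_type free_act _ _ _ _ _ free_unital free_hom free_direct_sum _).
- by move=> a b x; apply: val_inj; apply: funext => t /=; rewrite amulA.
- by move=> a b x; apply: val_inj; apply: funext => t /=; rewrite amulDl.
- by move=> a x y; apply: val_inj; apply: funext => t /=; rewrite amulDr.
- by move=> c a x; apply: val_inj; apply: funext => t /=; rewrite amulZl.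
- by move=> c a x; apply: val_inj; apply: funext => t /=; rewrite amulZr.
- by move=> h k a x ha hx t /=; rewrite -addrA; apply: ahom_mul.
Defined.

Lemma free_lin (c : K) (x y : free_mod) t : val (c *: x + y) t = c *: val x t + val y t.
Proof. by rewrite linearP. Qed.

Lemma free_gc h (x : free_mod) t : val (gc h x) t = hc (h - d t) (val x t).
Proof.
rewrite addrC; apply/esym.
apply: (comp_shift (ghom_direct_sum free_mod) (ahom_direct_sum A) (f := fun x : free_mod => val x t)) => //.
by move=> k y hy; rewrite addrC; apply: hy.
Qed.

Lemma free_map (M : grmod A) (y : T -> M) :
  (forall t, act (e (i t)) (y t) = y t) -> (forall t, ghom M (d t) (y t)) ->
  exists g : grhom free_mod M, forall (x : free_mod) (s : seq T), uniq s ->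
    (forall t, t \notin s -> val x t = 0) -> g x = \sum_(t <- s) act (val x t) (y t).
Proof.
move=> iy dy.
pose G (x : free_mod) m := exists s, [/\ uniq s, forall t, t \notin s -> val x t = 0
  & m = \sum_(t <- s) act (val x t) (y t)].
have ext (x : free_mod) s r : uniq s -> uniq r -> {subset s <= r} ->
    (forall t, t \notin s -> val x t = 0) ->
    \sum_(t <- s) act (val x t) (y t) = \sum_(t <- r) act (val x t) (y t).
  by move=> us ur sr xs; rewrite (@big_subset _ _ s r) // => t /xs ->; rewrite act0l.
have sub1 (s r : seq T) : {subset s <= undup (s ++ r)}.
  by move=> t ts; rewrite mem_undup mem_cat ts.
have sub2 (s r : seq T) : {subset r <= undup (s ++ r)}.
  by move=> t ts; rewrite mem_undup mem_cat ts orbT.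
have gG : graph G.
  split.
  - by exists [::]; rewrite big_nil; split.
  - move=> c x u x' u' [s [us xs ->]] [r [ur xr ->]]; exists (undup (s ++ r)).
    split; first exact: undup_uniq.
      move=> t; rewrite mem_undup mem_cat negb_or => /andP[/xs xt /xr x't].
      by rewrite free_lin xt x't scaler0 addr0.
    rewrite (ext _ _ _ us (undup_uniq (s ++ r))) // (ext _ _ _ ur (undup_uniq (s ++ r))) //.
    rewrite scaler_sumr -big_split; apply: eq_bigr => t _.
    by rewrite free_lin actDl actZl.
  - move=> a x u [s [us xs ->]]; exists s; split=> //.
      by move=> t /xs xt /=; rewrite xt amul0r.
    by rewrite act_sumr; apply: eq_bigr => t _; rewrite actA.
  - move=> h x u [s [us xs ->]]; exists s; split=> //.
      by move=> t /xs xt; rewrite free_gc xt; apply: comp0.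
    by rewrite gc_sum; apply: eq_bigr => t _; rewrite free_gc (gc_actr _ _ (dy t)).
  - by move=> m [s [us xs ->]]; rewrite big1 // => t _; rewrite raddf0 act0l.
have [|g Hg] := graph_total gG.
  by move=> x; have [s us xs] := free_supp x; exists (\sum_(t <- s) act (val x t) (y t)), s.
by exists g => x s us xs; apply: Hg; exists s.
Qed.

Lemma free_map_single (M : grmod A) (y : T -> M) :
  (forall t, act (e (i t)) (y t) = y t) -> (forall t, ghom M (d t) (y t)) ->
  forall g : grhom free_mod M, (forall (x : free_mod) (s : seq T), uniq s ->
    (forall t, t \notin s -> val x t = 0) -> g x = \sum_(t <- s) act (val x t) (y t)) ->
  forall t a, g (single t a) = act a (y t).
Proof.
move=> iy dy g Hg t a; rewrite (Hg _ [:: t]) //.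
  by rewrite big_seq1 /= eqxx -actA iy.
by move=> t'; rewrite inE /= => /negPf ->.
Qed.

Lemma single_act t a b : single t (a ** b) = act a (single t b : free_mod).
Proof.
apply: val_inj; apply: funext => t' /=.
by case: eqP; rewrite ?amul0r // amulA.
Qed.

Lemma single_gen t a : single t a = act a (single t (e (i t)) : free_mod).
Proof.
rewrite -single_act; apply: val_inj; apply: funext => t' /=.
by case: eqP => // _; rewrite -amulA df_idem.
Qed.

Lemma single_e t : act (e (i t)) (single t (e (i t)) : free_mod) = single t (e (i t)).
Proof. by rewrite -single_act df_idem. Qed.

Lemma free_hom_ext (M : grmod A) (f g : grhom free_mod M) :
  (forall t, f (single t (e (i t))) = g (single t (e (i t)))) -> forall x, f x = g x.
Proof.
move=> fg x; have [s us xs] := free_supp x; rewrite (free_sum us xs) !raddf_sum /=.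
by apply: eq_bigr => t _; rewrite single_gen !grhom_act fg.
Qed.

Lemma free_gen_hom t : ghom free_mod (d t) (single t (e (i t))).
Proof. by rewrite -[d t]add0r; apply: single_hom; apply: df_hom. Qed.

(** Generators are lifted to elements of the right degree and the right e_i M. *)
Lemma free_projective : gr_projective free_mod.
Proof.
move=> M N p f pp.
pose gen t : free_mod := single t (e (i t)).
have /choice[y Hy] t : exists y : M, [/\ act (e (i t)) y = y, ghom M (d t) y & p y = f (gen t)].
  have [y Ey] := pp (f (gen t)); exists (act (e (i t)) (gc (d t) y)).
  split; [exact: e_idem | exact: bih_hom |].
  by rewrite grhom_act gc_hom Ey -gc_hom -grhom_act gc_id ?single_e //; apply: free_gen_hom.
have iy t : act (e (i t)) (y t) = y t by case: (Hy t).
have dy t : ghom M (d t) (y t) by case: (Hy t).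
have [g Hg] := free_map iy dy; exists g.
have [k Hk] := hom_comp p g.
suff E x : k x = f x by move=> x; rewrite -E Hk.
apply: free_hom_ext => t; rewrite Hk (free_map_single iy dy Hg).
by have [_ _ <-] := Hy t; rewrite iy.
Qed.

Lemma free_proj t : exists p : grhom free_mod (shift (Ae e (i t)) (- d t)),
  forall x, val (p x) = val x t.
Proof.
have xi (x : free_mod) : val x t ** e (i t) = val x t by case: (free_valP x).
pose p (x : free_mod) : shift (Ae e (i t)) (- d t) := inAe e (i t) (val x t).
have pl c x y : p (c *: x + y) = c *: p x + p y.
  by rewrite /p -[RHS]inAeP linearP.
have pa a x : p (act a x) = act a (p x) by rewrite /p -[RHS]inAe_act.
have pd h x : ghom free_mod h x -> ghom (shift (Ae e (i t)) (- d t)) h (p x).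
  by move=> hx; rewrite /= xi addrC; apply: hx.
by exists (@grhom_of K H A free_mod _ p pl pa pd) => x /=; rewrite xi.
Qed.

Lemma free_inj t : exists p : grhom (shift (Ae e (i t)) (- d t)) free_mod,
  forall x, p x = single t (val x).
Proof.
pose p (x : shift (Ae e (i t)) (- d t)) : free_mod := single t (val x).
have pl c x y : p (c *: x + y) = c *: p x + p y.
  apply: val_inj; apply: funext => t'; rewrite !linearP.
  rewrite -[RHS]/(c *: (val (p x) t') + val (p y) t') /=.
  case: eqP => _; last by rewrite scaler0 addr0.
  by rewrite -amulZl -amulDl.
have pa a x : p (act a x) = act a (p x) by rewrite /p -[RHS]single_act.
have pd h x : ghom (shift (Ae e (i t)) (- d t)) h x -> ghom free_mod h (p x).
  by move=> hx; rewrite -[h](subrK (d t)); apply: single_hom; rewrite addrC; apply: hx.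
by exists (@grhom_of K H A _ free_mod p pl pa pd).
Qed.

End FreeModule.

Section FreeCover.
Variables (K : fieldType) (H : zmodType) (A : galgei K H).
Variables (I : choiceType) (e : dfamily A I).

Lemma free_cover (M : grmod A) : exists (T : choiceType) (i : T -> I) (d : T -> H)
  (p : grhom (free_mod e i d) M), forall y, exists x, p x = y.
Proof.
pose T : choiceType := (I * H * M)%type.
pose i (t : T) := t.1.1; pose d (t : T) := t.1.2.
pose y (t : T) : M := act (e (i t)) (gc (d t) t.2).
have iy t : act (e (i t)) (y t) = y t by apply: e_idem.
have dy t : ghom M (d t) (y t) by apply: bih_hom.
have [p Hp] := free_map iy dy; exists T, i, d, p.
apply: (bih_ind (e := e)).
- by exists 0; rewrite raddf0.
- by move=> u v [x <-] [z <-]; exists (x + z); rewrite raddfD.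
- move=> k h x hx kx; exists (single e i (k, h, x) (e k)).
  by rewrite (free_map_single iy dy Hp) /y /= (gc_id hx) !kx.
Qed.

Lemma proj_free (P : grmod A) : gr_projective P ->
  exists (T : choiceType) (i : T -> I) (d : T -> H)
    (s : grhom P (free_mod e i d)) (p : grhom (free_mod e i d) P), forall x, p (s x) = x.
Proof.
move=> Pp; have [T [i [d [p pp]]]] := free_cover P.
by have [s ps] := proj_split Pp pp; exists T, i, d, s, p.
Qed.

End FreeCover.

(** * Pairings from projective duals *)

Section ProjectiveCoduals.
Variables (K : fieldType) (H : zmodType) (A : galgei K H).
Variables (I : choiceType) (e : dfamily A I).
Hypothesis wb : weakly_basic e.

Lemma idem_local i z : bih e 0 i i z -> z ** z = z -> z <> 0 -> z = e i.
Proof.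
move=> bz zz z0; have [_ iz zi] := bz.
have [||[t [bt zt tz]]|[t [bt zt tz]]] := @local_e _ _ _ _ _ wb i z (e i - z) bz.
- by apply: bihB => //; apply: bih_e.
- by rewrite addrC subrK.
- have E : t ** (z ** z) = e i by rewrite zz.
  by rewrite -{1}iz -{1}tz -amulA E.
- by case: z0; rewrite -iz -tz -amulA amulBl iz zz subrr amul0r.
Qed.

Lemma codual_unshift i d (M : grmod A) k (l : M -> K) :
  @codual _ _ _ _ e i d (shift M k) l -> codual e i (k + d) l.
Proof. by case=> ll ld l0 la; split=> // x; rewrite -gc_shift; apply: ld. Qed.

(** A projective codual embeds, through its monolith, in a single shifted
    A e_j; it splits off because it is injective, and A e_j is
    indecomposable. *)
Lemma projective_paired i d (M : grmod A) (l : M -> K) : codual e i d l ->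
  gr_projective M -> exists j, paired e i j.
Proof.
move=> cl Mp; have [w [mw dw iw]] := codual_monolith wb cl.
have Minj := codual_inj wb cl.
have [T [it [dt [s [p ps]]]]] := proj_free e Mp.
have [w0 Mw] := mw.
(* A coordinate that does not kill the monolith is injective on M. *)
have [t wt] : exists t, val (s w) t <> 0.
  apply: contrapT => nt; apply: w0; rewrite -[w]ps (_ : s w = 0) ?raddf0 //.
  apply: val_inj; apply: funext => t; rewrite raddf0; apply: contrapT => st.
  by apply: nt; exists t.
have [q Hq] := free_proj e it dt t; have [f Hf] := hom_comp q s.
pose j := it t.
have fi : injective f.
  apply: ker_inj => x fx; apply: contrapT => x0.
  have : hom_ker f w by apply: Mw; exists x.
  move=> /(congr1 val); rewrite Hf Hq => E.
  by apply: wt; rewrite E raddf0.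
have [r rf] := inj_split Minj fi; have [k Hk] := hom_comp f r.
pose x0 : shift (Ae e j) (- dt t) := inAe e j (e j).
have dx0 : ghom (shift (Ae e j) (- dt t)) (dt t) x0.
  by rewrite /= addNr df_idem; apply: df_hom.
pose z : A := val (k x0).
have kE x : val (k x) = (val x : A) ** z.
  by rewrite -[RHS]/(val (act (val x : A) (k x0))) -grhom_act -[act _ _]inAe_act Ae_val inAe_val.
(* The idempotent endomorphism f r of A e_j is right multiplication by z. *)
have bz : bih e 0 j j z.
  split; last exact: Ae_val.
    have := grhom_deg k dx0; rewrite /= addNr; exact.
  by rewrite /z -[LHS]/(val (act (e j) (k x0))) -grhom_act -[act _ _]inAe_act df_idem.
have zz : z ** z = z by rewrite -kE /z !Hk rf.
have z0 : z <> 0.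
  move=> z0; apply: w0; apply: fi; rewrite raddf0; apply: val_inj.
  by rewrite raddf0 -[w in f w]rf -Hk kE z0 amul0r.
have ze : z = e j by apply: idem_local.
have rk x : f (r x) = x.
  by rewrite -Hk; apply: val_inj; rewrite kE ze; apply: Ae_val.
have br : bijective r by exists f.
exists j; apply: codual_pairing (codual_unshift (codual_iso br cl)).
Qed.

End ProjectiveCoduals.

(** Every primitive idempotent occurs on either side of a nondegenerate
    pairing; this is a Nakayama form, with its permutation left implicit. *)
Definition nakayama (K : fieldType) (H : zmodType) (A : galgei K H)
    (I : choiceType) (e : dfamily A I) : Prop :=
  (forall i, exists j, paired e i j) /\ (forall j, exists i, paired e i j).

Section Sources.
Variables (K : fieldType) (H : zmodType).

Lemma nakayama_op (A : galgei K H) (I : choiceType) (e : dfamily A I) :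
  nakayama e -> @nakayama K H (gop A) I (df_op e).
Proof.
by case=> N1 N2; split=> i; [have [j] := N2 i | have [j] := N1 i] => pij; exists j; apply/paired_op.
Qed.

(** The dual of e_i A is injective, hence projective. *)
Lemma frobenius_paired (A : galgei K H) (I : choiceType) (e : dfamily A I) :
  weakly_basic e -> Frobenius_category A -> forall i, exists j, paired e i j.
Proof.
move=> wb [_ _ pi] i; have cl := dual_codual e i.
by apply: (projective_paired wb cl); apply/pi; apply: codual_inj cl.
Qed.

(** The dual of e_i A is injective with a simple essential socle, hence finitely
    cogenerated, hence projective. *)
Lemma pseudo_frobenius_paired (A : galgei K H) (I : choiceType) (e : dfamily A I) :
  weakly_basic e -> fgproj_eq_fcinj A -> forall i, exists j, paired e i j.
Proof.
move=> wb pi i; have cl := dual_codual e i.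
apply: (projective_paired wb cl).
suff /pi[] : gr_injective (dual_mod e i) /\ fincogen (dual_mod e i) by [].
split; first exact: codual_inj cl.
have [w [mw dw _]] := codual_monolith wb cl.
by have [] := monolith_simple_socle mw dw.
Qed.

(** Bass's argument: the sum over n of modules containing the quotients by
    N_n is injective, and the cyclic module A e_i, when mapped to a direct sum,
    lands in finitely many summands. *)
Lemma frobenius_acc (A : galgei K H) (I : choiceType) (e : dfamily A I) :
  Frobenius_category A -> forall i, acc (Ae e i).
Proof.
move=> [_ einj pi] i N Nincr.
pose x0 : Ae e i := inAe e i (e i).
have x0E (y : Ae e i) : act (val y : A) x0 = y by rewrite -inAe_act Ae_val inAe_val.
(* For each n, a homogeneous element of a free module whose annihilator in A e_i
   is N n. *)
have /choice[S HS] n : exists S : {T : choiceType & {it : T -> I & {dt : T -> H & free_mod e it dt}}},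
    ghom (free_mod e (projT1 (projT2 S)) (projT1 (projT2 (projT2 S)))) 0 (projT2 (projT2 (projT2 S))) /\
    forall y : Ae e i, N n y <-> act (val y : A) (projT2 (projT2 (projT2 S))) = 0.
  have [p Hp] := quot_map (N n); have [E [iota [Einj ii]]] := einj (quot_by (N n)).
  have [T [it [dt [s [q qs]]]]] := proj_free e ((pi E).2 Einj).
  exists (existT _ T (existT _ it (existT _ dt (s (iota (p x0)))))) => /=; split.
    apply: (grhom_deg s); apply: (grhom_deg iota); apply: (grhom_deg p).
    by rewrite /= df_idem; apply: df_hom.
  move=> y; have Ey : act (val y : A) (s (iota (p x0))) = s (iota (p y)).
    by rewrite -!grhom_act x0E.
  suff X : N n y <-> s (iota (p y)) = 0 by rewrite -Ey in X; exact: X.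
  split.
    move=> Ny; rewrite (_ : p y = 0) ?raddf0 //.
    by rewrite Hp -(gq_pi0 (N n)); apply/gq_eq; rewrite subr0.
  move=> s0; have := qs (iota (p y)); rewrite s0 raddf0 => i0.
  have : p y = 0 by apply: ii; rewrite raddf0.
  by rewrite Hp -(gq_pi0 (N n)) => /gq_eq; rewrite subr0.
pose Tn n := projT1 (S n); pose T : choiceType := {n : nat & Tn n}.
pose it (t : T) := projT1 (projT2 (S (tag t))) (tagged t).
pose dt (t : T) := projT1 (projT2 (projT2 (S (tag t)))) (tagged t).
pose u n := projT2 (projT2 (projT2 (S n))).
pose F := free_mod e it dt.
(* On the union of the chain, y |-> (y u_n)_n has finite support. *)
pose G (y : Ae e i) (x : F) := (exists n, N n y) /\
  forall t, val x t = (val y : A) ** val (u (tag t)) (tagged t).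
have Nle m n y : (m <= n)%N -> N m y -> N n y.
  by move=> /subnK <-; elim: (n - m)%N => // k IH /IH; rewrite addSn; apply: Nincr.
have gG : graph G.
  split.
  - by split=> [|t]; [exists 0%N; apply: gs_0 | rewrite !raddf0 amul0l].
  - move=> c x y x' y' [[n xn] xy] [[n' xn'] xy']; split.
      exists (maxn n n'); apply: gs_D.
        by apply: gs_Z; apply: Nle xn; apply: leq_maxl.
      by apply: Nle xn'; apply: leq_maxr.
    by move=> t; rewrite free_lin xy xy' linearP amulDl amulZl.
  - move=> a x y [[n xn] xy]; split; first by exists n; apply: gs_act.
    by move=> t /=; rewrite xy amulA.
  - move=> h x y [[n xn] xy]; split; first by exists n; apply: gs_gc.
    move=> t; rewrite free_gc xy val_gc.
    have [ut _] := HS (tag t); have {ut} := ut (tagged t); rewrite sub0r => ut.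
    by rewrite addrC (hc_mulr _ _ ut).
  - move=> x [_ x0']; apply: val_inj; apply: funext => t.
    by rewrite x0' !raddf0 amul0l.
have Finj : gr_injective F by apply/pi; apply: free_projective.
have [g Hg] := inj_extends Finj gG.
have [s us gs] := free_supp (g x0).
(* The extension to A e_i sends e_i to an element without coordinates in the
   summands of index m or more, so u_m is killed by the whole union. *)
pose m := (\max_(t <- s) tag t).+1.
have Gtot y n : N n y -> exists x, G y x.
  move=> Ny; have [s' us' s'0] : exists2 s' : seq T, uniq s' & forall t : T, t \notin s' ->
      (val y : A) ** val (u (tag t)) (tagged t) = 0.
    have R k : {r : seq (Tn k) | forall t, t \notin r -> val (u k) t = 0}.
      by apply: cid; have [r _ Hr] := free_supp (u k); exists r.
    pose r k := sval (R k); have Hr k : forall t, t \notin r k -> val (u k) t = 0 := svalP (R k).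
    exists (undup (flatten [seq [seq (Tagged Tn t : T) | t <- r k] | k <- iota 0 n])).
      exact: undup_uniq.
    case=> k t; rewrite mem_undup => /flattenP nt /=.
    have [kn|nk] := ltnP k n.
      rewrite Hr ?amul0r //; apply/negP => tr; apply: nt.
      exists [seq (Tagged Tn t : T) | t <- r k].
        by apply/mapP; exists k; rewrite ?mem_iota.
      by apply/mapP; exists t.
    have /(HS k).2 Nk := Nle _ _ _ nk Ny.
    have := congr1 (fun x : free_mod e (projT1 (projT2 (S k))) (projT1 (projT2 (projT2 (S k)))) => val x t) Nk.
    by rewrite raddf0.
  have Fx : free_fun e it (fun t : T => (val y : A) ** val (u (tag t)) (tagged t)).
    split; first by exists s'.
    by move=> t; rewrite -amulA; have [_ ->] := free_valP (u (tag t)).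
  by exists (free_in Fx : F); split; [exists n | ].
exists m => n mn y Ny; have [x yx] := Gtot y n Ny.
have Ex : x = act (val y : A) (g x0) by rewrite -grhom_act x0E (Hg _ _ yx).
apply/(HS m).2; apply: val_inj; rewrite raddf0; apply: funext => t.
rewrite -[LHS](yx.2 (Tagged Tn t : T)) Ex /= gs ?amul0r //.
apply/negP => ts; suff : (m < m)%N by rewrite ltnn.
by rewrite {1}/m ltnS; apply: (@leq_bigmax_seq _ s xpredT (fun t : T => tag t) (Tagged Tn t)).
Qed.

End Sources.

(** * Consequences of the chain condition *)

Section Noetherian.
Variables (K : fieldType) (H : zmodType) (A : galgei K H).
Implicit Types M E : grmod A.

Lemma acc_max M (P : grsub M -> Prop) (N0 : grsub M) : acc M -> P N0 ->
  exists N, P N /\ forall N', P N' -> (forall x, N x -> N' x) -> forall x, N' x -> N x.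
Proof.
move=> accM P0; apply: contrapT => nN.
have step (N : {N : grsub M | P N}) : exists N' : {N : grsub M | P N},
    (forall x, sval N x -> sval N' x) /\ exists x, sval N' x /\ ~ sval N x.
  apply: contrapT => nS; apply: nN; exists (sval N); split; first exact: svalP.
  move=> N' PN' NN' x N'x; apply: contrapT => nNx; apply: nS.
  by exists (exist _ N' PN'); split=> //; exists x.
have [f Hf] := choice step.
pose s := fix s n := if n is n'.+1 then f (s n') else exist P N0 P0.
have [|n Hn] := accM (fun n => sval (s n)).
  by move=> n x; have [sub _] := Hf (s n); apply: sub.
have [_ [x [x1 x0]]] := Hf (s n).
by apply: x0; apply: (Hn n.+1).
Qed.

Definition gs_zero M : grsub M.
Proof.
refine (@GrSub K H A M (fun x => x = 0) _ _ _ _ _) => //.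
- by move=> x y -> ->; rewrite addr0.
- by move=> c x ->; rewrite scaler0.
- by move=> a x ->; rewrite act0r.
- by move=> x ->; apply: sums0.
Defined.

Lemma acc_shift M k : acc M -> acc (shift M k).
Proof.
move=> accM N Nincr.
have toM n : {L : grsub M | forall x, L x <-> N n x}.
  unshelve eexists; first refine (@GrSub K H A M (fun x => N n x) _ _ _ _ _).
  - exact: (gs_0 (N n)).
  - by move=> x y; apply: (gs_D (g := N n)).
  - by move=> c x; apply: (gs_Z (g := N n)).
  - by move=> a x; apply: (gs_act (g := N n)).
  - move=> x Nx; apply: graded_gc => h.
    by have := gs_gc (L := N n) (h - k) Nx; rewrite gc_shift addrC subrK.
  - by [].
have [|n Hn] := accM (fun n => sval (toM n)).
  by move=> n x /(svalP (toM n)) /Nincr ?; apply/(svalP (toM n.+1)).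
by exists n => m nm x /(svalP (toM m)) Nx; apply/(svalP (toM n)); apply: Hn nm _ Nx.
Qed.

End Noetherian.

Section Baer.
Variables (K : fieldType) (H : zmodType) (A : galgei K H).
Variables (I : choiceType) (e : dfamily A I).
Implicit Types M E : grmod A.

(** Baer's criterion: a maximal partial extension is total as soon as partial
    morphisms out of the shifted A e_k extend. *)
Lemma baer E : (forall k h, extends_from (shift (Ae e k) h) E) ->
  forall N, extends_from N E.
Proof.
move=> Eext N G gG.
have [||G' [gG' GG' maxG]] := @zorn_above (N * E)
  (fun X => @graph _ _ _ N E (fun x y => X (x, y))) (fun p => G p.1 p.2).
- by [].
- move=> C [X0 CX0] gC totC; have [X00 _ _ _ _] := gC _ CX0; split.
  + by exists X0.
  + move=> c x y x' y' [X CX Xxy] [Y CY Yxy].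
    have [XY|YX] := totC _ _ CX CY.
      by exists Y => //; have [_ GD _ _ _] := gC _ CY; apply: GD => //; apply: XY.
    by exists X => //; have [_ GD _ _ _] := gC _ CX; apply: GD => //; apply: YX.
  + by move=> a x y [X CX Xxy]; exists X => //; have [_ _ Ga _ _] := gC _ CX; apply: Ga.
  + by move=> h x y [X CX Xxy]; exists X => //; have [_ _ _ Gc _] := gC _ CX; apply: Gc.
  + by move=> y [X CX Xy]; have [_ _ _ _ X0y] := gC _ CX; apply: X0y.
suff tG : forall x, exists y, G' (x, y).
  have [g Hg] := graph_total gG' tG; exists g => x y xy; apply: Hg.
  exact: (GG' (x, y)).
have [L HL] := graph_dom gG'.
suff LT : forall x, L x by move=> x; apply/HL.
move=> x1; apply: (bih_sub (e := e)) => k h; set x := act _ _.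
have hx : ghom N h x by apply: bih_hom.
have kx : act (e k) x = x by apply: e_idem.
have [G0 GD Ga Gc G00] := gG'.
pose G2 (a : shift (Ae e k) (- h)) (y : E) := G' (act (val a : A) x, y).
have gG2 : graph G2.
  split; rewrite /G2.
  - by rewrite raddf0 act0l.
  - by move=> c a y a' y' ay ay'; rewrite linearP actDl actZl; apply: GD.
  - by move=> b a y ay; rewrite /= -actA; apply: Ga.
  - move=> l a y ay; rewrite gc_shift val_gc addrC.
    by rewrite -[gc _ (val a)]/(hc (l - h) (val a : A)) -(gc_actr _ _ hx); apply: Gc.
  - by move=> y; rewrite raddf0 act0l; apply: G00.
have [g Hg] := Eext _ _ _ gG2.
pose u := g (inAe e k (e k)).
have hu : ghom E h u.
  by apply: (grhom_deg g); rewrite /= addNr df_idem; apply: df_hom.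
have gE a : g (inAe e k a) = act a u.
  rewrite -grhom_act; congr (g _); apply: val_inj.
  by rewrite /= df_idem.
(* The extension of G' by x |-> u. *)
pose G3 (p : N * E) := exists n v a, [/\ G' (n, v), p.1 = n + act a x & p.2 = v + act a u].
have G3G' : forall p, G3 p -> G' p.
  apply: maxG; last by move=> [n v] nv; exists n, v, 0; rewrite !act0l !addr0.
  split.
  - by exists 0, 0, 0; rewrite !act0l !addr0.
  - move=> c y v y' v' [n [w [a [nw /= -> ->]]]] [n' [w' [a' [nw' /= -> ->]]]].
    exists (c *: n + n'), (c *: w + w'), (c *: a + a'); split=> /=.
    + exact: GD.
    + by rewrite actDl actZl scalerDr addrACA.
    + by rewrite actDl actZl scalerDr addrACA.
  - move=> b y v [n [w [a [nw /= -> ->]]]]; exists (act b n), (act b w), (b ** a).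
    by rewrite /= !actDr !actA; split=> //; apply: Ga.
  - move=> l y v [n [w [a [nw /= -> ->]]]]; exists (gc l n), (gc l w), (hc (l - h) a).
    by rewrite /= !gcD (gc_actr _ _ hx) (gc_actr _ _ hu); split=> //; apply: Gc.
  - move=> y [n [w [a [nw /= n0 ->]]]].
    have En : act a x = - n by apply/eqP; rewrite -addr_eq0 addrC -n0.
    have : G2 (inAe e k a) (- w).
      rewrite /G2 /= -actA kx En -scaleN1r -[- w]scaleN1r -[_ *: n]addr0 -[_ *: w]addr0.
      exact: GD.
    by move=> /Hg; rewrite gE => ->; rewrite subrr.
apply/HL; exists u; apply: G3G'; exists 0, 0, (e k); split=> //=; first by rewrite kx add0r.
by rewrite add0r /u -gE.
Qed.

Lemma hom_sum M (N : grmod A) (T : Type) (f : T -> grhom M N) (s : seq T) :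
  exists g : grhom M N, forall x, g x = \sum_(t <- s) f t x.
Proof.
have gl c x y : \sum_(t <- s) f t (c *: x + y) =
    c *: (\sum_(t <- s) f t x) + \sum_(t <- s) f t y.
  by rewrite scaler_sumr -big_split; apply: eq_bigr => t _; rewrite linearP.
have ga a x : \sum_(t <- s) f t (act a x) = act a (\sum_(t <- s) f t x).
  by rewrite act_sumr; apply: eq_bigr => t _; rewrite grhom_act.
have gd h x : ghom M h x -> ghom N h (\sum_(t <- s) f t x).
  move=> hx; elim/big_ind: _ => [|y z|t _]; [exact: ghom0 | exact: ghomD |].
  exact: grhom_deg.
by exists (grhom_of gl ga gd).
Qed.

(** A partial morphism from a Noetherian module to a direct sum lands in
    finitely many summands, so it can be extended one summand at a time. *)
Lemma free_extends M (T : choiceType) (it : T -> I) (dt : T -> H) : acc M ->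
  (forall t, extends_from M (shift (Ae e (it t)) (- dt t))) ->
  extends_from M (free_mod e it dt).
Proof.
move=> accM Text G gG; have [G0 GD Ga Gc G00] := gG.
have [L HL] := graph_dom gG.
pose P (N : grsub M) := (forall x, N x -> L x) /\
  exists s : seq T, forall x y, N x -> G x y -> forall t, t \notin s -> val y t = 0.
have [|N [[NL [s Ns]] maxN]] := @acc_max _ _ _ M P (gs_zero M) accM.
  split; first by move=> x ->; apply/HL; exists 0.
  by exists [::] => x y -> /G00 ->.
(* N is maximal among the submodules of the domain whose image has finite
   support; adding a homogeneous element of the domain keeps this, so N is the
   whole domain. *)
have supp x y : G x y -> forall t, t \notin s -> val y t = 0.
  suff LN : forall x, L x -> N x by move=> xy; apply: (Ns x) => //; apply: LN; apply/HL; exists y.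
  move=> {y}x Lx; have [r ->] := gc_full x; apply: gs_sum => h _.
  have hx := gcP h x; have Lhx : L (gc h x) by apply: gs_gc.
  move: (gc h x) hx Lhx => {Lx}x hx Lx.
  apply: (maxN (gs_add N (cyc hx))); last 2 first.
  - by move=> z Nz; exists z => //; rewrite subrr; apply: gs_0.
  - by exists 0; [apply: gs_0 | rewrite subr0; apply: cyc_id].
  split.
    move=> z [n /NL Ln [a Ea]]; rewrite -[z](subrK n) Ea; apply: gs_D => //.
    exact: gs_act.
  have [y xy] := (HL x).1 Lx; have [r0 _ yr] := free_supp y.
  exists (s ++ r0) => z z' [n Nn [a Ea]] zz' t.
  rewrite mem_cat negb_or => /andP[ts /yr yt].
  have [v nv] := (HL n).1 (NL _ Nn).
  have : G z (1 *: v + act a y).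
    by rewrite -[z](subrK n) Ea addrC -[n]scale1r; apply: GD => //; apply: Ga.
  by move=> /(graph_fun gG zz') ->; rewrite free_lin (Ns n) //= yt amul0r scaler0 addr0.
pose Gt t (x : M) (v : shift (Ae e (it t)) (- dt t)) := exists y, G x y /\ val v = val y t.
have gGt t : graph (Gt t).
  split.
  - by exists 0; rewrite !raddf0.
  - move=> c x v x' v' [y [xy vy]] [y' [xy' vy']]; exists (c *: y + y').
    by rewrite free_lin linearP /= vy vy'; split=> //; apply: GD.
  - by move=> a x v [y [xy vy]]; exists (act a y); rewrite /= vy; split=> //; apply: Ga.
  - move=> h x v [y [xy vy]]; exists (gc h y); split; first exact: Gc.
    by rewrite gc_shift val_gc vy free_gc addrC.
  - by move=> v [y [/G00 -> v0]]; apply: val_inj; rewrite v0 !raddf0.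
have Hc t : exists g : grhom M (free_mod e it dt), forall x y, G x y ->
    g x = single e it t (val y t).
  have [g Hg] := Text t _ (gGt t); have [q Hq] := free_proj e it dt t.
  have [j Hj] := free_inj e it dt t; have [k Hk] := hom_comp j g.
  exists k => x y xy; rewrite Hk Hj -Hq; congr (single e it t (val _)).
  by apply: Hg; exists y; rewrite Hq.
have [g Hg] := choice Hc; have [k Hk] := hom_sum g (undup s).
exists k => x y xy; rewrite Hk [RHS](free_sum (undup_uniq s)).
  by apply: eq_bigr => t _; rewrite (Hg t x y).
by move=> t; rewrite mem_undup; apply: supp xy t.
Qed.

(** Each summand is injective as a codual; the chain condition, through Baer's
    criterion, lets a partial morphism see only finitely many summands. *)
Lemma free_injective (T : choiceType) (it : T -> I) (dt : T -> H) : weakly_basic e ->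
  (forall k, acc (Ae e k)) -> (forall j, exists i, paired e i j) ->
  gr_injective (free_mod e it dt).
Proof.
move=> wb accA pj; apply: extends_inj; apply: baer => k h.
apply: free_extends; first exact: acc_shift.
move=> t; have [i [d [f pf]]] := pj (it t).
exact: (codual_extends wb (codual_shift (- dt t) (pairing_codual pf))).
Qed.

End Baer.

Section Minimal.
Variables (K : fieldType) (H : zmodType).

Lemma pairing_op (A : galgei K H) (I : choiceType) (e : dfamily A I) i j d f :
  pairing e i j d f -> @pairing K H (gop A) I (df_op e) j i d f.
Proof. by case=> lf fd fr fl; split=> // a; rewrite {1}fd /= amulA. Qed.

Variables (A : galgei K H) (I : choiceType) (e : dfamily A I).
Hypothesis wb : weakly_basic e.
Variables (i j : I) (d : H) (f : A -> K).
Hypothesis pf : pairing e i j d f.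

Let perp_mul (b a : A) h : f (hc h b ** a) = f (b ** hc (d - h) a).
Proof.
have [lf fd _ _] := pf; rewrite fd [RHS]fd; congr (f (_ ** _ ** _)).
have := hc_mull a (d - h) (hcP h b); rewrite addrC subrK => ->.
by have := hc_mulr b h (hcP (d - h) a); rewrite subrK => ->.
Qed.

Definition perp (N : grsub (Ae e j)) : grsub (eA e i).
Proof.
refine (@GrSub K H (gop A) (eA e i) (fun b => forall a, N a -> f ((val b : A) ** val a) = 0) _ _ _ _ _).
- by move=> a _; rewrite raddf0 amul0l lfun0 //; case: pf.
- move=> x y Hx Hy a Na; rewrite raddfD amulDl lfunD ?Hx ?Hy ?addr0 //; by case: pf.
- move=> c x Hx a Na; rewrite linearZ amulZl lfunZ ?Hx ?mulr0 //; by case: pf.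
- move=> b x Hx a Na; have := Hx (act (b : A) a) (gs_act _ Na).
  have -> : val (act (b : A) a) = (b : A) ** (val a : A) by [].
  by rewrite amulA.
- move=> x Hx; apply: graded_gc => h a Na; rewrite val_gc.
  rewrite [gc h _](_ : _ = hc h (val x : A)) // perp_mul.
  have := Hx (gc (d - h) a); rewrite val_gc; apply; exact: gs_gc.
Defined.

(** Otherwise a functional on one finite dimensional e_k A_h e_j separates y
    from N; the pairing represents it by an element of e_i A, which then kills
    N but not y. *)
Lemma biperp (N : grsub (Ae e j)) (y : Ae e j) :
  (forall b, perp N b -> f ((val b : A) ** val y) = 0) -> N y.
Proof.
move=> Hy; apply: (bih_sub (e := e)) => k h; apply: contrapT => nN.
have [lf fd _ _] := pf.
pose S (a : A) := exists2 n, N n & a = val n.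
set y' := act _ _ in nN.
have [||t [lt tS t1]] := @separate K A S (val y').
- split; first by exists 0; rewrite ?raddf0 //; apply: gs_0.
  move=> c _ _ [n Nn ->] [n' Nn' ->]; exists (c *: n + n'); last by rewrite linearP.
  by apply: gs_D => //; apply: gs_Z.
- by move=> [n Nn /val_inj E]; apply: nN; rewrite E.
have cl := pairing_codual (pairing_op pf).
have [b [db kb bt]] := codual_repr (wb_op wb) k (d - h) cl lt.
have {}kb : (val b : A) ** e k = val b by rewrite -[in RHS]kb.
have {}db : ahom A (d - h) (val b : A) := db.
have fb (a : Ae e j) : f ((val b : A) ** val a) = t (val (act (e k) (gc h a))).
  pose v : A := e k ** hc h (val a : A).
  have bv : bih e h k j v.
    split; last by rewrite /v -amulA -(hc_mulr _ _ (df_hom e j)) add0r Ae_val.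
      by rewrite -[h]add0r; apply: ahom_mul; [apply: df_hom | apply: hcP].
    by rewrite /v amulA df_idem.
  have -> : val (act (e k) (gc h a)) = v by rewrite -[LHS]/(e k ** val (gc h a)) val_gc.
  rewrite -bt; last by rewrite opprB addrC subrK; case: bv => hv kv vj; split.
  change (f ((val b : A) ** val a) = f ((val b : A) ** v)).
  by rewrite /v amulA kb -[in LHS](hc_id db) perp_mul opprB addrC subrK.
have : f ((val b : A) ** val y) = 0.
  apply: Hy => a Na; rewrite fb tS //; exists (act (e k) (gc h a)) => //.
  by apply: gs_act; apply: gs_gc.
by rewrite fb t1 => /eqP; apply/negP; apply: oner_neq0.
Qed.

Hypothesis accA : acc (eA e i).

(** Annihilators turn the ascending chain condition on e_i A into a descending
    one on A e_j: among the submodules N of A e_j with N x nonzero, one with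
    maximal annihilator is minimal, and then N x is simple. *)
Lemma minimal_below (M : grmod A) h (x : M) : ghom M h x -> act (e j) x = x -> x <> 0 ->
  exists y k l, [/\ exists a, y = act a x, y <> 0, ghom M l y, act (e k) y = y
    & forall a, Jgr a -> act a y = 0].
Proof.
move=> hx jx x0.
pose Q (N : grsub (Ae e j)) := exists2 a, N a & act (val a : A) x <> 0.
pose P (L : grsub (eA e i)) := exists2 N, Q N & forall b, L b <-> perp N b.
have PT : P (perp (gs_top (Ae e j))).
  exists (gs_top (Ae e j)) => //; exists (inAe e j (e j)) => //=.
  by rewrite df_idem jx.
have [L [[N [a Na ax0] LN] maxL]] := acc_max accA PT.
have [k [l yne0]] := bih_neq0 e ax0.
set y := act (e k) _ in yne0.
pose a' := act (e k) (gc (l - h) a).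
have Ey : y = act (val a' : A) x.
  by rewrite /y (gc_actr _ _ hx) actA -[val a']/(e k ** val (gc (l - h) a)) val_gc.
have ly : ghom M l y by apply: bih_hom.
have ky : act (e k) y = y by apply: e_idem.
exists y, k, l; split=> //; first by exists (val a').
apply: (J_kills wb ly ky) => b m mby by0.
(* The elements of N that send x into A b y form a submodule that does not kill
   x; by maximality it has the same annihilator as N, so it is N. *)
have [N' N'E] : exists N' : grsub (Ae e j), forall n, N' n <->
    N n /\ exists c, act (val n : A) x = act c (act b y).
  unshelve eexists; first refine (@GrSub K H A (Ae e j)
    (fun n => N n /\ exists c, act (val n : A) x = act c (act b y)) _ _ _ _ _).
  - by split; [apply: gs_0 | exists 0; rewrite raddf0 !act0l].
  - move=> u v [Nu [c Ec]] [Nv [c' Ec']]; split; first exact: gs_D.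
    exists (c + c'); change (act ((val u : A) + val v) x = act (c + c') (act b y)).
    by rewrite actDl [act (val u : A) x]Ec [act (val v : A) x]Ec' actDl.
  - move=> s u [Nu [c Ec]]; split; first exact: gs_Z.
    exists (s *: c); change (act (s *: (val u : A)) x = act (s *: c) (act b y)).
    by rewrite actZl [act (val u : A) x]Ec actZl.
  - move=> s u [Nu [c Ec]]; split; first exact: gs_act.
    exists (s ** c); change (act (s ** (val u : A)) x = act (s ** c) (act b y)).
    by rewrite -!actA [act (val u : A) x]Ec.
  - move=> u [Nu [c Ec]]; apply: graded_gc => r; split; first exact: gs_gc.
    exists (hc (r + h - m) c); rewrite val_gc -(gc_actr _ _ mby) -Ec.
    by rewrite (gc_actr _ _ hx) addrK.
  - by [].
have Na' : N a' by apply: gs_act; apply: gs_gc.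
have /N'E[Na'2 [c Ec]] : N' a'.
  apply: biperp => b' Hb'.
  have /LN Lb' : L b'; last by apply: Lb'.
  apply: (maxL (perp N')) Hb'.
    exists N' => //; exists (act b a').
      apply/N'E; split; first exact: gs_act.
      by have [v Ev] := lunit (act b y); exists v; rewrite Ev Ey /= -actA.
    by rewrite /= -actA -Ey.
  by move=> z /LN Lz n /N'E[Nn _]; apply: Lz.
by exists c; rewrite -Ec -Ey.
Qed.

End Minimal.

(** * The Frobenius property *)

Section Socles.
Variables (K : fieldType) (H : zmodType) (A : galgei K H).
Variables (I : choiceType) (e : dfamily A I).
Hypothesis wb : weakly_basic e.
Implicit Types M : grmod A.

(** The bihomogeneous generators of the simple graded submodules: for a nonzero
    x in e_k M, the cyclic module A x is simple as soon as the radical kills x,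
    since the remaining bihomogeneous scalars are invertible. *)
Definition simple_gen M (x : M) : Prop :=
  [/\ x <> 0, exists k l, ghom M l x /\ act (e k) x = x & forall a, Jgr a -> act a x = 0].

(** Some bihomogeneous part of a x is the product of x by an element outside the
    radical, that is, by an invertible one. *)
Lemma simple_gen_return M (x : M) (N : grsub M) a : simple_gen x ->
  N (act a x) -> act a x <> 0 -> N x.
Proof.
move=> [x0 [k [l [lx kx]]] Jx] Nax /(bih_neq0 e)[m [h ne0]].
set a' := e m ** hc (h - l) a ** e k.
have Ea : act (e m) (gc h (act a x)) = act a' x.
  by rewrite (gc_actr _ _ lx) -!actA kx.
have nJ : ~ Jgr a' by move=> /Jx; rewrite -Ea.
have [_ [b [_ ba _]]] := not_Jgr_inv wb (bih_comp e (h - l) m k a) nJ.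
rewrite -kx -ba -actA -/a' -Ea; do 2!apply: gs_act; exact: gs_gc.
Qed.

Lemma simple_gen_simple M h (x : M) (hx : ghom M h x) : simple_gen x -> gsimple (submod_of (cyc hx)).
Proof.
move=> sx; apply/simpleP; split.
  by exists x; [apply: cyc_id | case: sx].
move=> N Nx [z Nz z0]; have [a Ea] := Nx z Nz; rewrite Ea in Nz z0.
by apply: gs_le_cyc; apply: simple_gen_return sx Nz z0.
Qed.

Lemma simple_gen_socle M (x : M) : simple_gen x -> socle M x.
Proof.
move=> /[dup] sx [_ [k [l [lx _]]] _].
exact: (simple_socle (simple_gen_simple lx sx) (cyc_id lx)).
Qed.

(** Independence of the submodules A x, as opposed to that of the elements x. *)
Definition independent M (B : set M) : Prop :=
  forall s : seq M, uniq s -> (forall x, x \in s -> B x) ->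
  forall a : M -> A, \sum_(x <- s) act (a x) x = 0 -> forall x, x \in s -> act (a x) x = 0.

(** If a simple generator y outside a maximal B were not in the span, a relation
    involving y nontrivially would express a nonzero a y in the span of B, and
    y could be recovered from it. *)
Lemma max_independent M : exists B : set M,
  [/\ forall x, B x -> simple_gen x, independent B
    & forall y, simple_gen y -> hspan B y].
Proof.
have [||B [[BU Bi] _ maxB]] := @zorn_above M
  (fun B => (forall x, B x -> simple_gen x) /\ independent B) set0.
- split; first by move=> x [].
  by move=> [|x s] _ sB a _ y //; have := sB x (mem_head _ _).
- move=> C [X0 CX0] CP totC; split; first by move=> x [X /CP[XU _] Xx]; apply: XU.
  have fin (s : seq M) : (forall x, x \in s -> exists2 X, C X & X x) ->
      exists2 X, C X & forall x, x \in s -> X x.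
    elim: s => [|x s IH] sC; first by exists X0.
    have [|X CX Xs] := IH; first by move=> z zs; apply: sC; rewrite inE zs orbT.
    have [Y CY Yx] := sC x (mem_head _ _).
    have [XY|YX] := totC _ _ CX CY.
      by exists Y => // z; rewrite inE => /orP[/eqP ->|/Xs /XY].
    by exists X => // z; rewrite inE => /orP[/eqP ->|/Xs]; [apply: YX|].
  move=> s us /fin[X CX Xs]; have [_ Xi] := CP _ CX; exact: Xi.
exists B; split=> // y Uy.
have hB x : B x -> hspan B x.
  by move=> Bx; have [_ [k [l [lx _]]] _] := BU _ Bx; apply: hspan_mem lx.
apply: contrapT => ny; have nBy : ~ B y by move/hB.
suff : B y by [].
apply: (maxB (fun z => B z \/ z = y)); [|by left|by right].
split; first by move=> z [/BU|->].
move=> s us sB a E x xs.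
have yz : act (a y) y <> 0 -> y \in s -> False.
  move=> ay ys; apply: ny; apply: simple_gen_return Uy _ ay.
  move: E; rewrite (bigD1_seq y) //= => /eqP; rewrite addr_eq0 => /eqP ->.
  apply: (gs_N (N := hspan B)); rewrite big_seq_cond; apply: big_ind; [exact: gs_0 | exact: gs_D |].
  move=> z /andP[zs zy]; apply: gs_act; apply: hB.
  by case: (sB z zs) => // Ezy; rewrite Ezy eqxx in zy.
have [Exy|xy] := eqVneq x y.
  by subst x; apply: contrapT => ay; apply: yz.
pose s' := [seq z <- s | z != y].
apply: (Bi s'); rewrite ?filter_uniq ?mem_filter ?xy //.
  move=> z; rewrite mem_filter => /andP[zy /sB[//|Ezy]].
  by rewrite Ezy eqxx in zy.
rewrite big_filter; move: E.
rewrite (bigID (fun z => z != y)) /= [X in _ + X]big1_seq ?addr0 //.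
move=> z /andP[/negPn/eqP -> ys]; apply: contrapT => ay; exact: yz ay ys.
Qed.

Hypothesis accA : forall k, acc (Ae e k).
Hypothesis accB : forall i, acc (eA e i).
Hypothesis nak : nakayama e.

Lemma exists_simple_gen M (L : grsub M) : (exists2 x, L x & x <> 0) ->
  exists2 y, L y & simple_gen y.
Proof.
move=> [x Lx /(bih_neq0 e)[j [h x0]]].
have [_ /(_ j)[i [d [f pf]]]] := nak.
have [y [k [l [[a Ea] y0 ly ky Jy]]]] :=
  minimal_below wb pf (@accB i) (bih_hom e j h x) (e_idem _ _ _) x0.
exists y; first by rewrite Ea; do 2!apply: gs_act; apply: gs_gc.
by split => //; exists k, l.
Qed.

Lemma socle_essential M : essential (socle M).
Proof.
move=> L /exists_simple_gen[y Ly sy]; exists y.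
by split=> //; [apply: simple_gen_socle | case: sy].
Qed.

(** Every module embeds in a direct sum of shifted A e_j: the socle is a direct
    sum of simple modules, each embedded in some A e_j as its socle, and the
    embedding extends because the target is injective. *)
Lemma embed_free M : exists (T : choiceType) (jt : T -> I) (ct : T -> H) (b : T -> M)
  (iota : grhom M (free_mod e jt ct)),
  [/\ injective iota, forall t, val (iota (b t)) t <> 0, forall t, socle M (b t)
    & forall x, socle M x -> sums (fun y => exists a t, y = act a (b t)) x].
Proof.
have [B [BU Bi Bspan]] := max_independent M.
pose T : choiceType := {x : M | `[< B x >]}.
have BT (t : T) : B (val t) by apply/asboolP; apply: valP t.
have /choice[pk Hpk] (t : T) : exists p : I * H, ghom M p.2 (val t) /\ act (e p.1) (val t) = val t.
  by have [_ [k [l hx]] _] := BU _ (BT t); exists (k, l).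
have /choice[pj Hpj] (k : I) : exists p : I * H * A,
    [/\ bih e p.1.2 k p.1.1 p.2, p.2 <> 0 & forall a, Jgr a -> a ** p.2 = 0].
  have [/(_ k)[j [d [f pf]]] _] := nak.
  have [w [mw dw kw]] := codual_monolith wb (pairing_codual pf).
  exists (j, d, val w); split=> /=.
  - split; [exact: dw | exact: (congr1 val kw) | exact: Ae_val].
  - by move=> w0; have [w0' _] := mw; apply: w0'; apply: val_inj; rewrite raddf0; exact: w0.
  - by move=> a Ja; rewrite -[LHS]/(val (act a w)) (J_monolith wb mw dw kw Ja) raddf0.
pose it t := (pk t).1; pose dt t := (pk t).2.
pose jt t := (pj (it t)).1.1; pose ct t := dt t - (pj (it t)).1.2.
pose wt t := (pj (it t)).2.
have Hw t : [/\ bih e (dt t - ct t) (it t) (jt t) (wt t), wt t <> 0 & forall a, Jgr a -> a ** wt t = 0].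
  by rewrite /ct opprB addrC subrK; exact: Hpj (it t).
have ht t : ghom M (dt t) (val t) by case: (Hpk t).
have iht t : act (e (it t)) (val t) = val t by case: (Hpk t).
pose F := free_mod e jt ct.
pose y t : F := single e jt t (wt t).
have iy t : act (e (it t)) (y t) = y t.
  by rewrite /y -single_act; have [[_ -> _] _ _] := Hw t.
have hy t : ghom F (dt t) (y t).
  rewrite -[dt t](subrK (ct t)); apply: single_hom.
  by have [[hw _ _] _ _] := Hw t.
(* The simple module A t, for t in B, is isomorphic to the socle A w_t of a shifted
   A e_(jt t): a t and a w_t vanish for the same a, those with a e_(it t) in the
   radical. Hence q and v have the same kernel. *)
have [q Hq] := free_map iht ht; have [v Hv] := free_map iy hy.
have qs := free_map_single iht ht Hq; have vs := free_map_single iy hy Hv.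
have wJ t a : a ** wt t = 0 <-> Jgr (a ** e (it t)).
  have [[hw iw jw] w0 Jw] := Hw t.
  exact: (@annJ K H A I e wb (regmod A) (it t) _ (wt t) hw iw w0 Jw a).
have bJ t a : act a (val t) = 0 <-> Jgr (a ** e (it t)).
  by have [x0 _ Jx] := BU _ (BT t); apply: annJ (ht t) (iht t) x0 Jx a.
have qv x : q x = 0 -> v x = 0.
  have [s us xs] := free_supp x; rewrite (Hq x s us xs) (Hv x s us xs) => q0.
  rewrite big1_seq // => t /andP[_ ts].
  rewrite /y -single_act (_ : val x t ** wt t = 0) ?single0 //; apply/wJ/bJ.
  pose a (z : M) : A := if insub z is Some t' then val x t' else 0.
  have aE (t' : T) : a (val t') = val x t' by rewrite /a valK.
  rewrite -aE; apply: (Bi [seq val t' | t' <- s]).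
  - by rewrite map_inj_uniq //; apply: val_inj.
  - by move=> z /mapP[t' _ ->].
  - by rewrite big_map -[RHS]q0; apply: eq_bigr => t' _; rewrite aE.
  - exact: map_f.
have vq x : v x = 0 -> q x = 0.
  have [s us xs] := free_supp x; rewrite (Hq x s us xs) (Hv x s us xs) => v0.
  rewrite big1_seq // => t /andP[_ ts]; apply/bJ/wJ.
  have := congr1 (fun z : F => val z t) v0.
  rewrite raddf_sum raddf0 /= fct_sumE /= (bigD1_seq t) //= eqxx big1 ?addr0.
    by have [[_ _ wj] _ _] := Hw t; rewrite wj.
  by move=> t' t't; rewrite eq_sym (negPf t't) amul0r.
have Finj : gr_injective F by apply: free_injective => //; case: nak.
have [g gq] := inj_factor Finj qv.
have qspan x : hspan B x -> exists z, q z = x.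
  elim/sums_ind => [|_ x' [a [z [Bz _ ->]]] [z' <-]]; first by exists 0; rewrite raddf0.
  have Tz : `[< B z >] by apply/asboolP.
  by exists (single e it (exist _ z Tz : T) a + z'); rewrite raddfD /= qs.
exists T, jt, ct, (fun t => val t), g; split.
- apply: ker_inj => m gm; apply: contrapT => m0.
  have [|z gz sz] := @exists_simple_gen M (hom_ker g); first by exists m.
  have [z' Ez] := qspan z (Bspan z sz).
  have [z0 _ _] := sz; apply: z0; rewrite -Ez; apply: vq.
  by rewrite -gq Ez.
- move=> t; have <- : q (single e it t (e (it t))) = val t by rewrite qs.
  rewrite gq vs iy /= eqxx; have [[_ _ wj] w0 _] := Hw t.
  by rewrite wj.
- by move=> t; apply: simple_gen_socle; apply: BU.
- move=> x sx; suff hx : hspan B x.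
    elim/sums_ind: hx => [|z x' [a [z' [Bz _ ->]]] IH]; first exact: sums0.
    have Tz : `[< B z' >] by apply/asboolP.
    by apply: sumsD IH; apply: sums1; exists a, (exist _ z' Tz : T).
  elim/sums_ind: sx => [|z x' [S /simpleP[nS sS] Sz] IH]; first exact: sums0.
  apply: (gs_D (g := hspan B)) => //.
  have [s Ss sg] := exists_simple_gen nS.
  have [] := sS (gs_cap S (hspan B)) _ _ z Sz => //; first by move=> u [].
  by exists s; [split=> //; apply: Bspan | case: sg].
Qed.

Lemma frobenius_of_nakayama : Frobenius_category A.
Proof.
have Finj T jt ct : gr_injective (@free_mod K H A I e T jt ct).
  by apply: free_injective => //; case: nak.
split.
- move=> M; have [T [it [dt [p pp]]]] := free_cover e M.
  by exists (free_mod e it dt), p; split=> //; apply: free_projective.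
- move=> M; have [T [jt [ct [b [iota [ii _ _ _]]]]]] := embed_free M.
  by exists (free_mod e jt ct), iota.
- move=> M; split=> [Mp|Mi].
    have [T [it [dt [s [p ps]]]]] := proj_free e Mp.
    exact: inj_retract ps (Finj _ _ _).
  have [T [jt [ct [b [iota [ii _ _ _]]]]]] := embed_free M.
  have [r ri] := inj_split Mi ii.
  by apply: proj_retract ri _; apply: free_projective.
Qed.

(** The embedding in a direct sum sends a finitely generated M to finitely many
    summands, and each simple summand of the socle has its own index among them. *)
Lemma fingen_socle M : fingen M -> fingen (submod_of (socle M)).
Proof.
move=> /fingenP[s Hs]; have [T [jt [ct [b [iota [_ ib sb bs]]]]]] := embed_free M.
have [r Hr] := free_supp_seq s iota.
have all_r t : t \in r.
  apply/negPn/negP => tr; apply: (ib t).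
  elim/sums_ind: (Hs (b t)) => [|_ x [a [z [zs ->]]] IH]; first by rewrite !raddf0.
  rewrite raddfD /= grhom_act -[LHS]/(a ** val (iota z) t + val (iota x) t).
  by rewrite (Hr z zs t tr) amul0r IH addr0.
apply/fingenP; exists [seq gs_in (sb t) | t <- r] => x.
apply: (@gs_type_sums _ _ _ _ (socle M) (fun y => exists a t, y = act a (b t))).
  move=> z [a [t Ez]]; exists a, (gs_in (sb t)); split; first exact: map_f.
  exact: val_inj.
have := bs (val x) (gs_valP x); elim/sums_ind => [|_ z [a [t ->]] IH]; first exact: sums0.
apply: sumsD IH; apply: sums1; split; last by exists a, t.
by apply: gs_act; apply: sb.
Qed.

(** Project the embedding in a direct sum to the finitely many summands met by
    the socle: the projection stays injective because the socle is essential,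
    and M splits off this finite sum. *)
Lemma fincogen_fingen M : gr_injective M -> fincogen M -> fingen M.
Proof.
move=> Mi [/fingenP[s Hs] ess].
have [T [jt [ct [b [iota [ii _ _ _]]]]]] := embed_free M.
pose F := free_mod e jt ct.
have [r Hr] := free_supp_seq s (fun z => iota (val z)).
pose y t : F := if t \in r then single e jt t (e (jt t)) else 0.
have iy t : act (e (jt t)) (y t) = y t.
  by rewrite /y; case: ifP => _; rewrite ?act0r // single_e.
have hy t : ghom F (ct t) (y t).
  by rewrite /y; case: ifP => _; [apply: free_gen_hom | apply: ghom0].
have [p Hp] := free_map iy hy; have [k Hk] := hom_comp p iota.
have pE (x : F) : (forall t, t \notin r -> val x t = 0) -> p x = x.
  move=> xr; rewrite (Hp x _ (undup_uniq r)); last by move=> t; rewrite mem_undup; apply: xr.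
  rewrite [RHS](free_sum (undup_uniq r)); last by move=> t; rewrite mem_undup; apply: xr.
  apply: eq_big_seq => t; rewrite mem_undup => tr.
  by rewrite /y tr [in RHS](single_gen e jt ct).
(* The kernel of k meets the socle trivially, as p fixes the image of the socle. *)
have ki : injective k.
  apply: ker_inj => x kx; apply: contrapT => x0.
  have [|z [kz sz z0]] := ess (hom_ker k); first by exists x.
  have supp t : t \notin r -> val (iota z) t = 0.
    move=> tr; rewrite -[z]/(val (gs_in sz)).
    elim/sums_ind: (Hs (gs_in sz)) => [|_ u [a [c [cs ->]]] IH]; first by rewrite !raddf0.
    rewrite raddfD raddfD /=.
    rewrite [iota _](_ : _ = act a (iota (val c))); last by rewrite -grhom_act.
    rewrite -[LHS]/(a ** val (iota (val c)) t + val (iota (val u)) t).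
    by rewrite (Hr c cs t tr) amul0r IH addr0.
  apply: z0; apply: ii; rewrite raddf0 -(pE _ supp) -Hk; exact: kz.
have [g gk] := inj_split Mi ki.
apply/fingenP; exists [seq g (single e jt t (e (jt t))) | t <- r] => x.
rewrite -[x]gk Hk; have [s' us' xs] := free_supp (iota x).
rewrite (Hp _ _ us' xs) raddf_sum /=; elim/big_ind: _ => [|u v|t _].
- exact: sums0.
- exact: sumsD.
rewrite grhom_act /y; case: ifP => tr; last by rewrite raddf0 act0r; apply: sums0.
by apply: sums1; exists (val (iota x) t), (g (single e jt t (e (jt t)))); split=> //; apply: map_f.
Qed.

Lemma pseudo_frobenius_of_nakayama : fgproj_eq_fcinj A.
Proof.
have [_ _ pi] := frobenius_of_nakayama.
move=> M; split=> [[/pi Mi Mf]|[Mi Mc]].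
  by split=> //; split; [apply: fingen_socle | apply: socle_essential].
by split; [apply/pi | apply: fincogen_fingen].
Qed.

End Socles.

(** * Simple essential socles *)

Section Condition1.
Variables (K : fieldType) (H : zmodType) (A : galgei K H).
Variables (I : choiceType) (e : dfamily A I).
Hypothesis wb : weakly_basic e.

Variable J : gideal A.
Hypothesis JE : forall a, J a <-> Jgr a.

Lemma paired_socle i j : paired e i j -> simple_essential_socle (Ae e j) /\
  exists h, griso (submod_of (socle (Ae e j))) (shift (Ae_top e J i) h).
Proof.
move=> [d [f pf]]; have [w [mw dw iw]] := codual_monolith wb (pairing_codual pf).
split; first by have [] := monolith_simple_socle mw dw.
by exists (- d); apply: monolith_top mw dw iw.
Qed.

(** Two pairings with the same j give two generators w, w' of the socle of A e_j,
    so w' = b w with b in e_i' A e_i outside the radical. *)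
Lemma paired_inj i i' j : paired e i j -> paired e i' j -> i = i'.
Proof.
move=> [d [f pf]] [d' [f' pf']].
have [w [mw dw iw]] := codual_monolith wb (pairing_codual pf).
have [w' [mw' dw' iw']] := codual_monolith wb (pairing_codual pf').
have [w0 _] := mw; have [w'0 _] := mw'.
have [a Ea] := monolith_act mw' dw w0.
pose b := e i' ** hc (d' - d) a ** e i.
have Eb : w' = act b w.
  by rewrite /b -!actA iw -(gc_actr _ _ dw) -Ea (gc_id dw') iw'.
have nJ : ~ Jgr b by move=> /(J_monolith wb mw dw iw); rewrite -Eb.
by have [] := not_Jgr_inv wb (bih_comp e (d' - d) i' i a) nJ.
Qed.

(** w generates the left socle of A e_j, and that socle is the top of A e_i up to
    a shift. *)
Definition left_gen i j d (w : A) : Prop :=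
  [/\ bih e d i j w, w <> 0,
      forall l x, ahom A l x -> x ** e j = x -> x <> 0 -> exists b, w = b ** x
    & forall a, Jgr a -> a ** w = 0].

Lemma socle_left_gen i j h : simple_essential_socle (Ae e j) ->
  griso (submod_of (socle (Ae e j))) (shift (Ae_top e J i) h) ->
  exists d w, left_gen i j d w.
Proof.
move=> ss /(top_gen wb JE)[w [d [sw w0 dw iw Jw]]].
have mw := simple_socle_monolith ss sw w0.
exists d, (val w); split.
- split; [exact: dw | exact: (congr1 val iw) | exact: Ae_val].
- by move=> w0'; apply: w0; apply: val_inj; rewrite raddf0.
- move=> l x lx xj x0.
  have lx' : ghom (Ae e j) l (inAe e j x) by rewrite /= xj.
  have [|b Eb] := monolith_act mw lx'.
    by move=> x0'; apply: x0; rewrite -xj -[LHS]/(val (inAe e j x)) x0' raddf0.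
  by exists b; rewrite Eb /= xj.
- by move=> a /JE /Jw E; rewrite -[LHS]/(val (act a w)) E raddf0.
Qed.

Definition right_gen i j d (w : A) : Prop :=
  [/\ bih e d i j w, w <> 0,
      forall l x, ahom A l x -> e i ** x = x -> x <> 0 -> exists b, w = x ** b
    & forall a, Jgr a -> w ** a = 0].

(** A functional that does not vanish on a common generator of the two socles
    gives the pairing. *)
Lemma paired_of_gen i j d w : left_gen i j d w -> right_gen i j d w -> paired e i j.
Proof.
move=> [bw w0 Lw _] [_ _ Rw _]; have [dw iw wj] := bw.
have [||t [lt _ t1]] := @separate K A (fun x => x = 0) w.
- by split=> // c u v -> ->; rewrite scaler0 addr0.
- exact: w0.
exists d, (fun a => t (e i ** hc d a ** e j)); split.
- by move=> c u v; rewrite hcM amulDr amulZr amulDl amulZl lt.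
- by move=> a; case: (bih_comp e d i j a) => ha ia aj; rewrite (hc_id ha) ia aj.
- move=> y yj Hy; apply: contrapT => y0.
  have [l yl0] := hc_neq0 y0.
  have ylj : hc l y ** e j = hc l y by rewrite -(hc_mulr _ _ (df_hom e j)) add0r yj.
  have [b Eb] := Lw l _ (hcP l y) ylj yl0.
  have := Hy (hc (d - l) b); suff -> : hc d (hc (d - l) b ** y) = w.
    by rewrite iw wj t1 => /eqP; apply/negP; apply: oner_neq0.
  have := hc_mull y l (hcP (d - l) b); rewrite subrK => ->.
  have := hc_mulr b (d - l) (hcP l y); rewrite addrC subrK => <-.
  by rewrite -Eb hc_id.
- move=> x ix Hx; apply: contrapT => x0.
  have [l xl0] := hc_neq0 x0.
  have ixl : e i ** hc l x = hc l x by rewrite -(hc_mull _ _ (df_hom e i)) add0r ix.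
  have [b Eb] := Rw l _ (hcP l x) ixl xl0.
  have := Hx (hc (d - l) b); suff -> : hc d (x ** hc (d - l) b) = w.
    by rewrite iw wj t1 => /eqP; apply/negP; apply: oner_neq0.
  have := hc_mulr x l (hcP (d - l) b); rewrite subrK => ->.
  have := hc_mull b (d - l) (hcP l x); rewrite addrC subrK => <-.
  by rewrite -Eb hc_id.
Qed.

(** If w generates the right socle of e_i A and w' the left socle of A e_(nu i),
    then w' = a w, and comparing a w with the generator of the right socle of
    e_(nu' (nu i)) A shows that w and w' differ by an invertible factor. *)
Lemma gens_paired (nu nu' : I -> I) : injective nu ->
  (forall i, exists d w, right_gen i (nu i) d w) ->
  (forall j, exists d w, left_gen (nu' j) j d w) ->
  forall i, paired e i (nu i).
Proof.
move=> nui R L i; set j := nu i.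
have [d [w [bw w0 Rw wJ]]] := R i; have [d' [w' [bw' w'0 Lw' Jw']]] := L j.
have [dw iw wj] := bw; have [dw' kw' w'j] := bw'.
set k := nu' j in bw' kw'.
(* w' generates the least submodule of A e_j, so it lies in A w. *)
have [a0 Ea0] := Lw' _ _ dw wj w0.
pose a := e k ** hc (d' - d) a0 ** e i.
have Ea : w' = a ** w.
  have := hc_mulr a0 (d' - d) dw; rewrite addrC subrK -Ea0 (hc_id dw') => E.
  by rewrite /a -[_ ** e i ** w]amulA iw -amulA -E kw'.
(* v generates the least submodule of e_k A, so it lies in w' A; the factor c is
   outside the radical because w kills the radical. Hence nu k = j = nu i, so
   k = i, and v is the common generator. *)
have [dk [v [bv v0 Rv vJ]]] := R k; have [hv kv vl] := bv.
have [c0 Ec0] := Rv _ _ dw' kw' w'0.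
pose c := e j ** hc (dk - d') c0 ** e (nu k).
have Ec : v = w' ** c.
  have := hc_mull c0 (dk - d') dw'; rewrite addrC subrK -Ec0 (hc_id hv) => E.
  by rewrite /c !amulA w'j -E vl.
have nJ : ~ Jgr c by move=> /wJ wc; apply: v0; rewrite Ec Ea -amulA wc amul0r.
have [jk [c' [[hc' jc' c'j] c'c cc']]] := not_Jgr_inv wb (bih_comp e (dk - d') j (nu k) c0) nJ.
have Eki : i = k by apply: nui.
have {}bv : bih e dk i j v by split => //; rewrite ?Eki // jk.
apply: (@paired_of_gen i j dk v).
  split=> //; last by move=> b Jb; rewrite Ec amulA Jw' ?amul0l.
  move=> l x lx xj x0.
  have [||b Eb] := Lw' _ (x ** c') (ahom_mul lx hc').
  - by rewrite -amulA jk c'j.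
  - by move=> xc; apply: x0; rewrite -xj jk -c'c amulA xc amul0l.
  by exists b; rewrite Ec Eb -!amulA c'c -jk xj.
by rewrite Eki; split=> //; rewrite -Eki.
Qed.

End Condition1.

Section Opposites.
Variables (K : fieldType) (H : zmodType).

Lemma right_gen_op (A : galgei K H) (I : choiceType) (e : dfamily A I) i j d (w : A) :
  weakly_basic e -> @left_gen K H (gop A) I (df_op e) j i d w -> right_gen e i j d w.
Proof.
move=> wb [[dw jw wi] w0 Lw Jw]; split.
- by split.
- exact: w0.
- by move=> l x lx ix x0; apply: (Lw l x).
- by move=> a Ja; apply: (Jw a); apply/(Jgr_op wb).
Qed.

(** The opposite of the opposite algebra is not convertible to the algebra, so
    the chain condition is carried over by hand. *)
Lemma acc_opop (A : galgei K H) (I : choiceType) (e : dfamily A I) i :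
  acc (Ae e i) -> acc (@eA K H (gop A) I (df_op e) i).
Proof.
move=> accA N Nincr; pose B := @eA K H (gop A) I (df_op e) i.
pose p (x : Ae e i) : B := inAe (A := gop (gop A)) (df_op (df_op e)) i (val x).
have pP c x y : p (c *: x + y) = c *: p x + p y by rewrite /p linearP -[RHS]inAeP.
have p0 : p 0 = 0 by have := pP (-1) 0 0; rewrite scaler0 addr0 scaleN1r addNr.
have pa a x : p (act a x) = act (a : gop (gop A)) (p x).
  by rewrite /p -[RHS]inAe_act.
have pc h x : gc h (p x) = p (gc h x).
  by rewrite /p [LHS]inAe_gc val_gc.
have toA n : {L : grsub (Ae e i) | forall x, L x <-> N n (p x)}.
  unshelve eexists; first refine (@GrSub K H A (Ae e i) (fun x => N n (p x)) _ _ _ _ _).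
  - by rewrite p0; apply: gs_0.
  - by move=> x y Nx Ny; rewrite -[x]scale1r pP scale1r; apply: gs_D.
  - by move=> c x Nx; rewrite -[_ *: x]addr0 pP p0 addr0; apply: gs_Z.
  - by move=> a x Nx; rewrite pa; apply: gs_act.
  - by move=> x Nx; apply: graded_gc => h; rewrite -pc; apply: gs_gc.
  - by [].
have [|n Hn] := accA (fun n => sval (toA n)).
  by move=> n x /(svalP (toA n)) /Nincr ?; apply/(svalP (toA n.+1)).
exists n => m nm y Ny.
have Ey : y = p (inAe e i (val y)).
  rewrite -[LHS]inAe_val /p; congr inAe; rewrite /=.
  by apply/esym; apply: (@Ae_val K H (gop (gop A)) I (df_op (df_op e)) i y).
by rewrite Ey; apply/(svalP (toA n)); apply: (Hn m nm); apply/(svalP (toA m)); rewrite -Ey.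
Qed.

End Opposites.

Theorem corollary3p3 (K : fieldType) (H : zmodType) (A : galgei K H)
    (I : choiceType) (e : dfamily A I) (hA : weakly_basic e) :
  ((locally_Noetherian e /\
    (forall i : I, simple_essential_socle (Ae e i) /\
                   simple_essential_socle (eA e i)) /\
    (exists nu nu' : I -> I, bijective nu /\ bijective nu' /\
      forall i : I,
        (exists h : H, griso (submod_of (socle (eA e i)))
                             (shift (eA_top e (Jideal A) (nu i)) h)) /\
        (exists h' : H, griso (submod_of (socle (Ae e i)))
                              (shift (Ae_top e (Jideal A) (nu' i)) h'))))
   <-> (locally_Noetherian e /\ graded_pseudo_Frobenius A))
  /\
  ((locally_Noetherian e /\ graded_pseudo_Frobenius A)
   <-> graded_quasi_Frobenius A).
Proof.
have hop := wb_op hA.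
have Jl a : Jideal A a <-> Jgr a by [].
have Jr a : gi_op (Jideal A) a <-> @Jgr K H (gop A) a by rewrite (Jgr_op hA).
have nak_of : (forall i, exists j, paired e i j) ->
    (forall j, exists i, @paired K H (gop A) I (df_op e) j i) -> nakayama e.
  by move=> N1 N2; split=> // j; have [i /paired_op pij] := N2 j; exists i.
have of_nak : locally_Noetherian e -> nakayama e ->
    (Frobenius_category A /\ fgproj_eq_fcinj A) /\
    (Frobenius_category (gop A) /\ fgproj_eq_fcinj (gop A)).
  move=> LN nak; have accl i : acc (Ae e i) by case: (LN i).
  have accr i : acc (eA e i) by case: (LN i).
  have nakop := nakayama_op nak.
  have acco i : acc (@eA K H (gop A) I (df_op e) i) by apply: acc_opop.
  split; split.
  - exact: (frobenius_of_nakayama hA).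
  - exact: (pseudo_frobenius_of_nakayama hA).
  - exact: (frobenius_of_nakayama hop).
  - exact: (pseudo_frobenius_of_nakayama hop).
have nak_pF : graded_pseudo_Frobenius A -> nakayama e.
  by move=> [pl pr]; apply: nak_of; [apply: pseudo_frobenius_paired | apply: (pseudo_frobenius_paired hop)].
split; split.
- move=> [LN [soc [nu [nu' [bnu [bnu' top]]]]]].
  have R i : exists d w, right_gen e i (nu i) d w.
    have [[h th] _] := top i; have [_ ss] := soc i.
    have [d [w gw]] := socle_left_gen hop Jr ss th.
    by exists d, w; apply: right_gen_op.
  have L j : exists d w, left_gen e (nu' j) j d w.
    have [_ [h th]] := top j; have [ss _] := soc j.
    exact: (socle_left_gen hA Jl ss th).
  have P := gens_paired hA (bij_inj bnu) R L.
  have nak : nakayama e.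
    split=> [i|j]; first by exists (nu i).
    by have [g _ gK] := bnu; exists (g j); rewrite -{2}[j]gK.
  by have [[_ pl] [_ pr]] := of_nak LN nak.
- move=> [LN /nak_pF nak]; split=> //; have [N1 N2] := nak.
  have [nu Hnu] := choice N1; have [nu' Hnu'] := choice N2.
  have Hop i : @paired K H (gop A) I (df_op e) (nu i) i by apply/paired_op.
  have Hop' j : @paired K H (gop A) I (df_op e) j (nu' j) by apply/paired_op.
  split; first by move=> i; split; [have [] := paired_socle hA Jl (Hnu' i) | have [] := paired_socle hop Jr (Hop i)].
  have K1 : cancel nu nu' by move=> i; apply: (paired_inj hA (Hnu' (nu i))).
  have K2 : cancel nu' nu by move=> j; apply: (paired_inj hop (Hop (nu' j))).
  exists nu, nu'; split; first by exists nu'.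
  split; first by exists nu.
  move=> i; have [_ tl] := paired_socle hA Jl (Hnu' i).
  by have [_ tr] := paired_socle hop Jr (Hop i).
- by move=> [LN /nak_pF nak]; have [[ql _] [qr _]] := of_nak LN nak.
- move=> [ql qr]; have LN : locally_Noetherian e.
    by move=> i; split; [apply: frobenius_acc | apply: (@frobenius_acc K H (gop A) I (df_op e))].
  have nak : nakayama e.
    by apply: nak_of; [apply: frobenius_paired | apply: (frobenius_paired hop)].
  by have [[_ pl] [_ pr]] := of_nak LN nak.
Qed.
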